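(* Let $k\geq 1$ and let $s_2,s_3,\dots$ be a sequence of non-negative integers with only finitely many non-zero elements. The coefficient of $R_2^{s_2}R_3^{s_3}\cdots$ in the Kerov polynomial $K_k$ is equal to the number of triples $(\sigma_1,\sigma_2,q)$ with the following properties: (a) $\sigma_1,\sigma_2\in\mathfrak{S}(k)$ are such that $\sigma_1\circ\sigma_2=(1,2,\dots,k)$; (b) $|C(\sigma_2)|=s_2+s_3+\cdots$; (c) $|C(\sigma_1)|+|C(\sigma_2)|=2s_2+3s_3+4s_4+\cdots$; (d) $q:C(\sigma_2)\rightarrow\{2,3,\dots\}$ is a coloring of the cycles of $\sigma_2$ such that each color $i\in\{2,3,\dots\}$ is used exactly $s_i$ times; (e) for every set $A\subset C(\sigma_2)$ with $A\neq\emptyset$ and $A\neq C(\sigma_2)$ there are more than $\sum_{i\in A}\big(q(i)-1\big)$ cycles of $\sigma_1$ which intersect $\bigcup A$.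
   Context: $\mathfrak{S}(k)$ is the symmetric group on $\{1,\dots,k\}$. For a permutation $\pi$, $C(\pi)$ is the set of its cycles (including fixed points), each cycle being identified with its support; for $A\subseteq C(\pi)$, $\bigcup A$ is the union of the supports of the cycles in $A$. Normalized characters. For a Young diagram (partition) $\lambda$ with $n$ boxes, let $\rho^\lambda$ be the corresponding irreducible representation of $\mathfrak{S}(n)$ (the one-row diagram giving the trivial representation). For $k\geq 1$ put $\Sigma_k^\lambda=n(n-1)\cdots(n-k+1)\,\frac{\operatorname{Tr}\rho^\lambda((1,2,\dots,k))}{\dim\rho^\lambda}$ if $k\le n$ (the cycle being extended by fixed points to an element of $\mathfrak{S}(n)$) and $\Sigma_k^\lambda=0$ if $k>n$. Free cumulants. View $\lambda=(\lambda_1\ge\lambda_2\ge\cdots)$ as the planar region $\bigcup_j\{(x,y):0<x<\lambda_j,\ j-1<y<j\}$. For $n\geq 2$ let $S_n^\lambda=(n-1)\iint_{(x,y)\in\lambda}(x-y)^{n-2}\,dx\,dy$, and let $G^\lambda(z)=\frac1z\exp\big(\sum_{n\ge2}S_n^\lambda z^{-n}\big)$ (this is the Cauchy transform of Kerov's transition measure of $\lambda$). The free cumulants $R_2^\lambda,R_3^\lambda,\dots$ are defined by $(G^\lambda)^{\langle-1\rangle}(z)-\frac1z=\sum_{n\ge 2}R_n^\lambda z^{n-1}$, where $\langle -1\rangle$ denotes compositional inverse. (Equivalently, $R_k^\lambda=\lim_{s\to\infty}s^{-k}\Sigma^{s\lambda}_{k-1}$ for dilations $s\lambda$.) Kerov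 polynomial. It is known (Kerov, Biane) that for each $k\ge1$ there is a unique polynomial $K_k$ in indeterminates $R_2,R_3,\dots$, with integer coefficients, such that $\Sigma_k^\lambda=K_k(R_2^\lambda,R_3^\lambda,\dots)$ for every Young diagram $\lambda$; it is called the Kerov (character) polynomial. *)

(* Defs.v *)
(* MathComp with MathComp-Analysis.  The polynomials in infinitely many
   indeterminates are those of multinomials.monalg, imported without its
   notations, which clash with MathComp-Analysis: [malg K R] is the type
   {malg R[K]}, and [cmonom I] the type of commutative monomials over I. *)
From HB Require Import structures.
From mathcomp Require Import all_boot all_order all_algebra all_fingroup.
From mathcomp Require Import all_character.
From mathcomp Require Import all_classical all_reals all_analysis.
From mathcomp Require Import finmap complex.
From mathcomp Require Import -(notations) monalg.

Set Implicit Arguments.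
Unset Strict Implicit.
Unset Printing Implicit Defensive.

Import Order.TTheory GRing.Theory Num.Theory.

Local Open Scope ring_scope.

(* Points are numbered from 0: the cycle (1, 2, ..., k) of S(n) maps i to i + 1
   for i + 1 < k and k - 1 to 0, and fixes every i >= k.  [k] is replaced by
   [minn k n] so that this is a permutation without assuming k <= n. *)
Definition init_cycle_fun n k (i : 'I_n) : 'I_n :=
  insubd i (if i < minn k n then i.+1 %% minn k n else i)%N.

Lemma init_cycle_funE n k (i : 'I_n) : init_cycle_fun k i =
  (if i < minn k n then i.+1 %% minn k n else i)%N :> nat.
Proof.
rewrite /init_cycle_fun val_insubd; case: ifP => // /negP[].
case: ifP => // lt_im; rewrite (leq_trans _ (geq_minr k n)) //.
by rewrite ltn_mod (leq_ltn_trans _ lt_im).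
Qed.

Lemma init_cycle_fun_inj n k : injective (@init_cycle_fun n k).
Proof.
move=> i j /(congr1 (@nat_of_ord n)); rewrite !init_cycle_funE => e.
apply: val_inj => /=; move: (minn k n) e => m.
have aux a b : (a < m -> b < m -> a.+1 %% m = b.+1 %% m -> a = b)%N.
  move=> am bm /eqP; rewrite -(addn1 a) -(addn1 b) eqn_modDr => /eqP.
  by rewrite !modn_small.
have lt a : (a < m -> a.+1 %% m < m)%N.
  by move=> am; rewrite ltn_mod (leq_ltn_trans _ am).
case: ifP => im; case: ifP => jm e //; first exact: aux.
  by move: (lt _ im); rewrite e jm.
by move: (lt _ jm); rewrite -e im.
Qed.

Definition init_cycle n k : 'S_n := perm (@init_cycle_fun_inj n k).

Definition is_partition (lam : seq nat) : bool :=
  sorted geq lam && (0%N \notin lam).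

(* The boxes of lam are numbered row by row: box i lies in row
   [reshape_index lam i] and in column [reshape_offset lam i]. *)
Definition row_stab (lam : seq nat) : {set 'S_(sumn lam)} :=
  [set s : 'S_(sumn lam) |
    [forall i, reshape_index lam (s i) == reshape_index lam i]]%SET.

Definition col_stab (lam : seq nat) : {set 'S_(sumn lam)} :=
  [set s : 'S_(sumn lam) |
    [forall i, reshape_offset lam (s i) == reshape_offset lam i]]%SET.

Section Specht.
Variables (F : fieldType) (lam : seq nat).

Let G : {group 'S_(sumn lam)} := [set: 'S_(sumn lam)]%G.
Let aG := regular_repr F G.

Definition young_symmetrizer : 'rV[F]_#|G| :=
  gring_row (\sum_(p in row_stab lam) \sum_(q in col_stab lam)
               (-1) ^+ (q : bool) *: aG (p * q)%g).

(* The representation indexed by lam: the right ideal of the group algebra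
   generated by the Young symmetrizer.  The one-row diagram gives the trivial
   representation, the one-column diagram the signature. *)
Definition specht_mx : 'M[F]_#|G| := cyclic_mx aG young_symmetrizer.

Definition specht_repr : mx_representation F G (\rank specht_mx) :=
  submod_repr (cyclic_mx_module aG young_symmetrizer).

Definition normalized_character (k : nat) : F :=
  if (k <= sumn lam)%N then
    (sumn lam ^_ k)%:R *
      (\tr (specht_repr (init_cycle (sumn lam) k)) / (\rank specht_mx)%:R)
  else 0.

End Specht.

(* Formal power series, given by their sequences of coefficients; the n-th
   coefficient of the result depends on the inputs up to order n only. *)
Section FormalPowerSeries.
Variable F : fieldType.
Implicit Types f g : nat -> F.

Definition ps_trunc f n : {poly F} := \poly_(i < n.+1) f i.

Definition ps_mul f g n : F := (ps_trunc f n * ps_trunc g n)`_n.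

(* exp(f), for f without constant term *)
Definition ps_exp f n : F :=
  \sum_(j < n.+1) (j`!%:R)^-1 * (ps_trunc f n ^+ j)`_n.

(* f(g(z)), for g without constant term *)
Definition ps_comp f g n : F := (ps_trunc f n \Po ps_trunc g n)`_n.

(* multiplicative inverse, for f with non-zero constant term *)
Definition ps_inv f : nat -> F :=
  xget (fun=> 0)
    [set g : nat -> F | forall n, ps_mul f g n = (n == 0%N)%:R]%classic.

(* compositional inverse, for f = a z + ... with a != 0 *)
Definition ps_comp_inv f : nat -> F :=
  xget (fun=> 0)
    [set g : nat -> F |
      g 0%N = 0 /\ forall n, ps_comp f g n = (n == 1%N)%:R]%classic.

End FormalPowerSeries.

Section FreeCumulants.
Variable R : realType.

Variable lam : seq nat.

Definition diagram_region : set (R * R) :=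
  [set p | exists j : nat, 0 < p.1 < (nth 0%N lam j)%:R /\
                           j%:R < p.2 < j.+1%:R]%classic.

Definition shape_functional (n : nat) : R :=
  (n - 1)%:R *
  \int[(lebesgue_measure \x lebesgue_measure)%E]_(p in diagram_region)
    (p.1 - p.2) ^+ (n - 2).

(* G(z) = z^-1 exp(\sum_(n >= 2) S_n z^-n) as a power series in w = z^-1 *)
Definition cauchy_series (n : nat) : R :=
  if n is m.+1 then
    ps_exp (fun i => if (2 <= i)%N then shape_functional i else 0) m
  else 0.

(* If h is the compositional inverse of [cauchy_series], the compositional
   inverse of G is 1 / h(z) = z^-1 (h(z) / z)^-1, and R_n is its coefficient
   of z^(n - 1). *)
Definition free_cumulant (n : nat) : R :=
  ps_inv (fun m => ps_comp_inv cauchy_series m.+1) n.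

End FreeCumulants.

(* The indices of the indeterminates R_2, R_3, ...; also the colors. *)
Definition ge2 := {i : nat | (1 < i)%N}.

(* R_2^{s_2} R_3^{s_3} ... at R_i = x i *)
Definition eval_monomial (A : nzRingType) (x : nat -> A) (s : cmonom ge2) : A :=
  \prod_(i <- finsupp s) x (val i) ^+ s i.

Definition eval_poly (A : nzRingType) (x : nat -> A)
    (K : malg (cmonom ge2) int) : A :=
  mmap intr (eval_monomial x) K.

Definition is_kerov_polynomial (R : realType) (k : nat)
    (K : malg (cmonom ge2) int) : Prop :=
  forall lam : seq nat, is_partition lam ->
    normalized_character R[i] lam k = (eval_poly (free_cumulant R lam) K)%:C%C.

(* C(s), as a type *)
Definition cycles k (s : 'S_k) : finType := {c : {set 'I_k} | c \in porbits s}.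

Definition union_support k (s : 'S_k) (A : {set cycles s}) : {set 'I_k} :=
  (\bigcup_(c in A) val c)%SET.

Record colored_factorization (k : nat) := ColoredFactorization {
  sigma1 : 'S_k;
  sigma2 : 'S_k;
  coloring : {ffun cycles sigma2 -> ge2} }.

Definition admissible k (s : cmonom ge2) (t : colored_factorization k) : Prop :=
  let: ColoredFactorization s1 s2 q := t in
  [/\ forall i, s1 (s2 i) = init_cycle k k i,
      #|porbits s2| = (\sum_(i <- finsupp s) s i)%N,
      (#|porbits s1| + #|porbits s2|)%N
              = (\sum_(i <- finsupp s) val i * s i)%N,
      forall i : ge2, #|[set c | q c == i]%SET| = s i
    & forall A : {set cycles s2}, A != finset.set0 -> A != [set: cycles s2]%SET ->
              (\sum_(c in A) (val (q c) - 1) <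
               #|[set d in porbits s1 | d :&: union_support A != finset.set0]%SET|)%N].

(* Main.v *)
(** Both sides of Sigma_k = K_k(R_2, R_3, ...) are polynomials on
    multirectangular diagrams, with p_v rows put in the block of length
    Q_(rho v).  The left-hand side is given by the Stanley-Feray formula
      Sigma_k = \sum_(sigma1 sigma2 = (1 ... k)) (-1)^sigma1 N(sigma1, sigma2),
    N counting the maps from {1, ..., k} to the boxes for which the row is
    constant on the cycles of sigma2 and the column on those of sigma1; it
    follows from the explicit Young symmetrizer.  On the right-hand side,
    Lagrange inversion gives S_n = 1/n [w^n] (1 + \sum_m R_m w^m)^n, a
    triangular system, so K_k is also a polynomial in the S_n, whose values on
    these diagrams are explicit.

    One compares the coefficients of \prod_v p_v.  Reading off from them the
    exponents of the Q_i, for all chains of sets of variables, and summing over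
    the chains with signs, yields Moebius functions of the families
    {A : g(A) >= w(A)}, where g(A) counts the cycles of sigma1 whose neighbours
    all lie in A and w(v) = q(v) - 1.  As g is supermodular and sigma1, sigma2
    generate a transitive group, an argument of Weisner shows that such a
    function is -1 or 0 on the whole set, according to whether
    g(A) < w(A) for all proper nonempty A, which is condition (e) for the
    complements, and g = w on the whole set, which is (c).  For the products of
    the S_n the same sum is, up to the sign (-1)^l, the coefficient of
    \prod_v p_v after the substitution R_n := \sum_(q v = n) p_v, that is, the
    coefficient sought times the number of permutations of the l variables that
    preserve the colors q. *)

From HB Require Import structures.
Require Import Defs.
From mathcomp Require Import all_boot all_order all_algebra all_fingroup.
From mathcomp Require Import all_character.
From mathcomp Require Import all_classical all_reals all_analysis.
From mathcomp Require Import measurable_realfun.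
From mathcomp Require Import finmap complex.
From mathcomp Require Import -(notations) mpoly.
From mathcomp Require Import -(notations) monalg.
From mathcomp Require Import -(notations) fintype finset.
From mathcomp Require Import ring zify.

Set Implicit Arguments.
Unset Strict Implicit.
Unset Printing Implicit Defensive.

Import Order.TTheory GRing.Theory Num.Theory.

Local Open Scope ring_scope.

(** * Signed sums over chains of sets *)

(** The weights w = q - 1 come from the shape side. The coefficient of \prod_(v in B) p_v in S_n is
    a constant times the power n - |B| of a single Q_i. For a product of such factors the Moebius
    function is nonzero exactly when every factor has n - |B| equal to the sum of q(v) - 1 over B,
    that is, when n is the sum of the q(v); this is also the condition for S_n to contain \prod_(v
    in B) R_(q v). So the functional that turns shape functionals into cumulants is the one that
    tests condition (e) on the factorizations.

    A chain serves twice. It determines rho, a variable going to the block numbered by the first set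
    that contains it, so that the total exponents of the initial blocks are the values of g along
    the chain. And by Philip Hall's theorem the signed sum over chains of the indicator that all
    sets of the chain satisfy a condition is a Moebius function.

    The Q_i are numbers, and they describe a diagram only in decreasing order. The exponents are
    therefore read off by interpolation on grids in decreasing position. *)

Section ChainSums.
Variables (T : finType) (R : comNzRingType).
Implicit Types (A B : {set T}) (s : seq {set T}) (ok : pred {set T}).

(* The sum of [Phi] over the strict chains of nonempty sets that end with [A]
   and go on as [s], with sign (-1)^(number of sets up to [A]); [n] is fuel. *)
Fixpoint chain_sum n A s (Phi : seq {set T} -> R) : R :=
  if n is n'.+1 then
    if A == set0 then Phi s
    else - \sum_(B : {set T} | B \proper A) chain_sum n' B (A :: s) Phi
  else 0.

(* The Moebius function of the inclusion order restricted to the empty set and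
   the sets satisfying [ok], extended by 0. *)
Fixpoint mobius_rec (ok : pred {set T}) n A : R :=
  if n is n'.+1 then
    if A == set0 then 1
    else if ok A then - \sum_(B : {set T} | B \proper A) mobius_rec ok n' B
    else 0
  else 0.

Definition mobius ok A := mobius_rec ok #|A|.+1 A.

Lemma mobius_recE ok n A : (#|A| < n)%N -> mobius_rec ok n A = mobius ok A.
Proof.
rewrite /mobius; have [m] := ubnP #|A|.
elim: m A n => // m IH A [|n] //= ltAm ltAn.
case: ifP => // _; case: ifP => // _; congr (- _); apply: eq_bigr => B BA.
have ltBA := proper_card BA.
rewrite [LHS]IH ?(leq_trans ltBA) // [RHS]IH //; exact: leq_trans ltBA _.
Qed.

Lemma mobius0 ok : mobius ok set0 = 1.
Proof. by rewrite /mobius /= eqxx. Qed.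

Lemma mobius_notok ok A : A != set0 -> ~~ ok A -> mobius ok A = 0.
Proof. by rewrite /mobius /= => /negbTE-> /negbTE->. Qed.

Lemma mobiusE ok A : A != set0 -> ok A ->
  mobius ok A = - \sum_(B : {set T} | B \proper A) mobius ok B.
Proof.
rewrite {1}/mobius /= => /negbTE-> ->; congr (- _); apply: eq_bigr => B BA.
by rewrite mobius_recE // proper_card.
Qed.

Lemma sum_mobius_subset ok A : A != set0 -> ok A ->
  \sum_(B : {set T} | B \subset A) mobius ok B = 0.
Proof.
move=> A0 okA; rewrite (bigD1 A) //= mobiusE // addrC; apply/eqP.
rewrite subr_eq0; apply/eqP; apply: eq_bigl => B.
by rewrite properEneq andbC.
Qed.

(** Philip Hall's theorem. A set that fails [ok] kills every continuation of the chain, so the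
    recursion of [chain_sum] becomes that of [mobius_rec]. *)
Lemma chain_sum_all ok n A s :
  chain_sum n A s (fun s => (all ok s)%:R) = (all ok s)%:R * mobius_rec ok n A.
Proof.
elim: n A s => [|n IH] A s /=; first by rewrite mulr0.
case: ifP => [_|A0]; first by rewrite mulr1.
under eq_bigr => B _ do rewrite IH /=.
rewrite -big_distrr /=; case: (ok A) => /=; rewrite ?mul0r ?mulr0 ?oppr0 //.
by rewrite mulrN.
Qed.

Lemma chain_sum_full ok :
  chain_sum #|T|.+1 [set: T]%SET [::] (fun s => (all ok s)%:R)
  = mobius ok [set: T]%SET.
Proof. by rewrite chain_sum_all mul1r /mobius cardsT. Qed.

Lemma chain_sum_linear n A s (I : Type) (r : seq I) (c : I -> R)
    (Phi : I -> seq {set T} -> R) :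
  chain_sum n A s (fun s => \sum_(i <- r) c i * Phi i s) =
  \sum_(i <- r) c i * chain_sum n A s (Phi i).
Proof.
elim: n A s => [|n IH] A s /=.
  by rewrite big1 // => i _; rewrite mulr0.
case: ifP => // _; under eq_bigr => B _ do rewrite IH.
rewrite exchange_big /= -sumrN; apply: eq_bigr => i _.
by rewrite mulrN -big_distrr.
Qed.

Definition proper_chain s := sorted (fun A B => A \proper B) (set0 :: s).

(** Sets are only added at the front, so the last set of the chain never changes; the two
    functionals are compared only on strict chains with that end. *)
Lemma eq_chain_sum n A s (Phi Psi : seq {set T} -> R) :
  path (fun A B => A \proper B) A s ->
  (forall s', proper_chain s' ->
     last A s = last set0 s' -> Phi s' = Psi s') ->
  chain_sum n A s Phi = chain_sum n A s Psi.
Proof.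
elim: n A s => [|n IH] A s //= pAs e.
case: ifP => [/eqP A0|A0]; first by rewrite A0 in pAs e; exact: e.
congr (- _); apply: eq_bigr => B BA; apply: IH; first by rewrite /= BA.
exact: e.
Qed.

(* Weisner's argument: the values of the Moebius function over the sets [A]
   with [A :|: X = C] cancel, where [X = D :&: B0]. *)
Lemma mobius_no_complement (ok : pred {set T}) (B0 : {set T}) :
  B0 != [set: T]%SET ->
  (forall D, ok D -> D :|: B0 = [set: T]%SET -> D :&: B0 != set0) ->
  (forall D A, ok D -> D :|: B0 = [set: T]%SET -> A \subset D ->
     (A != set0 -> ok A) -> A :|: B0 != [set: T]%SET ->
     ok (A :|: (D :&: B0))) ->
  mobius ok [set: T]%SET = 0.
Proof.
move=> B0T noC okU.
(* The vanishing is proved by induction for every [D] that together with [B0] covers everything. *)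
suff H m (D : {set T}) : (#|D| < m)%N -> D :|: B0 = [set: T]%SET -> mobius ok D = 0.
  by apply: (H _ _ (ltnSn _)); rewrite setTU.
elim: m D => // m IHm D; rewrite ltnS => leDm DB0.
have D0 : D != set0.
  by apply: contraNneq B0T => D0; rewrite D0 set0U in DB0; rewrite DB0.
have [okD|nokD] := boolP (ok D); last exact: mobius_notok.
set X := D :&: B0; have X0 : X != set0 by exact: noC.
have XD : X \subset D by exact: subsetIl.
have XB0 : X \subset B0 by exact: subsetIr.
(* If [C] violates [ok], then by the closure property no nonempty set of its fibre satisfies [ok],
   and the empty set does not lie in the fibre. *)
have bad (A C : {set T}) : A :|: X = C -> C \subset D -> C :|: B0 != [set: T]%SET ->
    ~~ ok C -> mobius ok A = 0.
  move=> eAC CD CB0 nokC; have [A0|A0] := eqVneq A set0.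
    exfalso; move/negP: nokC; apply; rewrite -eAC A0; apply: okU => //.
    - by rewrite sub0set.
    - by rewrite eqxx.
    - by rewrite set0U.
  apply: mobius_notok => //; apply: contra nokC => okA; rewrite -eAC.
  apply: okU => //; first by rewrite (subset_trans _ CD) // -eAC subsetUl.
  apply: contraNneq CB0 => AB0; rewrite -eAC -setUA.
  by rewrite (setUidPr XB0) AB0.
(* The subsets of [C] are spread over the fibres of [A :|: X]; those over smaller sets cancel by
   induction, hence so does the one over [C]. *)
have fib n (C : {set T}) : (#|C| < n)%N -> X \subset C -> C \subset D ->
    C :|: B0 != [set: T]%SET ->
    \sum_(A : {set T} | A :|: X == C) mobius ok A = 0.
  elim: n C => // n IHn C; rewrite ltnS => leCn XC CD CB0.
  have [okC|nokC] := boolP (ok C); last first.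
    by rewrite big1 // => A /eqP eAC; exact: (bad _ _ eAC).
  have C0 : C != set0.
    by apply: contraNneq X0 => C0; rewrite C0 finset.subset0 in XC.
  have := sum_mobius_subset C0 okC.
  rewrite (partition_big (fun A => A :|: X)
             (fun E => (X \subset E) && (E \subset C))) /=; last first.
    by move=> A eAC; rewrite subsetUr subUset eAC XC.
  rewrite (bigD1 C) /=; last by rewrite XC subxx.
  rewrite [X in _ + X]big1 ?addr0 => [e|E /andP[/andP[XE EC] EneC]].
    rewrite -[RHS]e; apply: eq_bigl => A; apply/eqP/andP => [<-|[_ /eqP //]].
    by rewrite subsetUl.
  have ED : E \subset D by exact: subset_trans CD.
  have EB0 : E :|: B0 != [set: T]%SET.
    apply: contraNneq CB0 => EB0; rewrite -subTset -EB0.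
    exact: setSU.
  rewrite (eq_bigl (fun A : {set T} => A :|: X == E)).
    apply: IHn => //; apply: leq_trans leCn; apply: proper_card.
    by rewrite properEneq EneC.
  move=> A; apply/andP/eqP => [[_ /eqP //]|AE]; rewrite -AE; split => //.
  by rewrite (subset_trans _ EC) // -AE subsetUl.
have low : \sum_(A : {set T} | (A \subset D) && (A :|: B0 != [set: T]%SET))
    mobius ok A = 0.
  rewrite (partition_big (fun A => A :|: X) (fun E => [&& X \subset E,
     E \subset D & E :|: B0 != [set: T]%SET])) /=; last first.
    move=> A /andP[AD AB0]; rewrite subsetUr subUset AD XD /=.
    by rewrite -setUA (setUidPr XB0).
  rewrite big1 // => E /and3P[XE ED EB0].
  rewrite (eq_bigl (fun A : {set T} => A :|: X == E)).
    exact: (fib _ _ (ltnSn _)).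
  move=> A; apply/andP/eqP => [[_ /eqP //]|AE]; rewrite -AE; split => //.
  rewrite (subset_trans _ ED) -?AE ?subsetUl //=.
  by apply: contraNneq EB0 => AB0; rewrite -AE -setUA (setUidPr XB0) AB0.
(* By [low] only the [A] with [A :|: B0] full remain, and all of them but [D] vanish by the
   induction hypothesis. *)
have := sum_mobius_subset D0 okD.
rewrite (bigID (fun A : {set T} => A :|: B0 != [set: T]%SET)) /= low add0r.
rewrite (bigD1 D) /=; last by rewrite subxx DB0 eqxx.
rewrite [X in _ + X]big1 ?addr0 // => A /andP[/andP[AD]].
rewrite negbK => /eqP AB0 AneD; apply: IHm => //.
by apply: leq_trans leDm; apply: proper_card; rewrite properEneq AneD.
Qed.

Lemma mobius_minus_one ok : [set: T]%SET != set0 -> ok [set: T]%SET ->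
  (forall A, A != set0 -> A != [set: T]%SET -> ~~ ok A) ->
  mobius ok [set: T]%SET = -1.
Proof.
move=> T0 okT nok; rewrite mobiusE // (bigD1 set0) /=; last first.
  by rewrite properEneq eq_sym T0 sub0set.
rewrite mobius0 big1 ?addr0 // => A /andP[AT A0].
by apply: mobius_notok => //; apply: nok => //; move: AT; rewrite properEneq => /andP[].
Qed.

End ChainSums.

(** * Moebius functions of Hall conditions *)

Section HallFunctions.
Variables (T : finType) (R : comNzRingType).
Implicit Types (A B : {set T}) (w : T -> nat) (g : {set T} -> nat).

Definition weight w A := (\sum_(v in A) w v)%N.

(** The chains considered end with the full set; asking for equality there fixes the total degree
    and becomes condition (c). *)
Definition hall_ok w g : pred {set T} := fun A =>
  (weight w A <= g A)%N && ((A == [set: T]%SET) ==> (g A == weight w A)).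

Definition supermodular g :=
  g set0 = 0%N /\ forall A B, (g A + g B <= g (A :|: B) + g (A :&: B))%N.

Lemma weightUI w A B :
  (weight w A + weight w B = weight w (A :|: B) + weight w (A :&: B))%N.
Proof.
rewrite /weight !(big_mkcond (fun v => v \in _)) /= -!big_split /=.
apply: eq_bigr => v _; rewrite in_setU in_setI.
by case: (v \in A) (v \in B) => -[]; rewrite ?addn0 ?add0n.
Qed.

Lemma weight0 w : weight w set0 = 0%N.
Proof. by rewrite /weight big_set0. Qed.

(** Weisner's argument for a [B0] of largest excess g - w. The excess of [A :&: B0] does not exceed
    that of [B0], so by supermodularity [A :|: B0] has at least the excess of [A]. Moreover
    [A :|: (D :&: B0)] is [D :&: (A :|: B0)], where supermodularity applies again because the full
    set has excess 0. The last hypothesis forbids the complement of [B0] as a [D]. *)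
Lemma mobius_hall_max w g B0 : supermodular g ->
  g [set: T]%SET = weight w [set: T]%SET ->
  B0 != set0 -> B0 != [set: T]%SET -> (weight w B0 <= g B0)%N ->
  (forall B, B != set0 -> B != [set: T]%SET ->
     (g B + weight w B0 <= g B0 + weight w B)%N) ->
  (g (~: B0) < weight w (~: B0))%N ->
  mobius R (hall_ok w g) [set: T]%SET = 0.
Proof.
move=> [g0 sup] gT B00 B0T okB0 maxB0 nokC.
have okE A : hall_ok w g A = (weight w A <= g A)%N.
  rewrite /hall_ok; case: eqP => [->|_]; last by rewrite andbT.
  by rewrite gT leqnn eqxx.
have w0 := weight0 w.
have okU A : (weight w A <= g A)%N -> A :|: B0 != [set: T]%SET ->
    (weight w (A :|: B0) <= g (A :|: B0))%N.
  move=> okA AB0T; have := sup A B0; have := weightUI w A B0.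
  have : (g (A :&: B0) + weight w B0 <= g B0 + weight w (A :&: B0))%N.
    have [->|AB0] := eqVneq (A :&: B0) set0; first by rewrite g0 w0; lia.
    apply: maxB0 => //; apply: contraNneq B0T => AB0T'.
    by rewrite -subTset -AB0T' subsetIr.
  lia.
apply: mobius_no_complement B0T _ _ => [D|D A]; rewrite !okE.
  move=> okD DB0; apply/eqP => DB0'; move: nokC.
  suff -> : ~: B0 = D by rewrite ltnNge okD.
  apply/setP => v; move/setP/(_ v): DB0; move/setP/(_ v): DB0'.
  by rewrite !inE; case: (v \in D); case: (v \in B0).
move=> okD DB0 AD okA AB0.
have okA' : (weight w A <= g A)%N.
  by have [->|/okA] := eqVneq A set0; rewrite ?w0 // okE.
have := okU _ okA' AB0.
have := sup D (A :|: B0); have := weightUI w D (A :|: B0).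
have -> : D :|: (A :|: B0) = [set: T]%SET.
  by rewrite setUCA DB0 setUT.
rewrite setIUr (setIidPr AD) gT; lia.
Qed.

(** If some proper nonempty set is ok, take [B0] of largest excess: then g(~B0) < g(T) - g(B0) <=
    w(T) - w(B0) = w(~B0), and Weisner's argument applies. Otherwise only the empty and the full set
    are left. *)
Lemma mobius_hall_connected w g : supermodular g -> (0 < #|T|)%N ->
  (forall A, A != set0 -> A != [set: T]%SET ->
     (g A + g (~: A) < g [set: T]%SET)%N) ->
  mobius R (hall_ok w g) [set: T]%SET =
  - ((g [set: T]%SET == weight w [set: T]%SET) &&
     [forall A : {set T}, (A != set0) ==> (A != [set: T]%SET) ==>
        (g A < weight w A)%N])%:R.
Proof.
move=> sup T0 conn.
have T0' : [set: T]%SET != set0 by rewrite -card_gt0 cardsT.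
have [gT|gT] := eqVneq; last first.
  rewrite mobius_notok ?oppr0 //= /hall_ok eqxx /= negb_and.
  by rewrite gT orbT.
have okE A : hall_ok w g A = (weight w A <= g A)%N.
  rewrite /hall_ok; case: eqP => [->|_]; last by rewrite andbT.
  by rewrite gT leqnn eqxx.
case: forallP => [no|/forallP/forallPn[/= A]].
  rewrite mobius_minus_one //= ?okE ?gT // => A A0 AT.
  by move: (no A); rewrite A0 AT /= okE -ltnNge.
rewrite !negb_imply -leqNgt => /and3P[A0 AT okA] /=; rewrite oppr0.
pose P B := (B != set0) && (B != [set: T]%SET).
have PA : P A by apply/andP.
have wB B : (weight w B <= weight w [set: T]%SET)%N.
  by rewrite [leqRHS](big_setID B) /= setTI leq_addr.
(* The excess g - w is shifted by the total weight to stay in [nat]. *)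
have [B0 /andP[B00 B0T] maxB0] := arg_maxnP
  (fun B => g B + (weight w [set: T]%SET - weight w B))%N PA.
have max' B : P B -> (g B + weight w B0 <= g B0 + weight w B)%N.
  move=> /maxB0 /=; have := wB B; have := wB B0; lia.
have okB0 : (weight w B0 <= g B0)%N by have := max' _ PA; move: okA; lia.
apply: (mobius_hall_max (B0 := B0)) => // [B Bn0 BnT|].
  by apply: max'; apply/andP.
have := conn _ B00 B0T; have := weightUI w B0 (~: B0).
rewrite setUCr setICr weight0 gT; move: okB0; lia.
Qed.

End HallFunctions.

Section EdgeFunctions.
Variables (T J : finType) (V : J -> {set T}) (d : J -> nat).

(* [d j] points with neighbourhood [V j] *)
Definition edge_fun (A : {set T}) := (\sum_(j | V j \subset A) d j)%N.

Lemma edge_fun_supermodular : (forall j, V j != set0) -> supermodular edge_fun.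
Proof.
move=> V0; split=> [|A B].
  by apply: big_pred0 => j; rewrite finset.subset0 (negbTE (V0 j)).
rewrite /edge_fun !(big_mkcond (fun j => V j \subset _)) /= -!big_split /=.
apply: leq_sum => j _; rewrite subsetI.
have [jA|_] := boolP (V j \subset A).
  have -> : V j \subset A :|: B by rewrite (subset_trans jA) // subsetUl.
  by case: (V j \subset B); rewrite ?addn0.
have [jB|_] := boolP (V j \subset B); last by case: ifP.
have -> : V j \subset A :|: B by rewrite (subset_trans jB) // subsetUr.
by rewrite /= addn0.
Qed.

End EdgeFunctions.

Section BlockFunctions.
Variables (T I : finType) (R : numDomainType).
Variables (f : T -> I) (d : I -> nat) (w : T -> nat).
Hypothesis f_surj : forall j, exists v, f v = j.
Hypothesis w_gt0 : forall v, (0 < w v)%N.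

Definition block j : {set T} := [set v | f v == j]%SET.

Definition block_fun (A : {set T}) := (\sum_(j | block j \subset A) d j)%N.

Lemma block_neq0 j : block j != set0.
Proof. by have [v vj] := f_surj j; apply/set0Pn; exists v; rewrite inE vj. Qed.

Lemma block_fun_supermodular : supermodular block_fun.
Proof. by apply: edge_fun_supermodular; exact: block_neq0. Qed.

Lemma block_funT : block_fun [set: T]%SET = (\sum_j d j)%N.
Proof. by apply: eq_bigl => j; rewrite subsetT. Qed.

Lemma weightT_block : weight w [set: T]%SET = (\sum_j weight w (block j))%N.
Proof.
rewrite /weight (partition_big f xpredT) //=.
by apply: eq_bigr => j _; apply: eq_bigl => v; rewrite !inE.
Qed.

Lemma block_in v : v \in block (f v).
Proof. by rewrite inE. Qed.

Lemma sum_sign_subset (J : {set I}) : J != set0 ->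
  \sum_(K : {set I} | K \subset J) (-1) ^+ #|K| = 0 :> R.
Proof.
move=> /set0Pn[j jJ].
rewrite (bigID (fun K : {set I} => j \in K)) /=.
rewrite (reindex_onto (fun K => j |: K) (fun K => K :\ j)) /=; last first.
  by move=> K /andP[_ jK]; rewrite setD1K.
rewrite (eq_bigl (fun K : {set I} => (K \subset J) && (j \notin K))).
  by rewrite -big_split big1 //= => K /andP[_ jK]; rewrite cardsU1 jK exprS mulN1r addNr.
move=> K; rewrite subUset sub1set jJ setU11 /= andbT; congr (_ && _).
apply/eqP/idP => [<-|jK]; first by rewrite !inE eqxx.
by rewrite setU1K.
Qed.

(** As all weights are positive, a set is ok exactly when it is a union of blocks, and these unions
    form the Boolean lattice of subsets of [I]. *)
Lemma mobius_block_balanced : (forall j, d j = weight w (block j)) ->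
  mobius R (hall_ok w block_fun) [set: T]%SET = (-1) ^+ #|I|.
Proof.
move=> dw.
(* What [A] lacks to equality is the weight of its points whose block is not contained in [A]. *)
have gE A : (block_fun A + weight w [set v in A | ~~ (block (f v) \subset A)]%SET
             = weight w A)%N.
  rewrite /block_fun /weight (eq_bigr _ (fun j _ => dw j)).
  rewrite [RHS](bigID (fun v => block (f v) \subset A)) /=; congr (_ + _)%N.
    rewrite [RHS](partition_big f (fun j => block j \subset A)) /=; last first.
      by move=> v /andP[].
    apply: eq_bigr => j jA; apply: eq_bigl => v; rewrite inE.
    case: eqP => [vj|]; last by rewrite andbF.
    rewrite vj jA !andbT; apply/esym; move/subsetP: jA; apply.
    by rewrite inE vj.
  by apply: eq_bigl => v; rewrite inE.
pose sat (A : {set T}) := [forall v in A, block (f v) \subset A].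
have okE A : hall_ok w block_fun A = sat A.
  have -> : hall_ok w block_fun A = (weight w A <= block_fun A)%N.
    rewrite /hall_ok; case: eqP => [->|_]; last by rewrite andbT.
    rewrite block_funT weightT_block (eq_bigr _ (fun j _ => dw j)).
    by rewrite leqnn eqxx.
  rewrite -(gE A) -{2}[block_fun A]addn0 leq_add2l leqn0 sum_nat_eq0.
  apply/forallP/forallP => H v; apply/implyP.
    move=> vA; move: (H v); rewrite inE vA /=.
    by case: (_ \subset _) => //=; rewrite eqn0Ngt w_gt0.
  by rewrite inE => /andP[vA]; move: (H v); rewrite vA /= => ->.
suff H n (A : {set T}) : (#|A| < n)%N -> sat A ->
    mobius R (hall_ok w block_fun) A = (-1) ^+ #|[set j | block j \subset A]|.
  rewrite (H _ _ (ltnSn _)); last by apply/forallP => v; rewrite subsetT implybT.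
  by congr (_ ^+ _); rewrite -cardsT; apply: eq_card => j; rewrite !inE subsetT.
elim: n A => // n IHn A leAn satA.
have [->|A0] := eqVneq A set0.
  rewrite mobius0 -[LHS](expr0 (-1)); congr (_ ^+ _); apply/esym/eqP.
  rewrite cards_eq0; apply/eqP/setP => j.
  by rewrite !inE finset.subset0 (negbTE (block_neq0 j)).
rewrite mobiusE ?okE //.
set J := [set j | block j \subset A].
have [v0 v0A] := set0Pn _ A0.
have J0 : J != set0.
  by apply/set0Pn; exists (f v0); rewrite inE; move/forallP/(_ v0): satA; rewrite v0A.
have := sum_sign_subset J0; rewrite (bigD1 J) //= => /eqP; rewrite addr_eq0.
move=> /eqP ->; congr (- _).
rewrite (bigID sat) /= [X in _ + X]big1 ?addr0 => [|B /andP[BA nB]]; last first.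
  have [B0|B0] := eqVneq B set0; last by rewrite mobius_notok ?okE.
  by case/negP: nB; apply/forallP => v; rewrite B0 inE.
have satP (B : {set T}) : sat B ->
    [set v | f v \in [set j | block j \subset B]]%SET = B.
  move=> /forallP sB; apply/setP => v; rewrite !inE; apply/idP/idP => [/subsetP|vB].
    by apply; exact: block_in.
  by move: (sB v); rewrite vB.
have blockK (K : {set I}) :
    [set j | block j \subset [set v | f v \in K]%SET] = K.
  apply/setP => j; rewrite inE; apply/subsetP/idP => [|jK v].
    have [v <-] := f_surj j; move=> /(_ v (block_in v)); by rewrite inE.
  by rewrite !inE => /eqP ->.
rewrite (reindex_onto (fun K : {set I} => [set v | f v \in K]%SET)
   (fun B : {set T} => [set j | block j \subset B]%SET)) /=; last first.
  by move=> B /andP[_ sB]; exact: satP.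
have satK (K : {set I}) : sat [set v | f v \in K]%SET.
  apply/forallP => v; apply/implyP; rewrite inE => vK.
  by apply/subsetP => u; rewrite !inE => /eqP ->.
have subK (K K' : {set I}) : ([set v | f v \in K]%SET \subset [set v | f v \in K']%SET)
    = (K \subset K').
  apply/subsetP/subsetP => [H j jK|H v]; last by rewrite !inE; exact: H.
  by have [v vj] := f_surj j; move: (H v); rewrite !inE vj; apply.
rewrite (eq_bigl (fun K : {set I} => (K \subset J) && (K != J))).
  apply: eq_bigr => K /andP[KJ KneJ].
  have ltK : (#|[set v | f v \in K]%SET| < n)%N.
    have leAn' : (#|A| <= n)%N by [].
    apply: leq_trans leAn'; rewrite -(satP _ satA); apply: proper_card.
    rewrite properE !subK KJ /=; apply: contra KneJ => JK.
    by rewrite eqEsubset KJ.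
  by rewrite (IHn _ ltK (satK K)) blockK.
move=> K; rewrite satK blockK eqxx !andbT -{1}(satP _ satA) properE !subK -/J.
by rewrite eqEsubset; case: (K \subset J).
Qed.

(** Without balance but with the right total, some block has [d] above its weight. The largest
    excess is then positive, and this takes the place of connectedness in making the complement of
    [B0] fail. *)
Lemma mobius_block :
  mobius R (hall_ok w block_fun) [set: T]%SET =
  (-1) ^+ #|I| * [forall j, d j == weight w (block j)]%:R.
Proof.
case: (altP forallP) => [H|nH].
  by rewrite mulr1 mobius_block_balanced // => j; apply/eqP.
rewrite mulr0.
have [j0 dj0] := forallPn nH.
have T0 : [set: T]%SET != set0.
  by have [v _] := f_surj j0; apply/set0Pn; exists v; rewrite inE.
have [gT|gT] := eqVneq (block_fun [set: T]%SET) (weight w [set: T]%SET); last first.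
  by apply: mobius_notok => //; rewrite /hall_ok eqxx /= negb_and gT orbT.
have SM := block_fun_supermodular; have [g0 sup] := SM.
have wle (A B : {set T}) : A \subset B -> (weight w A <= weight w B)%N.
  by move=> AB; rewrite [leqRHS](big_setID A) /= (setIidPr AB) leq_addr.
have [j1 dj1] : exists j, (weight w (block j) < d j)%N.
  apply/existsP; apply: contraT; rewrite negb_exists => /forallP le.
  have := gT; rewrite block_funT weightT_block => /eqP.
  rewrite (bigD1 j0) //= [in X in _ == X](bigD1 j0) //=.
  have lt0 : (d j0 < weight w (block j0))%N.
    by rewrite ltn_neqAle dj0 leqNgt le.
  have : (\sum_(i | i != j0) d i <= \sum_(i | i != j0) weight w (block i))%N.
    by apply: leq_sum => i _; rewrite leqNgt le.
  move: lt0; lia.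
have gj1 : (d j1 <= block_fun (block j1))%N.
  by rewrite /block_fun (bigD1 j1) //= leq_addr.
pose P B := (B != set0) && (B != [set: T]%SET).
have Pj1 : P (block j1).
  rewrite /P block_neq0 /=; apply: contraTneq dj1 => bT.
  rewrite -leqNgt bT -gT -bT; exact: gj1.
have [B0 /andP[B00 B0T] maxB0] := arg_maxnP
  (fun B => block_fun B + (weight w [set: T]%SET - weight w B))%N Pj1.
have max' B : P B -> (block_fun B + weight w B0 <= block_fun B0 + weight w B)%N.
  move=> /maxB0 /=; have := wle B _ (subsetT B).
  by have := wle B0 _ (subsetT B0); lia.
have posB0 : (weight w B0 < block_fun B0)%N by have := max' _ Pj1; lia.
apply: (@mobius_hall_max _ _ _ _ B0) => //.
- exact: ltnW.
- by move=> B Bn0 BnT; apply: max'; apply/andP.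
have := sup B0 (~: B0); have := weightUI w B0 (~: B0).
rewrite setUCr setICr weight0 gT g0; move: posB0; lia.
Qed.

End BlockFunctions.

(** * Coefficients from values on grids *)

(** The coefficients are a column of the inverse Vandermonde matrix of the nodes b, ..., b + D. *)
Lemma power_sum_dual (F : numFieldType) (b D E : nat) : (E <= D)%N ->
  exists k : 'I_D.+1 -> F, forall e, (e <= D)%N ->
    \sum_j k j * (b + j)%:R ^+ e = (e == E)%:R.
Proof.
move=> leED.
pose a : 'rV[F]_D.+1 := \row_j (b + j)%:R.
have unitV : Vandermonde D.+1 a \in unitmx.
  rewrite unitmxE det_Vandermonde unitfE.
  apply/prodf_neq0 => i _; apply/prodf_neq0 => j ltij.
  by rewrite !mxE subr_eq0 eqr_nat eqn_add2l gtn_eqF.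
pose K := invmx (Vandermonde D.+1 a) *m delta_mx (inord E) (ord0 : 'I_1).
exists (fun j => K j ord0) => e leeD.
have := mulKVmx unitV (delta_mx (inord E) (ord0 : 'I_1)); rewrite -/K.
move/matrixP/(_ (inord e) ord0); rewrite !mxE eqxx andbT.
rewrite -val_eqE /= !inordK ?ltnS // => <-.
by apply: eq_bigr => j _; rewrite !mxE inordK ?ltnS // mulrC.
Qed.

(* The values on a product of intervals of length D + 1 determine a polynomial
   of degree at most D in each variable, and the intervals can be put in
   decreasing position. *)
Lemma grid_functional (F : numFieldType) m D (phi : {ffun 'I_m -> nat} -> F) :
  exists (J : finType) (kap : J -> F) (x : J -> 'I_m -> nat),
    (forall t i, (0 < x t i)%N) /\
    (forall t (i j : 'I_m), (i < j)%N -> (x t j < x t i)%N) /\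
    forall e : {ffun 'I_m -> nat}, (forall i, (e i <= D)%N) ->
      \sum_t kap t * \prod_i (x t i)%:R ^+ e i = phi e.
Proof.
pose J : finType := {ffun 'I_m -> 'I_D.+1}.
have dual (iE : 'I_m * 'I_D.+1) := power_sum_dual F
    ((m - iE.1) * D.+1) (ltn_ord iE.2 : (iE.2 <= D)%N).
have [k kE] := fin_all_exists dual.
(* The nodes of variable [i] are the D + 1 integers from (m - i)(D + 1) on: they are positive, and a
   larger [i] has smaller nodes. *)
pose x (t : J) (i : 'I_m) := ((m - i) * D.+1 + t i)%N.
exists J, (fun t : J => \sum_(E : J) phi [ffun i => E i : nat] * \prod_(i < m) k (i, E i) (t i)), x.
split; first by move=> t i; rewrite /x addn_gt0 muln_gt0 subn_gt0 ltn_ord.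
split=> [t i j ltij|e leD].
  rewrite /x; have := ltn_ord (t j); have := ltn_ord j; have := ltn_ord (t i).
  move: (nat_of_ord (t i)) (nat_of_ord (t j)) => u v.
  move: (nat_of_ord i) (nat_of_ord j) ltij => a b ltab.
  move=> ltu ltb ltv; rewrite ltnS in ltv.
  have -> : (m - a = (m - b) + (b - a))%N by lia.
  rewrite mulnDl -addnA ltn_add2l; apply: leq_trans (leq_addr _ _).
  by apply: leq_trans (leq_pmull _ _); rewrite ?subn_gt0.
under eq_bigr => t _ do rewrite mulr_suml.
rewrite exchange_big /= (bigD1 [ffun i => inord (e i)]) //=.
have term (E : J) : \sum_(t : J) phi [ffun i => E i : nat] *
    (\prod_(i < m) k (i, E i) (t i)) * \prod_(i < m) (x t i)%:R ^+ e i =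
    phi [ffun i => E i : nat] * \prod_(i < m) (e i == E i)%:R.
  under eq_bigr => t _ do rewrite -mulrA -big_split /=.
  rewrite -mulr_sumr; congr (_ * _).
  rewrite -(bigA_distr_bigA (fun i j => k (i, E i) j * ((m - i) * D.+1 + j)%:R ^+ e i)).
  by apply: eq_bigr => i _; rewrite kE.
rewrite term big1 ?mulr1 => [|i _]; last by rewrite ffunE inordK ?eqxx // ltnS.
rewrite big1 ?addr0 => [|E neq].
  by congr phi; apply/ffunP => i; rewrite !ffunE inordK // ltnS.
rewrite term; have [i nei] : exists i, e i != E i.
  apply/existsP; apply: contraR neq; rewrite negb_exists => /forallP eE.
  by apply/eqP/ffunP => i; rewrite ffunE (eqP (negbNE (eE i))) inord_val.
by rewrite (bigD1 i) //= (negbTE nei) mul0r mulr0.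
Qed.

(** * Characters of Young symmetrizers and the Stanley-Feray formula *)

Section QuasiIdempotent.
Variable F : fieldType.

(** [L] factors as C b through a basis [b] of its row space, with b C = alpha; hence tr(C b B) =
    tr(C S b) = tr(S b C). *)
Lemma trace_quasi_idempotent n r (L B : 'M[F]_n) (b : 'M[F]_(r, n)) (S : 'M[F]_r)
    (alpha : F) : L *m L = alpha *: L -> row_free b -> (b :=: L)%MS ->
  S *m b = b *m B -> \tr (L *m B) = alpha * \tr S.
Proof.
move=> LL freeb bL SbB.
have /submxP[C LC] : (L <= b)%MS by rewrite bL.
have /submxP[D bD] : (b <= L)%MS by rewrite bL.
have bC : b *m C = alpha%:M.
  apply: (row_free_inj freeb); rewrite -mulmxA -LC {1}bD -mulmxA LL.
  by rewrite -scalemxAr -bD mul_scalar_mx.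
by rewrite {1}LC -mulmxA -SbB mxtrace_mulC -mulmxA bC mul_mx_scalar mxtraceZ.
Qed.

Variables (gT : finGroupType) (G : {group gT}).
Local Notation aG := (regular_repr F G).

Lemma mul_regular_mx (y : 'rV[F]_#|G|) h j : h \in G ->
  (y *m aG h) 0 j = y 0 (gring_index G (enum_val j * h^-1)%g).
Proof.
move=> Gh; rewrite mxE (bigD1 (gring_index G (enum_val j * h^-1)%g)) //=.
rewrite big1 ?addr0 => [|i].
  rewrite !mxE gring_indexK ?groupM ?groupV ?enum_valP // mulgKV gring_valK.
  by rewrite !eqxx mulr1.
apply: contraNeq; rewrite !mxE eqxx /=.
case: (j =P _) => [->|_]; last by rewrite mulr0 eqxx.
by rewrite gring_indexK ?groupM ?enum_valP // mulgK gring_valK.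
Qed.

Variables (y : 'rV[F]_#|G|) (alpha : F).
Hypothesis y_quasi : y *m gring_mx aG y = alpha *: y.
Local Notation M := (submod_repr (cyclic_mx_module aG y)).

(** [L] is left multiplication by [y] on the group algebra. Its row space is the cyclic module, and
    its diagonal after right multiplication by [g] consists of the coefficients of [y] at the
    conjugates of the inverse of [g]. *)
Lemma trace_cyclic_mx (g : gT) : g \in G ->
  alpha * \tr (M g) =
  \sum_(x in G) y 0 (gring_index G (x * g^-1 * x^-1)%g).
Proof.
move=> Gg.
pose L := enveloping_algebra_mx aG *m lin_mul_row y.
have rowL (x : 'rV_#|G|) : x *m L = y *m gring_mx aG x.
  by rewrite mulmxA mul_rV_lin1.
have rowLi i : row i L = y *m aG (enum_val i).
  rewrite rowE rowL; congr (_ *m _).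
  by rewrite /gring_mx /= -rowE rowK mxvecK.
rewrite -(@trace_quasi_idempotent _ _ L (aG g) (row_base (cyclic_mx aG y))).
- rewrite /mxtrace [RHS](reindex_onto (@enum_val gT (mem G)) (gring_index G)).
    apply: eq_big => [i|i _]; first by rewrite enum_valP gring_valK eqxx.
    have -> : (L *m aG g) i i = (row i (L *m aG g)) 0 i by rewrite [RHS]mxE.
    have Gi := enum_valP i.
    rewrite row_mul rowLi -mulmxA -(repr_mxM aG Gi Gg).
    by rewrite mul_regular_mx ?groupM // invMg mulgA.
  by move=> x Gx; rewrite gring_indexK.
- apply/row_matrixP => i; rewrite row_mul rowL rowLi gring_mxJ ?enum_valP //.
  by rewrite mulmxA y_quasi -scalemxAl linearZ /= rowLi.
- exact: row_base_free.
- by apply: eqmx_trans (eq_row_base _) (genmxE _).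
- have := val_submodJ (cyclic_mx_module aG y) 1%:M Gg.
  by rewrite /val_submod /= !mul1mx.
Qed.

Lemma rank_cyclic_mx :
  alpha * (\rank (cyclic_mx aG y))%:R = #|G|%:R * y 0 (gring_index G 1%g).
Proof.
rewrite -mxtrace1 -(repr_mx1 M) trace_cyclic_mx //.
under eq_bigr => x _ do rewrite invg1 mulg1 mulgV.
by rewrite sumr_const mulr_natl.
Qed.

End QuasiIdempotent.

(** * The Young symmetrizer as a quasi-idempotent *)

Section YoungSymmetrizer.
Variables (F : numFieldType) (n : nat) (I : finType).
Variables (rw : 'I_n -> I) (cl : 'I_n -> nat) (lam : I -> nat).
Hypothesis box_inj : forall i j, rw i = rw j -> cl i = cl j -> i = j.
Hypothesis cl_lt : forall i, (cl i < lam (rw i))%N.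
Hypothesis box_ex : forall r c, (c < lam r)%N -> exists2 i, rw i = r & cl i = c.

(* Counting the points with column less than [lam (rw i)] row by row, before
   and after [g]. *)
Lemma separated_column_lt (g : 'S_n) :
  (forall i j, rw i = rw j -> cl (g i) = cl (g j) -> i = j) ->
  forall i, (cl (g i) < lam (rw i))%N.
Proof.
move=> sep i0; set k := lam (rw i0).
pose X := [set i | (cl (g i) < k)%N]%SET; pose Y := [set i | (cl i < k)%N]%SET.
pose row_of (Z : {set 'I_n}) r := (Z :&: [set i | rw i == r])%SET.
have cardXY : #|X| = #|Y|.
  have <- : g @^-1: Y = X by apply/setP => i; rewrite !inE.
  by rewrite card_preimset //; exact: perm_inj.
have cardE (Z : {set 'I_n}) : #|Z| = (\sum_r #|row_of Z r|)%N.
  rewrite -sum1_card (partition_big rw xpredT) //=.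
  apply: eq_bigr => r _; rewrite -sum1_card; apply: eq_bigl => i.
  by rewrite !inE.
(* In a row of length at least [k], send each box to the one of the same row in the column of its
   image under [g]; a shorter row lies in [Y] entirely. *)
have leXY r : (#|row_of X r| <= #|row_of Y r|)%N.
  have [lekr|ltrk] := leqP k (lam r); last first.
    apply: subset_leq_card; apply/subsetP => i; rewrite !inE.
    by move=> /andP[_ /eqP ir]; rewrite ir eqxx (leq_trans (cl_lt i)) // ir ltnW.
  have box (i : 'I_n) : exists j, (cl (g i) < k)%N -> rw j = r /\ cl j = cl (g i).
    case: (ltnP (cl (g i)) k) => [lt|ge]; last by exists i.
    by have [j jr jc] := box_ex (leq_trans lt lekr); exists j.
  have [f fE] := fin_all_exists box.
  rewrite -(card_in_imset (f := f)).
    apply: subset_leq_card; apply/subsetP => _ /imsetP[i + ->].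
    by rewrite !inE => /andP[ltk _]; have [-> ->] := fE i ltk; rewrite ltk eqxx.
  move=> i j; rewrite !inE => /andP[iX /eqP ir] /andP[jX /eqP jr] eqf.
  apply: sep; first by rewrite ir jr.
  by have [_ <-] := fE i iX; have [_ <-] := fE j jX; rewrite eqf.
have eq0 : #|row_of X (rw i0)| = #|row_of Y (rw i0)|.
  apply/eqP; rewrite eqn_leq leXY /=.
  have : (\sum_(r | r != rw i0) #|row_of X r| <= \sum_(r | r != rw i0) #|row_of Y r|)%N.
    by apply: leq_sum => r _.
  have := cardXY; rewrite (cardE X) (cardE Y) (bigD1 (rw i0)) //=.
  by rewrite [in RHS](bigD1 (rw i0)) //=; lia.
have sub0 : row_of X (rw i0) \subset row_of Y (rw i0).
  apply/subsetP => i; rewrite !inE => /andP[_ /eqP ir].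
  by rewrite ir eqxx andbT (leq_trans (cl_lt i)) // ir.
have : i0 \in row_of X (rw i0).
  have -> : row_of X (rw i0) = row_of Y (rw i0).
    by apply/eqP; rewrite eqEcard sub0 eq0 leqnn.
  by rewrite !inE eqxx andbT cl_lt.
by rewrite !inE => /andP[].
Qed.

Definition row_group : {set 'S_n} := [set s : 'S_n | [forall i, rw (s i) == rw i]]%SET.
Definition col_group : {set 'S_n} := [set s : 'S_n | [forall i, cl (s i) == cl i]]%SET.

Lemma row_groupP (s : 'S_n) : reflect (forall i, rw (s i) = rw i) (s \in row_group).
Proof. by rewrite inE; apply: (iffP forallP) => H i; apply/eqP. Qed.

Lemma col_groupP (s : 'S_n) : reflect (forall i, cl (s i) = cl i) (s \in col_group).
Proof. by rewrite inE; apply: (iffP forallP) => H i; apply/eqP. Qed.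

(** [p] sends a point to the box of its own row in the column of its image under [g]; this box
    exists by [separated_column_lt]. *)
Lemma row_col_factor (g : 'S_n) :
  (forall i j, rw i = rw j -> cl (g i) = cl (g j) -> i = j) ->
  exists p q, [/\ p \in row_group, q \in col_group & g = (p * q)%g].
Proof.
move=> sep; have lt := separated_column_lt sep.
have box i : exists j, rw j = rw i /\ cl j = cl (g i).
  by have [j jr jc] := box_ex (lt i); exists j.
have [f fE] := fin_all_exists box.
have f_inj : injective f.
  move=> i j eqf; have [ir ic] := fE i; have [jr jc] := fE j.
  by apply: sep; [rewrite -ir -jr eqf | rewrite -ic -jc eqf].
pose p := perm f_inj; exists p, (p^-1 * g)%g; split.
- by apply/row_groupP => i; rewrite permE; case: (fE i).
- apply/col_groupP => j; rewrite permM.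
  have [_ <-] := fE ((p^-1)%g j); congr cl.
  by rewrite -[f _](permE f_inj) permKV.
- by rewrite mulKVg.
Qed.

Let G : {group 'S_n} := [set: 'S_n]%G.
Local Notation aG := (regular_repr F G).

Definition row_symmetrizer := \sum_(p in row_group) aG p.
Definition col_antisymmetrizer := \sum_(q in col_group) (-1) ^+ (q : bool) *: aG q.
Local Notation a := row_symmetrizer.
Local Notation b := col_antisymmetrizer.

Lemma aGM (s t : 'S_n) : aG (s * t)%g = aG s *m aG t.
Proof. by rewrite repr_mxM ?inE. Qed.

Lemma row_symmetrizerM p : p \in row_group -> a *m aG p = a.
Proof.
move=> /row_groupP pR; rewrite mulmx_suml [RHS](reindex_inj (mulIg p)) /=.
apply: eq_big => [s|s _]; last by rewrite aGM.
by apply/row_groupP/row_groupP => H i; first rewrite permM pR;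
   rewrite -?(H i) ?permM ?pR.
Qed.

Lemma col_antisymmetrizerM q : q \in col_group ->
  aG q *m b = (-1) ^+ (q : bool) *: b.
Proof.
move=> /col_groupP qC; rewrite mulmx_sumr scaler_sumr.
rewrite [RHS](reindex_inj (mulgI q)) /=.
apply: eq_big => [s|s _].
  apply/col_groupP/col_groupP => H i; first by rewrite permM H qC.
  have := H ((q^-1)%g i); rewrite permM permKV => ->.
  by rewrite -(qC ((q^-1)%g i)) permKV.
rewrite -scalemxAr aGM scalerA; congr (_ *: _).
by rewrite odd_permM signr_addb mulrA -expr2 sqrr_sign mul1r.
Qed.

(* von Neumann's lemma: if [g] does not factor, a transposition exchanging two
   points of a row and two points of a column cancels the product. *)
Lemma symmetrizers_collapse (g : 'S_n) :
  exists c, a *m aG g *m b = c *: (a *m b).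
Proof.
case: (boolP [exists i, exists j, [&& rw i == rw j, cl (g i) == cl (g j) & i != j]]).
  move=> /existsP[i /existsP[j /and3P[/eqP ij /eqP gij neq]]].
  exists 0; rewrite scale0r.
  have tR : tperm i j \in row_group.
    by apply/row_groupP => x; case: tpermP => [->|->|].
  have tC : tperm (g i) (g j) \in col_group.
    by apply/col_groupP => x; case: tpermP => [->|->|].
  have e : a *m aG g *m b = - (a *m aG g *m b).
    rewrite -{1}(row_symmetrizerM tR) -(mulmxA a) -aGM.
    have -> : (tperm i j * g = g * tperm (g i) (g j))%g.
      by rewrite -tpermJ conjgE mulKVg.
    rewrite aGM mulmxA -(mulmxA _ _ b) col_antisymmetrizerM //.
    by rewrite odd_tperm (inj_eq perm_inj) neq expr1 scaleN1r mulmxN.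
  apply/matrixP => x y; move/matrixP/(_ x y)/eqP: e; rewrite !mxE.
  by rewrite -subr_eq0 opprK -mulr2n mulrn_eq0 /= => /eqP.
rewrite negb_exists => /forallP sep.
have [|p [q [pR qC ->]]] := @row_col_factor g.
  move=> i j ij gij; apply/eqP; move: (sep i); apply: contraNT => neq.
  by apply/existsP; exists j; rewrite ij gij neq !eqxx.
exists ((-1) ^+ (q : bool)); rewrite aGM mulmxA row_symmetrizerM //.
by rewrite -mulmxA col_antisymmetrizerM // scalemxAr.
Qed.

(** Expanding the factor b a in the middle of a b a b leaves terms to which [symmetrizers_collapse]
    applies. *)
Lemma young_quasi_idempotent :
  exists c, (a *m b) *m (a *m b) = c *: (a *m b).
Proof.
have [c cE] := fin_all_exists symmetrizers_collapse.
exists (\sum_(q in col_group) \sum_(p in row_group) (-1) ^+ (q : bool) * c (q * p)%g).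
rewrite mulmxA -(mulmxA a b a) [b *m a]mulmx_suml [a *m _]mulmx_sumr [_ *m b]mulmx_suml scaler_suml.
apply: eq_bigr => q _.
rewrite [_ *: aG q *m a]mulmx_sumr [a *m _]mulmx_sumr [_ *m b]mulmx_suml scaler_suml.
apply: eq_bigr => p _.
by rewrite -scalemxAl -scalemxAr -scalemxAl -aGM cE scalerA.
Qed.

Definition young_row : 'rV[F]_#|G| := gring_row (a *m b).

Lemma young_rowE (g : 'S_n) : young_row 0 (gring_index G g) =
  \sum_(p in row_group) \sum_(q in col_group)
     (-1) ^+ (q : bool) * ((p * q)%g == g)%:R.
Proof.
rewrite /young_row mulmx_suml linear_sum /= summxE; apply: eq_bigr => p _.
rewrite mulmx_sumr linear_sum /= summxE; apply: eq_bigr => q _.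
rewrite -scalemxAr linearZ /= mxE; congr (_ * _).
rewrite -aGM /gring_row rowK !mxE gring_indexK ?inE // mul1g eqxx /=.
by rewrite -(inj_eq (@enum_val_inj _ _)) !gring_indexK ?inE // eq_sym.
Qed.

(** Only the identity preserves both rows and columns, so p q = 1 has a single solution. The value 1
    makes the constant of quasi-idempotency nonzero. *)
Lemma young_row1 : young_row 0 (gring_index G 1%g) = 1.
Proof.
have in1 : (1%g \in row_group) && (1%g \in col_group).
  by apply/andP; split; [apply/row_groupP|apply/col_groupP] => i; rewrite perm1.
have [inR inC] := andP in1.
rewrite young_rowE (bigD1 1%g) //= [X in _ + X]big1 ?addr0 => [|p /andP[pR p1]].
  rewrite (bigD1 1%g) //= big1 ?addr0 => [|q /andP[_ q1]].
    by rewrite odd_perm1 mulg1 eqxx mulr1.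
  by rewrite mul1g (negbTE q1) mulr0.
rewrite big1 // => q qC; case: eqP => [e|]; last by rewrite mulr0.
case/negP: p1; apply/eqP/permP => i; rewrite perm1.
have q' : q = (p^-1)%g by rewrite -[LHS](mulKg p) e mulg1.
apply: box_inj; first exact: (row_groupP _ pR).
by have := col_groupP _ qC (p i); rewrite q' permK => ->.
Qed.

(** The constant c of quasi-idempotency multiplies both the trace and the rank, so it cancels; c
    times the rank is n! by [rank_cyclic_mx]. *)
Lemma young_trace_ratio (U := cyclic_mx aG young_row)
    (M := submod_repr (cyclic_mx_module aG young_row)) (g : 'S_n) :
  \tr (M g) / (\rank U)%:R = (n`!%:R)^-1 *
    \sum_(x : 'S_n) young_row 0 (gring_index G (x * g^-1 * x^-1)%g).
Proof.
have Gin (x : 'S_n) : x \in G by rewrite inE.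
have gmx : gring_mx aG young_row = a *m b.
  rewrite -[LHS]/(gring_op aG (a *m b)) mulmx_suml linear_sum.
  apply: eq_bigr => p _; rewrite mulmx_sumr linear_sum; apply: eq_bigr => q _.
  by rewrite -scalemxAr linearZ /= -aGM gring_opG.
have [c cE] := young_quasi_idempotent.
have quasi : young_row *m gring_mx aG young_row = c *: young_row.
  by rewrite gmx -gring_row_mul cE linearZ.
have cardG : #|G| = n`! by rewrite cardsT card_Sn.
have rk : c * (\rank U)%:R = n`!%:R.
  by rewrite (rank_cyclic_mx quasi) young_row1 mulr1 cardG.
have n0 : (n`!%:R : F) != 0 by rewrite pnatr_eq0 -lt0n fact_gt0.
have c0 : c != 0 by apply: contraNneq n0 => c0; rewrite -rk c0 mul0r.
have := trace_cyclic_mx quasi (Gin g); rewrite -/M => tr.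
rewrite (eq_bigl (fun x => x \in G)) -?tr => [|x]; last by rewrite Gin.
rewrite -rk invfM mulrACA mulVf // mul1r mulrC //.
Qed.

End YoungSymmetrizer.

(** * Permutations and injections of an initial segment *)

Section ExtendPerm.
Variables (n k : nat) (le_kn : (k <= n)%N).
Local Notation w := (widen_ord le_kn).

Definition extend_perm_fun (s : 'S_k) (i : 'I_n) : 'I_n :=
  if insub (val i) is Some j then w (s j) else i.

Lemma extend_perm_funE s j : extend_perm_fun s (w j) = w (s j).
Proof. by rewrite /extend_perm_fun valK. Qed.

Lemma extend_perm_fun_out s (i : 'I_n) : (k <= i)%N -> extend_perm_fun s i = i.
Proof. by move=> ki; rewrite /extend_perm_fun insubF // ltnNge ki. Qed.

Lemma widen_ord_inj : injective w.
Proof. by move=> i j /(congr1 val) /= /val_inj. Qed.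

Variant widen_spec (i : 'I_n) : Prop :=
| WidenIn (j : 'I_k) of i = w j
| WidenOut of (k <= i)%N.

Lemma widenP i : widen_spec i.
Proof.
case: (ltnP i k) => [lt|ge]; last exact: WidenOut.
by apply: (@WidenIn _ (Ordinal lt)); apply: val_inj.
Qed.

Lemma extend_perm_fun_inj s : injective (extend_perm_fun s).
Proof.
move=> i j; case: (widenP i) => [i' ->|ki]; case: (widenP j) => [j' ->|kj].
- by rewrite !extend_perm_funE => /widen_ord_inj/perm_inj ->.
- rewrite extend_perm_funE extend_perm_fun_out // => e.
  by move: kj; rewrite -e leqNgt /= ltn_ord.
- rewrite extend_perm_funE extend_perm_fun_out // => e.
  by move: ki; rewrite e leqNgt /= ltn_ord.
- by rewrite !extend_perm_fun_out.
Qed.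

Definition extend_perm s : 'S_n := perm (@extend_perm_fun_inj s).

Lemma extend_permE s j : extend_perm s (w j) = w (s j).
Proof. by rewrite permE extend_perm_funE. Qed.

Lemma extend_perm_out s (i : 'I_n) : (k <= i)%N -> extend_perm s i = i.
Proof. by move=> ki; rewrite permE extend_perm_fun_out. Qed.

Lemma extend_permM s t : extend_perm (s * t)%g = (extend_perm s * extend_perm t)%g.
Proof.
apply/permP => i; rewrite permM; case: (widenP i) => [j ->|ki].
  by rewrite !extend_permE permM.
by rewrite !extend_perm_out.
Qed.

Lemma extend_perm_inj : injective extend_perm.
Proof.
move=> s t /permP e; apply/permP => j; apply: widen_ord_inj.
by rewrite -!extend_permE e.
Qed.

Lemma extend_perm1 : extend_perm 1%g = 1%g.
Proof.
apply/permP => i; rewrite perm1; case: (widenP i) => [j ->|ki].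
  by rewrite extend_permE perm1.
by rewrite extend_perm_out.
Qed.

Lemma extend_tperm i j : extend_perm (tperm i j) = tperm (w i) (w j).
Proof.
apply/permP => x; case: (widenP x) => [y ->|kx].
  by rewrite extend_permE (inj_tperm _ _ _ widen_ord_inj).
rewrite extend_perm_out // tpermD //; apply/eqP => e;
  by move: kx; rewrite -e leqNgt /= ltn_ord.
Qed.

Lemma odd_extend_perm s : odd_perm (extend_perm s) = odd_perm s.
Proof.
have [ts -> dts] := prod_tpermP s.
elim: ts dts => [|t ts IH] /=; first by rewrite !big_nil extend_perm1 !odd_perm1.
move=> /andP[dt /IH e]; rewrite !big_cons extend_permM !odd_permM e.
by rewrite extend_tperm !odd_tperm (inj_eq widen_ord_inj).
Qed.

Lemma extend_init_cycle : extend_perm (init_cycle k k) = init_cycle n k.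
Proof.
apply/permP => i; apply: val_inj; rewrite [RHS]/= [init_cycle n k i]permE.
rewrite init_cycle_funE (minn_idPl le_kn).
case: (widenP i) => [j ->|ki].
  by rewrite extend_permE /= permE init_cycle_funE minnn ltn_ord.
by rewrite extend_perm_out // ltnNge ki.
Qed.

Lemma extend_perm_onto (u : 'S_n) : (forall i : 'I_n, (k <= i)%N -> u i = i) ->
  exists s, extend_perm s = u.
Proof.
move=> fixu.
have lt (j : 'I_k) : (u (w j) < k)%N.
  rewrite ltnNge; apply/negP => kle; have e := @perm_inj _ u _ _ (fixu _ kle).
  by move: kle; rewrite e leqNgt /= ltn_ord.
have res_inj : injective (fun j => Ordinal (lt j)).
  by move=> i j /(congr1 val) /= e; apply/widen_ord_inj/(@perm_inj _ u)/val_inj.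
exists (perm res_inj); apply/permP => i; case: (widenP i) => [j ->|ki].
  by rewrite extend_permE permE; apply: val_inj.
by rewrite extend_perm_out // fixu.
Qed.

Lemma extend_injection (f : 'I_k -> 'I_n) : injective f ->
  exists x : 'S_n, forall j, x (w j) = f j.
Proof.
move=> f_inj.
(* The values of [f] followed by the missing ones list all points once, hence define a
   permutation. *)
pose s := codom f ++ [seq y <- enum 'I_n | y \notin codom f].
have ps : perm_eq s (ord_tuple n).
  rewrite val_ord_tuple; apply: uniq_perm; rewrite ?enum_uniq //.
    rewrite cat_uniq; apply/and3P; split; last by rewrite filter_uniq ?enum_uniq.
      by apply/injectiveP.
    by apply/hasPn => y; rewrite mem_filter => /andP[].
  by move=> y; rewrite mem_cat mem_filter mem_enum andbT orbN.
have /tuple_permP[x sx] := ps.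
exists x => j.
have -> : x (w j) = nth (w j) s (w j).
  by rewrite sx -tnth_nth tnth_mktuple tnth_ord_tuple.
rewrite nth_cat /= size_codom card_ord ltn_ord /codom.
by rewrite (nth_map j) ?size_enum_ord // nth_ord_enum.
Qed.

End ExtendPerm.

Section InjectionAverage.
Variables (F : numFieldType) (n k : nat) (le_kn : (k <= n)%N).
Local Notation w := (widen_ord le_kn).

Lemma average_injections (Phi : {ffun 'I_k -> 'I_n} -> F) :
  (n ^_ k)%:R / n`!%:R * \sum_(x : 'S_n) Phi [ffun j => x (w j)] =
  \sum_(f : {ffun 'I_k -> 'I_n} | injectiveb f) Phi f.
Proof.
pose fib (f : {ffun 'I_k -> 'I_n}) := [set x : 'S_n | [ffun j => x (w j)] == f]%SET.
pose M := #|fib [ffun j => w j]|.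
have cardfib (f : {ffun 'I_k -> 'I_n}) : injectiveb f -> #|fib f| = M.
  move=> /injectiveP f_inj; have [y yf] := extend_injection le_kn f_inj.
  rewrite /M -(card_imset (mem (fib [ffun j => w j])) (mulIg y)).
  apply: eq_card => x; rewrite inE; apply/eqP/imsetP => [xf|[z]].
    exists (x * y^-1)%g; last by rewrite mulgKV.
    rewrite inE; apply/eqP/ffunP => j; rewrite !ffunE permM.
    apply: (@perm_inj _ y); rewrite permKV yf -xf ffunE //.
  rewrite inE => /eqP/ffunP zf ->; apply/ffunP => j.
  by rewrite ffunE permM -yf; have := zf j; rewrite !ffunE => ->.
have sumfib (Psi : {ffun 'I_k -> 'I_n} -> F) :
    \sum_(x : 'S_n) Psi [ffun j => x (w j)] =
    M%:R * \sum_(f : {ffun 'I_k -> 'I_n} | injectiveb f) Psi f.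
  rewrite (partition_big (fun x : 'S_n => [ffun j => x (w j)])
             (fun f : {ffun 'I_k -> 'I_n} => injectiveb f)) /=; last first.
    move=> x _; apply/injectiveP => i j; rewrite !ffunE.
    by move=> /perm_inj /widen_ord_inj.
  rewrite mulr_sumr; apply: eq_bigr => f f_inj.
  rewrite -(cardfib f f_inj) (eq_bigr (fun=> Psi f)) => [|x /eqP -> //].
  rewrite (eq_bigl (fun x => x \in fib f)) => [|x]; last by rewrite inE.
  by rewrite sumr_const mulr_natl.
(* The common fibre size [M] is eliminated by comparison with the constant function 1. *)
have := sumfib (fun=> 1); rewrite !sumr_const card_Sn.
have -> : #|[pred f : {ffun 'I_k -> 'I_n} | injectiveb f]| = n ^_ k.
  by rewrite -[in RHS](card_ord n) -[in RHS](card_ord k) -card_inj_ffuns cardsE.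
move=> e; rewrite sumfib mulrA e [_ / _ * _]mulrAC [_ * M%:R]mulrC divff ?mul1r //.
by rewrite -e pnatr_eq0 -lt0n fact_gt0.
Qed.

End InjectionAverage.

(** * From the symmetrizer to a sum over factorizations *)

Section StanleySum.
Variables (F : numFieldType) (n k : nat) (I : finType).
Variables (rw : 'I_n -> I) (cl : 'I_n -> nat).
Hypothesis box_inj : forall i j, rw i = rw j -> cl i = cl j -> i = j.

Definition compatible (f : 'I_k -> 'I_n) (s1 s2 : 'S_k) :=
  [forall i, rw (f (s2 i)) == rw (f i)] && [forall i, cl (f (s1 i)) == cl (f i)].

(** With u1 = x q^-1 x^-1 and u2 = x p^-1 x^-1 the equation becomes u1 u2 = c. For a point i >= k,
    fixed by c, the boxes [x i] and [x (u1 i)] share their row, and they always share their column;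
    so u1 and u2 fix i and come from permutations of ['I_k]. *)
Lemma conj_factor_sum (le_kn : (k <= n)%N) (x : 'S_n) :
  \sum_(p in row_group rw) \sum_(q in col_group cl)
     (-1) ^+ (q : bool) * ((p * q)%g == (x^-1 * (init_cycle n k)^-1 * x)%g)%:R =
  \sum_(v : 'S_k * 'S_k | (v.1 * v.2)%g == init_cycle k k)
     (-1) ^+ (v.1 : bool) * (compatible (fun j => x (widen_ord le_kn j)) v.1 v.2)%:R
  :> F.
Proof.
set c := init_cycle n k; pose ext := extend_perm le_kn.
pose res (u : 'S_n) := odflt 1%g [pick s | ext s == u].
have resK u : (exists s, ext s = u) -> ext (res u) = u.
  rewrite /res; case: pickP => [s /eqP //|no [s /eqP su]].
  by have := no s; rewrite su.
have extK s : res (ext s) = s.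
  by apply: (extend_perm_inj (le_kn := le_kn)); rewrite -/ext resK //; exists s.
pose cond (u1 u2 : 'S_n) := [&& (u1 * u2)%g == c,
  [forall i, rw (x (u2 i)) == rw (x i)] & [forall i, cl (x (u1 i)) == cl (x i)]].
have condE (p q : 'S_n) : cond (x * q^-1 * x^-1)%g (x * p^-1 * x^-1)%g =
   [&& p \in row_group rw, q \in col_group cl & (p * q)%g == (x^-1 * c^-1 * x)%g].
  rewrite /cond andbC -andbA; congr [&& _, _ & _].
  - apply/forallP/(row_groupP rw) => H i.
      by have := eqP (H ((x^-1)%g (p i))); rewrite !permM !permKV permK.
    apply/eqP; rewrite !permM permKV.
    by rewrite -(H ((p^-1)%g (x i))) permKV.
  - apply/forallP/(col_groupP cl) => H i.
      by have := eqP (H ((x^-1)%g (q i))); rewrite !permM !permKV permK.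
    apply/eqP; rewrite !permM permKV.
    by rewrite -(H ((q^-1)%g (x i))) permKV.
  - rewrite -(inj_eq invg_inj) !invMg !invgK !mulgA mulgKV.
    apply/eqP/eqP => e; first by rewrite -e !mulgA mulVg mul1g mulgKV.
    by rewrite -(mulgA x) e !mulgA mulgV mul1g mulgK.
rewrite pair_big_dep /= (eq_bigr (fun pq : 'S_n * 'S_n => if
  (pq.1 * pq.2 == x^-1 * c^-1 * x)%g then (-1) ^+ (pq.2 : bool) else 0 : F)); last first.
  by move=> pq _; case: eqP; rewrite ?mulr1 ?mulr0.
rewrite -big_mkcondr /=.
rewrite (reindex_onto (fun v : 'S_k * 'S_k =>
   (x^-1 * (ext v.2)^-1 * x, x^-1 * (ext v.1)^-1 * x)%g)
  (fun pq => (res (x * pq.2^-1 * x^-1), res (x * pq.1^-1 * x^-1))%g)) /=; last first.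
  move=> [p q] /=; rewrite -andbA -condE.
  set u1 := (x * q^-1 * x^-1)%g; set u2 := (x * p^-1 * x^-1)%g.
  move=> /and3P[/eqP e /forallP H2 /forallP H1].
  have fix_both (i : 'I_n) : (k <= i)%N -> u1 i = i /\ u2 i = i.
    move=> ki; have ci : c i = i.
      by rewrite /c -(extend_init_cycle le_kn) extend_perm_out.
    have u12 : u2 (u1 i) = i by rewrite -permM e.
    have u1i : u1 i = i.
      apply: (@perm_inj _ x); apply: box_inj; last exact/eqP.
      by rewrite -(eqP (H2 (u1 i))) u12.
    by split; rewrite // -{1}u1i u12.
  rewrite !resK.
  - by rewrite /u1 /u2 !invMg !invgK !mulgA !mulVg !mul1g !mulgKV.
  - by apply: extend_perm_onto => i /fix_both[].
  - by apply: extend_perm_onto => i /fix_both[].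
rewrite [RHS](eq_bigr (fun v : 'S_k * 'S_k => if compatible
  (fun j => x (widen_ord le_kn j)) v.1 v.2 then (-1) ^+ (v.1 : bool) else 0 : F));
  last by move=> v _; case: ifP; rewrite ?mulr1 ?mulr0.
rewrite -[RHS]big_mkcondr /=; apply: eq_big => [[v1 v2]|[v1 v2] _] /=; last first.
  by rewrite !odd_permM !odd_permV addbC addbA addbb (odd_extend_perm le_kn).
rewrite -[X in X && _]andbA -condE !invMg !invgK !mulgA !mulgV !mul1g !mulgK !extK eqxx andbT.
rewrite /cond -(extend_permM le_kn) /c -(extend_init_cycle le_kn).
rewrite (inj_eq (@extend_perm_inj _ _ _)); congr (_ && _); congr (_ && _).
  apply/forallP/forallP => H j; first by have := H (widen_ord le_kn j); rewrite extend_permE.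
  case: (widenP le_kn j) => [i ->|kj]; first by rewrite extend_permE.
  by rewrite extend_perm_out.
apply/forallP/forallP => H j; first by have := H (widen_ord le_kn j); rewrite extend_permE.
case: (widenP le_kn j) => [i ->|kj]; first by rewrite extend_permE.
by rewrite extend_perm_out.
Qed.

(** For a transposition t of two points with the same image, (v1, v2) -> (v1 t, t v2) is a
    sign-reversing involution of the compatible factorizations. *)
Lemma compatible_noninjective (f : {ffun 'I_k -> 'I_n}) : ~~ injectiveb f ->
  \sum_(v : 'S_k * 'S_k | (v.1 * v.2)%g == init_cycle k k)
     (-1) ^+ (v.1 : bool) * (compatible f v.1 v.2)%:R = 0 :> F.
Proof.
move=> /injectivePn[i [j neq fij]].
set S := \sum_(_ | _) _; pose t := tperm i j.
have ft x : f (t x) = f x by rewrite /t; case: tpermP => [->|->|].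
have ttx x : t (t x) = x by rewrite /t tpermK.
have tt : (t * t = 1)%g by apply/permP => x; rewrite permM ttx perm1.
have SN : S = - S.
  rewrite {1}/S (reindex_inj (h := fun v : 'S_k * 'S_k => (v.1 * t, t * v.2)%g)) /=; last first.
    by move=> [v1 v2] [u1 u2] [/mulIg -> /mulgI ->].
  rewrite -sumrN; apply: eq_big => [[v1 v2]|[v1 v2] _] /=.
    by rewrite -(mulgA v1 t) (mulgA t) tt mul1g.
  rewrite odd_permM odd_tperm neq addbT -mulNr; congr (_ * _%:R).
    by case: (odd_perm v1); rewrite ?expr0 ?expr1 ?opprK.
  congr (nat_of_bool _); congr (_ && _).
    apply/forallP/forallP => H x; have := H (t x);
      by rewrite ?permM ?ttx ft.
  by apply/eq_forallb => x; rewrite permM ft.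
by move/eqP: SN; rewrite -subr_eq0 opprK -mulr2n mulrn_eq0 /= => /eqP.
Qed.

(** By [compatible_noninjective] the sum extends from injections to all maps. On the right
    [v.2 * v.1] applies [v.2] first, as does \sigma_1\circ\sigma_2. *)
Lemma sum_injective_compatible :
  \sum_(f : {ffun 'I_k -> 'I_n} | injectiveb f)
    \sum_(v : 'S_k * 'S_k | (v.1 * v.2)%g == init_cycle k k)
     (-1) ^+ (v.1 : bool) * (compatible f v.1 v.2)%:R =
  \sum_(v : 'S_k * 'S_k | (v.2 * v.1)%g == init_cycle k k) (-1) ^+ (v.1 : bool) *
    #|[set f : {ffun 'I_k -> 'I_n} | compatible f v.1 v.2]%SET|%:R :> F.
Proof.
pose Phi (f : {ffun 'I_k -> 'I_n}) : F :=
  \sum_(v : 'S_k * 'S_k | (v.1 * v.2)%g == init_cycle k k)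
     (-1) ^+ (v.1 : bool) * (compatible f v.1 v.2)%:R.
transitivity (\sum_f Phi f).
  rewrite [RHS](bigID (fun f : {ffun 'I_k -> 'I_n} => injectiveb f)) /=.
  by rewrite [X in _ + X]big1 ?addr0 // => f; exact: compatible_noninjective.
rewrite exchange_big /=.
(* conjugating by [v.1] exchanges the order of the two factors *)
rewrite (reindex_onto (fun v : 'S_k * 'S_k => (v.1, v.1^-1 * v.2 * v.1)%g)
  (fun v : 'S_k * 'S_k => (v.1, v.1 * v.2 * v.1^-1)%g)) /=; last first.
  by move=> [v1 v2] _ /=; rewrite !mulgA mulVg mul1g mulgKV.
apply: eq_big => [[v1 v2]|[v1 v2] _] /=.
  by rewrite !mulgA mulgV mul1g mulgK eqxx andbT.
rewrite -mulr_sumr; congr (_ * _); rewrite -natr_sum; congr _%:R.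
rewrite -sum1_card [RHS]big_mkcond /=.
pose h (f : {ffun 'I_k -> 'I_n}) := [ffun j => f ((v1^-1)%g j)].
rewrite (reindex_inj (h := h)) /=; last first.
  move=> f g /ffunP e; apply/ffunP => j; have := e (v1 j).
  by rewrite !ffunE permK.
apply: eq_bigr => f _; rewrite inE.
rewrite -[RHS](_ : nat_of_bool (compatible f v1 v2) = _); last by case: ifP.
congr nat_of_bool; congr (_ && _); apply/forallP/forallP => H i.
- by have := H (v1 i); rewrite !ffunE !permM !permK.
- by rewrite !ffunE !permM !permK.
- by have := H (v1 i); rewrite !ffunE !permK eq_sym.
- by have := H ((v1^-1)%g i); rewrite !ffunE permKV permK eq_sym.
Qed.


Lemma stanley_sum_injections (le_kn : (k <= n)%N) :
  (n ^_ k)%:R / n`!%:R * (\sum_(x : 'S_n)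
    \sum_(p in row_group rw) \sum_(q in col_group cl) (-1) ^+ (q : bool) *
      ((p * q)%g == (x * (init_cycle n k)^-1 * x^-1)%g)%:R) =
  \sum_(v : 'S_k * 'S_k | (v.2 * v.1)%g == init_cycle k k) (-1) ^+ (v.1 : bool) *
    #|[set f : {ffun 'I_k -> 'I_n} | compatible f v.1 v.2]%SET|%:R :> F.
Proof.
rewrite -sum_injective_compatible -(average_injections le_kn) (reindex_inj invg_inj) /=.
congr (_ * _); apply: eq_bigr => x _; rewrite invgK (conj_factor_sum le_kn).
apply: eq_bigr => v _; congr (_ * (nat_of_bool _)%:R).
by congr (_ && _); apply: eq_forallb => j; rewrite !ffunE.
Qed.

End StanleySum.

Section CharacterFormula.
Variables (F : numFieldType) (lam : seq nat) (k : nat).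
Let n := sumn lam.

Definition box_row (i : 'I_n) : 'I_(size lam) := Ordinal (reshape_indexP (ltn_ord i)).
Definition box_col (i : 'I_n) : nat := reshape_offset lam i.

Lemma box_col_lt i : (box_col i < nth 0%N lam (box_row i))%N.
Proof. exact: reshape_offsetP. Qed.

Lemma box_inj i j : box_row i = box_row j -> box_col i = box_col j -> i = j.
Proof.
move=> /(congr1 val) /= r c; apply: val_inj => /=.
by rewrite -(reshape_indexK lam i) -(reshape_indexK lam j) r -/(box_col i) c.
Qed.

Lemma box_ex (r : 'I_(size lam)) c : (c < nth 0%N lam r)%N ->
  exists2 i, box_row i = r & box_col i = c.
Proof.
move=> lt; have ltn := flatten_indexP lt.
exists (Ordinal ltn); first by apply: val_inj; rewrite /= flatten_indexKl.
by rewrite /box_col /= flatten_indexKr.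
Qed.

Theorem normalized_character_stanley :
  normalized_character F lam k =
  \sum_(v : 'S_k * 'S_k | (v.2 * v.1)%g == init_cycle k k) (-1) ^+ (v.1 : bool) *
    #|[set f : {ffun 'I_k -> 'I_n} | compatible box_row box_col f v.1 v.2]%SET|%:R.
Proof.
rewrite /normalized_character; case: leqP => [le_kn|lt_nk]; last first.
  (* For k > n the sum over injections is empty, in agreement with the value 0 of the character. *)
  rewrite -(@sum_injective_compatible F n k _ box_row box_col) big_pred0 // => f.
  apply/negP => /injectiveP/leq_card; rewrite !card_ord leqNgt.
  by rewrite -/n lt_nk.
have rowE : row_stab lam = row_group box_row by [].
have colE : col_stab lam = col_group box_col by [].
have yE : young_symmetrizer F lam = young_row F box_row box_col.
  rewrite /young_symmetrizer /young_row; congr gring_row.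
  rewrite mulmx_suml; apply: eq_bigr => p _; rewrite mulmx_sumr.
  by apply: eq_bigr => q _; rewrite -scalemxAr aGM.
rewrite /specht_repr /specht_mx yE.
rewrite (young_trace_ratio F box_inj box_col_lt box_ex) mulrA.
rewrite -(stanley_sum_injections _ box_inj le_kn); congr (_ * _).
by apply: eq_bigr => x _; rewrite young_rowE.
Qed.

End CharacterFormula.

(** * Shape functionals and Lagrange inversion *)

Section ShapeIntegral.
Local Open Scope classical_set_scope.
Import numFieldNormedType.Exports.
Variable R : realType.
Notation mu := (@lebesgue_measure R).

Lemma integral_deriv_poly (p : {poly R}) a b : a <= b ->
  (\int[mu]_(x in `]a, b[) (p^`().[x])%:E = (p.[b] - p.[a])%:E)%E.
Proof.
rewrite le_eqVlt => /predU1P[->|ltab].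
  by rewrite set_itv_ge ?bnd_simp ?ltxx // integral_set0 subrr.
have mp (A : set R) : measurable_fun A (EFin \o horner p^`()).
  apply/measurable_EFinP; apply: measurable_funTS.
  by apply: continuous_measurable_fun; exact: continuous_horner.
rewrite -(@integral_itv_bndoo _ _ _ _ true false) ?EFinB; last exact: mp.
apply: (@continuous_FTC2 _ (horner p^`()) (horner p)) => //.
- by apply: continuous_subspaceT; exact: continuous_horner.
- split; first by move=> x _; exact: derivable_horner.
  + by apply: cvg_at_right_filter; exact: continuous_horner.
  + by apply: cvg_at_left_filter; exact: continuous_horner.
- by move=> x _; rewrite derivE.
Qed.

Definition box_strip (a : R) (j : nat) : set (R * R) := `]0, a[ `*` `]j%:R, j.+1%:R[.

Lemma measurable_box_strip a j : measurable (box_strip a j).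
Proof. by apply: measurableX; exact: measurable_itv. Qed.

Definition diff_pow m (p : R * R) : R := (p.1 - p.2) ^+ m.

Lemma measurable_diff_pow m (D : set (R * R)) : measurable_fun D (diff_pow m).
Proof.
apply: measurable_funTS; apply: measurable_funX; apply: measurable_funB.
- exact: measurable_fst.
- exact: measurable_snd.
Qed.

Lemma integrable_diff_pow m a j : 0 <= a ->
  (mu \x mu)%E.-integrable (box_strip a j) (EFin \o diff_pow m).
Proof.
move=> a0; apply: measurable_bounded_integrable.
- exact: measurable_box_strip.
- rewrite [X in (X < _)%E]product_measure1E; try exact: measurable_itv.
  have mi (u v : R) : (mu `]u, v[ < +oo)%E.
    by rewrite lebesgue_measure_itv /=; case: ifP => _; rewrite -?EFinB ?ltry.
  apply: lte_mul_pinfty; [exact: measure_ge0| |exact: mi].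
  by rewrite ge0_fin_numE; [exact: mi|exact: measure_ge0].
- exact: measurable_diff_pow.
exists ((a + j.+1%:R) ^+ m); split; first exact: num_real.
move=> M ltM [x y] [/=]; rewrite !in_itv /= => /andP[x0 xa] /andP[jy yj].
apply: le_trans (ltW ltM); rewrite /diff_pow /= normrX lerXn2r ?nnegrE //.
  by rewrite addr_ge0.
rewrite (le_trans (ler_normB _ _)) // lerD // ger0_norm ?ltW //.
by rewrite (le_lt_trans _ jy).
Qed.

Lemma integral_box_strip m (a : R) j : 0 <= a ->
  (\int[mu \x mu]_(p in box_strip a j) (diff_pow m p)%:E =
   (((a - j%:R) ^+ m.+2 - (a - j.+1%:R) ^+ m.+2 - (- j%:R) ^+ m.+2 +
     (- j.+1%:R) ^+ m.+2) / (m.+1 * m.+2)%:R)%:E)%E.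
Proof.
move=> a0; rewrite integral_mkcond -integral21_prod_meas1; last first.
  by rewrite -integrable_mkcond; [exact: integrable_diff_pow|exact: measurable_box_strip].
(* [q] is a primitive in y of the inner integral over x, and [r] below is one of the integrand in
   x. *)
pose q : {poly R} := - ((m.+1 * m.+2)%:R^-1 *: ((a%:P - 'X) ^+ m.+2 - (- 'X) ^+ m.+2)).
have qE y : q.[y] = - ((a - y) ^+ m.+2 - (- y) ^+ m.+2) / (m.+1 * m.+2)%:R.
  by rewrite /q !hornerE /= mulNr mulrC.
have q'E y : (q^`()).[y] = ((a - y) ^+ m.+1 - (- y) ^+ m.+1) / m.+1%:R.
  rewrite /q derivN derivZ derivB !deriv_exp derivB derivN derivC derivX sub0r.
  rewrite !(hornerMn, hornerN, hornerZ, hornerD, hornerM, horner_exp, hornerC, hornerX).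
  rewrite -!pred_Sn -[X in X - _]mulr_natl -[X in _ - X]mulr_natl natrM.
  have c0 : (m.+1%:R : R) != 0 by rewrite pnatr_eq0.
  have d0 : (m.+2%:R : R) != 0 by rewrite pnatr_eq0.
  move: (m.+1%:R : R) (m.+2%:R : R) c0 d0 ((a - y) ^+ m.+1) ((- y) ^+ m.+1) => c d c0 d0 u v.
  by field; rewrite c0 d0.
have Gx y : (\int[mu]_x ((EFin \o diff_pow m) \_ (box_strip a j)) (x, y) =
    ((EFin \o horner q^`()) \_ `]j%:R, j.+1%:R[) y)%E.
  have [yj|yj] := boolP (y \in (`]j%:R, j.+1%:R[ : set R)); last first.
    rewrite [RHS]patchN //; apply: integral0_eq => x _; rewrite patchN //.
    apply: contra yj.
    by rewrite !in_setE => -[].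
  rewrite patchT //= q'E.
  pose r : {poly R} := m.+1%:R^-1 *: ('X - y%:P) ^+ m.+1.
  have r'E x : (r^`()).[x] = (x - y) ^+ m.
    rewrite /r derivZ deriv_exp derivB derivC derivX subr0.
    rewrite !(hornerMn, hornerN, hornerZ, hornerD, hornerM, horner_exp, hornerC, hornerX).
    by rewrite mul1r -pred_Sn -[X in _ * X]mulr_natl mulKf // pnatr_eq0.
  transitivity (\int[mu]_(x in (`]0%R, a[ : set R)) (r^`().[x])%:E)%E.
    rewrite [RHS]integral_mkcond; apply: eq_integral => x _.
    rewrite /patch; have -> : ((x, y) \in box_strip a j) = (x \in (`]0, a[ : set R)).
      apply/idP/idP; rewrite !in_setE; first by case.
      by move=> xa; split => //=; move: yj; rewrite in_setE.
    by case: ifP => //= _; rewrite r'E.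
  rewrite integral_deriv_poly // /r; congr EFin.
  rewrite !(hornerMn, hornerN, hornerZ, hornerD, hornerM, horner_exp, hornerC, hornerX).
  by rewrite sub0r -mulrBr mulrC.
transitivity (\int[mu]_y ((EFin \o horner q^`()) \_ `]j%:R, j.+1%:R[) y)%E.
  by apply: eq_integral => y _; exact: Gx.
rewrite -integral_mkcond integral_deriv_poly; last by rewrite ler_nat.
congr EFin; rewrite !qE -mulrBl; congr (_ / _); ring.
Qed.

Lemma shape_functionalE lam n : (2 <= n)%N -> shape_functional R lam n =
  n%:R^-1 * \sum_(0 <= j < size lam)
     (((nth 0%N lam j)%:R - j%:R) ^+ n - ((nth 0%N lam j)%:R - j.+1%:R) ^+ n
      - (- j%:R) ^+ n + (- j.+1%:R) ^+ n).
Proof.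
move=> n2; case: n n2 => [|[|m]] // _; rewrite /shape_functional subn1 subn2 /=.
pose A j := box_strip (nth 0%N lam j)%:R j.
have -> : diagram_region lam =
    \big[classical_sets.setU/classical_sets.set0]_(j <- index_iota 0 (size lam)) A j.
  rewrite -classical_sets.bigcup_seq; apply/seteqP; split => [p [j [h1 h2]]|p [j _ [h1 h2]]].
    exists j; last by split; rewrite /= in_itv.
    rewrite /= mem_index_iota /= ltnNge; apply/negP => sj.
    by move: h1; rewrite nth_default // => /andP[h h']; move: (lt_trans h h'); rewrite ltxx.
  by exists j; move: h1 h2; rewrite /= !in_itv.
rewrite /Rintegral integral_bigsetU_EFin //=; first last.
- by apply/measurable_EFinP; exact: measurable_diff_pow.
- move=> i j _ _ [p [[_ +] [_ +]]]; rewrite /= !in_itv /= => /andP[i1 i2] /andP[j1 j2].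
  have := lt_trans i1 j2; have := lt_trans j1 i2; rewrite !ltr_nat !ltnS => ji ij.
  by apply/eqP; rewrite eqn_leq ij ji.
- exact: iota_uniq.
- by move=> i; exact: measurable_box_strip.
under eq_bigr => j _ do rewrite integral_box_strip //.
rewrite sumEFin /= mulr_sumr mulr_sumr; apply: eq_bigr => j _.
have c0 : (m.+1%:R : R) != 0 by rewrite pnatr_eq0.
rewrite natrM invfM [LHS]mulrCA [m.+1%:R * _]mulrA mulfV // mul1r mulrC.
by [].
Qed.

End ShapeIntegral.

(** * Power series through truncated polynomials *)

Section TruncatedPolynomials.
Variable F : comNzRingType.
Implicit Types (p q A B : {poly F}) (M n : nat).

(** Congruence modulo ['X^M]. *)
Definition eqX M p q := forall i, (i < M)%N -> p`_i = q`_i.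

Lemma eqX_refl M p : eqX M p p. Proof. by []. Qed.

Lemma eqX_sym M p q : eqX M p q -> eqX M q p.
Proof. by move=> e i iM; rewrite e. Qed.

Lemma eqX_trans M q p r : eqX M p q -> eqX M q r -> eqX M p r.
Proof. by move=> e1 e2 i iM; rewrite e1 ?e2. Qed.

Lemma eqXD M p p' q q' : eqX M p p' -> eqX M q q' -> eqX M (p + q) (p' + q').
Proof. by move=> e1 e2 i iM; rewrite !coefD e1 ?e2. Qed.

Lemma eqXM M p p' q q' : eqX M p p' -> eqX M q q' -> eqX M (p * q) (p' * q').
Proof.
move=> e1 e2 i iM; rewrite !coefM; apply: eq_bigr => j _.
by rewrite e1 ?e2 // ?(leq_ltn_trans _ iM) ?leq_subr // -ltnS.
Qed.

Lemma eqX_exp M n p q : eqX M p q -> eqX M (p ^+ n) (q ^+ n).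
Proof. by move=> e; elim: n => // n IH; rewrite !exprS; apply: eqXM. Qed.

Lemma eqX_leq M M' p q : (M' <= M)%N -> eqX M p q -> eqX M' p q.
Proof. by move=> le e i iM; rewrite e // (leq_trans iM). Qed.

Lemma eqX_deriv M p q : eqX M.+1 p q -> eqX M p^`() q^`().
Proof. by move=> e i iM; rewrite !coef_deriv e. Qed.

Lemma eqX_mulX M p q : eqX M.+1 (p * 'X) (q * 'X) -> eqX M p q.
Proof. by move=> e i iM; have := e i.+1 iM; rewrite !coefMX. Qed.

Lemma eqX_comp_r M p q q' : eqX M q q' -> eqX M (p \Po q) (p \Po q').
Proof.
move=> e; elim/poly_ind: p => [|p c IH]; first by rewrite !comp_poly0.
rewrite !comp_polyD !comp_polyM !comp_polyX !comp_polyC.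
by apply: eqXD => //; apply: eqXM.
Qed.

Lemma mulX_of_coef0 q : q`_0 = 0 -> q = drop_poly 1 q * 'X.
Proof.
move=> q0; rewrite -[LHS](poly_take_drop 1) expr1 [take_poly _ _](_ : _ = 0) ?add0r //.
apply/polyP => i; rewrite coef_take_poly coef0; case: i => //.
Qed.

Lemma eqX_comp_l M p p' q : q`_0 = 0 -> eqX M p p' -> eqX M (p \Po q) (p' \Po q).
Proof.
move=> q0 e; rewrite -(subrK p' p) comp_polyD => i iM.
have -> : p - p' = drop_poly M (p - p') * 'X^M.
  rewrite -[LHS](poly_take_drop M) [take_poly _ _](_ : _ = 0) ?add0r //.
  apply/polyP => j; rewrite coef_take_poly coef0.
  by case: ifP => // jM; rewrite coefB e ?subrr.
rewrite coefD comp_polyM comp_Xn_poly (mulX_of_coef0 q0) exprMn mulrA coefMXn iM.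
by rewrite add0r.
Qed.

(** The remainder contains the square of ['X^(n.+1)], and 2n + 2 >= n + 2. *)
Lemma taylor1 p A B n : eqX n.+2 (p \Po (A + B * 'X^(n.+1)))
  (p \Po A + B * 'X^(n.+1) * (p^`() \Po A)).
Proof.
elim/poly_ind: p => [|p c IH].
  by rewrite !comp_poly0 deriv0 comp_poly0 mulr0 addr0.
rewrite derivD derivM derivX derivC addr0 mulr1.
rewrite !comp_polyD !comp_polyM !comp_polyX !comp_polyC.
rewrite [X in eqX _ _ X]addrAC; apply: eqXD => //.
apply: eqX_trans (eqXM IH (@eqX_refl _ _)) _ => i lt.
set P := p \Po A; set Q := p^`() \Po A; set Z := B * 'X^(n.+1).
have -> : (P + Z * Q) * (A + Z) = P * A + Z * (Q * A + P) + Q * B * B * 'X^n * 'X^(n.+2).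
  by rewrite /Z !exprS; ring.
by rewrite coefD coefMXn lt addr0.
Qed.

End TruncatedPolynomials.

Section TruncatedSeries.
Variable F : numFieldType.
Implicit Types (p q : {poly F}) (f g : nat -> F) (M n : nat).

Lemma coef_ps_trunc f n i : (ps_trunc f n)`_i = if (i < n.+1)%N then f i else 0.
Proof. by rewrite /ps_trunc coef_poly. Qed.

Lemma eqX_ps_trunc f n n' : (n <= n')%N -> eqX n.+1 (ps_trunc f n) (ps_trunc f n').
Proof.
by move=> le i lt; rewrite !coef_ps_trunc lt (leq_trans lt).
Qed.

Lemma ps_mulE f g n n' : (n <= n')%N -> ps_mul f g n = (ps_trunc f n' * ps_trunc g n')`_n.
Proof.
by move=> le; rewrite /ps_mul (eqXM (eqX_ps_trunc f le) (eqX_ps_trunc g le)).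
Qed.

Lemma ps_compE f g n n' : g 0%N = 0 -> (n <= n')%N ->
  ps_comp f g n = (ps_trunc f n' \Po ps_trunc g n')`_n.
Proof.
move=> g0 le; rewrite /ps_comp (eqX_comp_r _ (eqX_ps_trunc g le)) //.
by rewrite (eqX_comp_l _ (eqX_ps_trunc f le)) // coef_ps_trunc /= g0.
Qed.

Definition exp_poly n : {poly F} := \poly_(j < n.+1) (j`!%:R)^-1.

Lemma exp_poly_comp n p : exp_poly n \Po p = \sum_(j < n.+1) (j`!%:R)^-1 *: p ^+ j.
Proof.
rewrite /exp_poly poly_def linear_sum; apply: eq_bigr => j _.
by rewrite /= linearZ /= comp_Xn_poly.
Qed.

Lemma deriv_exp_poly n : eqX n (exp_poly n)^`() (exp_poly n).
Proof.
move=> i lt; rewrite coef_deriv !coef_poly ltnS lt (leqW lt) factS natrM invfM.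
by rewrite -[LHS]mulr_natr mulrAC mulVf ?mul1r // pnatr_eq0.
Qed.

Lemma ps_expE f n n' : f 0%N = 0 -> (n <= n')%N ->
  ps_exp f n = (exp_poly n' \Po ps_trunc f n')`_n.
Proof.
move=> f0 le; rewrite -(eqX_comp_r _ (eqX_ps_trunc f le)) //.
have e : eqX n.+1 (exp_poly n) (exp_poly n').
  by move=> i lt; rewrite !coef_poly lt (leq_trans lt).
rewrite -(eqX_comp_l _ e) ?coef_ps_trunc //= exp_poly_comp coef_sum.
by apply: eq_bigr => j _; rewrite coefZ.
Qed.

Lemma ps_truncS f n : ps_trunc f n.+1 = ps_trunc f n + (f n.+1)%:P * 'X^(n.+1).
Proof.
apply/polyP => i; rewrite coefD coefMXn coefC !coef_ps_trunc.
have [lt|gt|->] := ltngtP i n.+1; first by rewrite (leqW lt) addr0.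
  by rewrite [(i < n.+2)%N]ltnS leqNgt gt /= subn_eq0 leqNgt gt addr0.
by rewrite leqnn subnn add0r.
Qed.

(** Course-of-values recursion, the state [G n] being the polynomial of the values found so far. *)
Lemma sequence_recursion (c : F) (step : nat -> {poly F} -> F) :
  exists g : nat -> F, g 0%N = c /\ forall n, g n.+1 = step n (ps_trunc g n).
Proof.
pose G := fix G n : {poly F} :=
  if n is n'.+1 then G n' + (step n' (G n'))%:P * 'X^(n'.+1) else c%:P.
pose g n := (G n)`_n.
have GE n : G n = ps_trunc g n.
  elim: n => [|n IH] /=.
    by apply/polyP => i; rewrite coef_ps_trunc coefC; case: i => //=; rewrite /g /= coefC.
  rewrite ps_truncS IH; congr (_ + _%:P * _).
  have -> : g n.+1 = (G n + (step n (G n))%:P * 'X^(n.+1))`_n.+1 by [].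
  by rewrite coefD IH coef_ps_trunc ltnn coefMXn ltnn subnn coefC add0r.
exists g; split; first by rewrite /g /= coefC.
move=> n; have -> : g n.+1 = (G n + (step n (G n))%:P * 'X^(n.+1))`_n.+1 by [].
by rewrite coefD GE coef_ps_trunc ltnn coefMXn ltnn subnn coefC add0r.
Qed.

(** Existence makes [xget] return an inverse and not its default. By [taylor1] and f_1 = 1, the
    unknown of order n + 1 enters the coefficient of that order additively. *)
Lemma ps_comp_invP f : f 0%N = 0 -> f 1%N = 1 -> ps_comp_inv f 0%N = 0 /\
  forall n, ps_comp f (ps_comp_inv f) n = (n == 1%N)%:R.
Proof.
move=> f0 f1; rewrite /ps_comp_inv.
apply: (@xgetPex _ (fun=> 0) [set g : nat -> F |
      g 0%N = 0 /\ forall n, ps_comp f g n = (n == 1%N)%:R]%classic).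
have [g [g0 gS]] := sequence_recursion 0 (fun n G =>
  (n.+1 == 1)%:R - (ps_trunc f n.+1 \Po G)`_n.+1).
exists g; split => // -[|n].
  rewrite /ps_comp /ps_trunc !poly_def !big_ord_recl !big_ord0 g0 f0.
  by rewrite !scale0r !addr0 comp_poly0 coef0.
rewrite /ps_comp (ps_truncS g) (taylor1 _ _ _ (ltnSn _)) coefD.
rewrite [_ * 'X^_]mulrC -mulrA coefXnM ltnn subnn coefCM gS.
have -> : ((ps_trunc f n.+1)^`() \Po ps_trunc g n)`_0 = 1.
  rewrite -horner_coef0 horner_comp horner_coef0 coef_ps_trunc /= g0 horner_coef0.
  by rewrite coef_deriv coef_ps_trunc f1.
by rewrite mulr1 addrC subrK.
Qed.

Lemma ps_invP f : f 0%N != 0 -> forall n, ps_mul f (ps_inv f) n = (n == 0%N)%:R.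
Proof.
move=> f0; rewrite /ps_inv.
apply: (@xgetPex _ (fun=> 0) [set g : nat -> F |
      forall n, ps_mul f g n = (n == 0%N)%:R]%classic).
have [g [g0 gS]] := sequence_recursion (f 0%N)^-1 (fun n G =>
  - (f 0%N)^-1 * (ps_trunc f n.+1 * G)`_n.+1).
exists g => -[|n].
  by rewrite /ps_mul coefM big_ord_recl big_ord0 !coef_ps_trunc /= addr0 g0 mulfV.
rewrite /ps_mul (ps_truncS g) mulrDr coefD mulrA coefMXn ltnn subnn coefMC.
by rewrite coef_ps_trunc /= gS mulNr mulrN mulVKf ?subrr.
Qed.

End TruncatedSeries.

(** * Lagrange inversion *)

Section LagrangeInversion.
Variable F : numFieldType.

Lemma coef_deriv_pow (p : {poly F}) a : (0 < a)%N ->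
  (p^`() * p ^+ a.-1)`_a.-1 = (p ^+ a)`_a.
Proof.
case: a => // a _ /=; have := congr1 (fun q : {poly F} => q`_a) (deriv_exp p a.+1).
rewrite coef_deriv coefMn /= => e.
by apply: (@pmulrnI F a.+1); rewrite // -e.
Qed.

Variables (f C : nat -> F).
Hypotheses (f0 : f 0%N = 0) (C0 : C 0%N = 0) (CS : forall m, C m.+1 = ps_exp f m).

Let h := ps_comp_inv C.
Let rho := ps_inv (fun m => h m.+1).

Lemma C1 : C 1%N = 1.
Proof. by rewrite CS /ps_exp big_ord_recl big_ord0 expr0 coef1 mulr1 addr0 invr1. Qed.

Section Truncation.
Variable M : nat.
(** With C(z) = z exp(f(z)) and its inverse h, these are truncations: [K] of h(z)/z, [phi] of
    z/h(z), [s] of f, and [T] stands for exp(f(h(z))). *)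
Let H := ps_trunc h M.+1.
Let K := ps_trunc (fun m => h m.+1) M.
Let phi := ps_trunc rho M.
Let s := ps_trunc f M.
Let T := exp_poly F M \Po (s \Po H).

Let h0 : h 0%N = 0. Proof. by have [] := ps_comp_invP C0 C1. Qed.

Lemma HK : H = K * 'X.
Proof.
apply/polyP => i; rewrite coefMX !coef_ps_trunc.
by case: i => [|i] //=; rewrite !ltnS.
Qed.

Let H_0 : H`_0 = 0. Proof. by rewrite coef_ps_trunc. Qed.

(** C(h(z)) = z reads h(z) exp(f(h(z))) = z, and a factor z is cancelled. *)
Lemma KT1 : eqX M.+1 (K * T) 1.
Proof.
apply: eqX_mulX; rewrite mul1r mulrAC -HK.
have cE : eqX M.+2 (ps_trunc C M.+1) ('X * (exp_poly F M \Po s)).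
  move=> i lt; rewrite coefXM coef_ps_trunc lt; case: i lt => [|i] lt; first by rewrite C0.
  by rewrite /= CS (ps_expE (n' := M)).
have e := eqX_comp_l H_0 cE; rewrite comp_polyM comp_polyX -comp_polyA -/T in e.
apply: eqX_trans (eqX_sym e) _ => i lt.
rewrite -(ps_compE _ h0) // (proj2 (ps_comp_invP C0 C1)) coefX.
by [].
Qed.

Lemma K0 : h 1%N != 0.
Proof.
have := KT1 (ltn0Sn _); rewrite coefM big_ord_recl big_ord0 coef1 /= coef_ps_trunc /=.
by move=> e; apply: contra_eq_neq e => ->; rewrite mul0r addr0 eq_sym oner_eq0.
Qed.

Lemma Kphi1 : eqX M.+1 (K * phi) 1.
Proof.
move=> i lt; rewrite -ps_mulE // (ps_invP K0) coef1 //.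
Qed.

Lemma Tphi : eqX M.+1 T phi.
Proof.
have e : eqX M.+1 (T * (K * phi)) (T * 1) by apply: eqXM Kphi1.
rewrite mulr1 in e; apply: eqX_trans (eqX_sym e) _.
rewrite mulrA [T * K]mulrC -[X in eqX _ _ X]mul1r; exact: eqXM KT1 _.
Qed.

Lemma phi0 : rho 0%N = 1.
Proof.
have := Tphi (ltn0Sn M); rewrite coef_ps_trunc /= => <-.
rewrite -horner_coef0 !horner_comp !horner_coef0 H_0 horner_coef0 coef_ps_trunc /= f0.
by rewrite horner_coef0 coef_poly /= invr1.
Qed.

(** By [Tphi], this differentiates exp(f(h(z))). *)
Lemma deriv_phi : eqX M phi^`() ((s \Po H)^`() * phi).
Proof.
apply: eqX_trans (eqX_deriv (eqX_sym Tphi)) _.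
rewrite /T deriv_comp mulrC; apply: eqXM => //.
apply: eqX_trans (eqX_leq (leqnSn _) Tphi).
apply: eqX_comp_l (@deriv_exp_poly F M).
by rewrite -horner_coef0 horner_comp !horner_coef0 H_0 horner_coef0 coef_ps_trunc.
Qed.

Lemma Kphi_exp a b : (a <= b)%N -> eqX M.+1 (K ^+ a * phi ^+ b) (phi ^+ (b - a)).
Proof.
move=> le; rewrite -{1}(subnK le) exprD mulrCA -exprMn -[X in eqX _ _ X]mulr1.
by rewrite -[X in eqX _ _ (_ * X)](expr1n _ a); apply: eqXM => //; apply: eqX_exp Kphi1.
Qed.

Lemma deriv_K : eqX M (K^`() * phi ^+ 2) (- phi^`()).
Proof.
have := eqX_deriv Kphi1; rewrite derivM -[1]polyC1 derivC => e i lt.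
have e2 : eqX M ((K^`() * phi + K * phi^`()) * phi) (0 * phi) by apply: eqXM.
have e3 : eqX M (K * phi * phi^`()) (1 * phi^`()).
  by apply: eqXM => //; apply: eqX_leq Kphi1.
have := e2 i lt; rewrite mul0r mulrDl coefD coef0 => /eqP; rewrite addr_eq0 => /eqP.
rewrite expr2 mulrA => ->; rewrite mulrAC (e3 i lt) mul1r coefN //.
Qed.

(** The coefficient is the residue of h'/h^(a+1), which is the derivative of a Laurent series unless
    a = 0. *)
Lemma coef_derivH a : (a < M)%N -> (H^`() * phi ^+ a.+1)`_a = (a == 0%N)%:R.
Proof.
move=> lt; rewrite HK derivM derivX mulr1 mulrDl coefD.
have := Kphi_exp (isT : (1 <= a.+1)%N) (leqW lt); rewrite expr1 subn1 /= => ->.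
case: a lt => [|a] lt; first by rewrite expr0 coef1 mulrAC coefMX add0r.
have e : eqX M (K^`() * phi ^+ a.+2) (- phi^`() * phi ^+ a).
  by rewrite -[a.+2]/(2 + a)%N exprD mulrA; apply: eqXM => //; exact: deriv_K.
rewrite mulrAC coefMX /= (e _ (ltnW lt)) mulNr coefN.
by rewrite (@coef_deriv_pow phi a.+1) // addNr.
Qed.

Lemma lagrange_inversion_aux : (0 < M)%N -> M%:R * f M = (phi ^+ M)`_M.
Proof.
move=> M0; rewrite -(coef_deriv_pow phi M0).
have M1 : (M.-1 < M)%N by rewrite prednK.
have -> : (phi^`() * phi ^+ M.-1)`_M.-1 = ((s \Po H)^`() * phi ^+ M)`_M.-1.
  have -> : phi ^+ M = phi * phi ^+ M.-1 by rewrite -exprS prednK.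
  by rewrite mulrA; apply: (eqXM deriv_phi _ M1).
have -> : (s \Po H)^`() = \sum_(i < M.+1) f i *: (H^`() * H ^+ i.-1 *+ i).
  rewrite /s /ps_trunc poly_def linear_sum linear_sum; apply: eq_bigr => i _.
  by rewrite /= comp_polyZ comp_Xn_poly derivZ deriv_exp.
(* Multiplied by phi^M, the power h^j becomes z^j phi^(M-j); by [coef_derivH] only the index i = M
   of the expansion survives. *)
have term j : (j < M)%N -> (H^`() * H ^+ j * phi ^+ M)`_M.-1 = (M.-1 == j)%:R.
  move=> lt; rewrite {2}HK exprMn mulrA mulrAC coefMXn ltnNge.
  have le : (j <= M.-1)%N by rewrite -ltnS prednK.
  rewrite le /= -mulrA; set a := (M.-1 - j)%N.
  have aM : (a < M)%N by rewrite (leq_ltn_trans (leq_subr _ _)).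
  rewrite (eqXM (@eqX_refl _ M H^`()) (eqX_leq (leqnSn _) (Kphi_exp (ltnW lt)))) //.
  have -> : (M - j = a.+1)%N by rewrite /a -subSn ?prednK.
  by rewrite coef_derivH // /a subn_eq0 eqn_leq le andbT.
rewrite mulr_suml coef_sum big_ord_recr big1 /= => [|i _].
  rewrite add0r -scalerAl coefZ [_ * phi ^+ M]mulrnAl coefMn term ?prednK // eqxx.
  by rewrite mulr_natr mulr_natl.
rewrite -scalerAl coefZ [_ * phi ^+ M]mulrnAl coefMn; case: i => [[|i] lti] /=.
  by rewrite mulr0n mulr0.
rewrite term ?(ltnW lti) //; case: eqP => [e|_]; last by rewrite mul0rn mulr0.
by exfalso; move: lti e M0; clear; lia.
Qed.

End Truncation.

Lemma lagrange_inversion n : (0 < n)%N ->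
  f n = n%:R^-1 * (ps_trunc rho n ^+ n)`_n.
Proof.
move=> n0; rewrite -lagrange_inversion_aux // mulrA mulVf ?mul1r //.
by rewrite pnatr_eq0 -lt0n.
Qed.

End LagrangeInversion.

Lemma shape_functional_free_cumulant (R : realType) lam n : (2 <= n)%N ->
  shape_functional R lam n =
  n%:R^-1 * (ps_trunc (free_cumulant R lam) n ^+ n)`_n.
Proof.
move=> n2; have := @lagrange_inversion R
  (fun i => if (2 <= i)%N then shape_functional R lam i else 0)
  (cauchy_series R lam) erefl erefl (fun=> erefl) n (ltnW n2).
by rewrite n2.
Qed.

Lemma free_cumulant0 (R : realType) lam : free_cumulant R lam 0 = 1.
Proof.
exact: (@phi0 R (fun i => if (2 <= i)%N then shape_functional R lam i else 0)
  (cauchy_series R lam) erefl erefl (fun=> erefl) 0).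
Qed.

Lemma free_cumulant1 (R : realType) lam : free_cumulant R lam 1 = 0.
Proof.
have := @lagrange_inversion R
  (fun i => if (2 <= i)%N then shape_functional R lam i else 0)
  (cauchy_series R lam) erefl erefl (fun=> erefl) 1 isT.
by rewrite /= invr1 mul1r expr1 coef_ps_trunc => /esym.
Qed.

(** * The triangular system between shape functionals and cumulants *)

Section ShapeFromCumulants.

(** The Lagrange formula with R_0 = 1 and R_1 = 0 built in. The ring is arbitrary because the system
    is used over the reals and over polynomial rings, the rationals being embedded by [iota]. *)
Definition shape_poly (A : comNzRingType) (iota : rat -> A) (x : nat -> A) n : A :=
  iota n%:R^-1 * ((1 + \sum_(2 <= m < n.+1) x m *: 'X^m) ^+ n)`_n.

Lemma rmorph_shape_poly (A B : comNzRingType) (iota : rat -> A) (iota' : rat -> B)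
    (g : {rmorphism A -> B}) (x : nat -> A) n : (forall c, g (iota c) = iota' c) ->
  g (shape_poly iota x n) = shape_poly iota' (g \o x) n.
Proof.
move=> gi; rewrite /shape_poly rmorphM /= gi -coef_map rmorphXn rmorphD rmorph1.
rewrite rmorph_sum (eq_bigr (fun m => (g \o x) m *: 'X^m)) // => m _.
by rewrite /= map_polyZ map_polyXn.
Qed.

Lemma eq_shape_poly (A : comNzRingType) (iota : rat -> A) (x y : nat -> A) n :
  (forall m, (2 <= m <= n)%N -> x m = y m) ->
  shape_poly iota x n = shape_poly iota y n.
Proof.
move=> xy; rewrite /shape_poly.
rewrite (@eq_big_nat _ _ _ _ _ _ (fun m => y m *: 'X^m)) // => m /andP[m2 mn].
by rewrite xy // m2.
Qed.

(* The right-hand side is [x n] plus a polynomial in the [x m] with [m < n]. *)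
Lemma shape_poly_split (A : comNzRingType) (iota : {rmorphism rat -> A})
    (x : nat -> A) n : (2 <= n)%N ->
  shape_poly iota x n = x n + shape_poly iota (fun m => if (m < n)%N then x m else 0) n.
Proof.
move=> n2; rewrite /shape_poly big_nat_recr //= [in RHS]big_nat_recr //= ltnn.
rewrite scale0r addr0.
set p := 1 + \sum_(2 <= m < n) x m *: 'X^m.
rewrite [in RHS](_ : \sum_(2 <= m < n) _ = \sum_(2 <= m < n) x m *: 'X^m); last first.
  by apply: eq_big_nat => m /andP[_ ->].
rewrite addrA -/p.
case: n n2 @p => // n n2 p.
(* The top variable enters through the derivative of the power at p, whose constant term cancels the
   leading inverse. *)
have := @taylor1 A 'X^(n.+1) p (x n.+1)%:P n n.+1 (ltnSn _).
rewrite !comp_Xn_poly mul_polyC => ->.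
rewrite coefD mulrDr addrC; congr (_ + _).
rewrite derivXn raddfMn /= comp_Xn_poly -scalerAl coefZ coefXnM ltnn subnn.
rewrite coefMn -horner_coef0 horner_exp horner_coef0.
have -> : p`_0 = 1.
  rewrite coefD coef1 coef_sum big1_seq ?addr0 // => m /andP[_].
  rewrite mem_index_iota => /andP[m2 _].
  by rewrite coefZ coefXn; case: m m2 => // m _; rewrite mulr0.
rewrite expr1n mulrCA -[X in iota X]mulr1.
have -> : iota (n.+1%:R^-1 * 1) * n.+1%:R = 1.
  by rewrite -(rmorph_nat iota n.+1) -rmorphM mulr1 mulVf ?rmorph1 // pnatr_eq0.
by rewrite mulr1.
Qed.

(** The system is solved by subtracting the contribution of the lower cumulants from the n-th
    indeterminate. [T] does not depend on the ring, so it can be evaluated both on diagrams and on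
    formal cumulants. *)
Lemma cumulants_from_shapes N : exists T : nat -> mpoly N rat,
  forall (A : comNzRingType) (iota : {rmorphism rat -> A}) (x : nat -> A) n,
    (2 <= n < N)%N ->
    mpoly.mmap iota (fun i : 'I_N => shape_poly iota x i) (T n) = x n.
Proof.
suff H : forall M, exists T : nat -> mpoly N rat,
    forall (A : comNzRingType) (iota : {rmorphism rat -> A}) (x : nat -> A) n,
    (2 <= n < N)%N -> (n < M)%N ->
    mpoly.mmap iota (fun i : 'I_N => shape_poly iota x i) (T n) = x n.
  by have [T TE] := H N; exists T => A iota x n nN; apply: TE => //; case/andP: nN.
elim => [|M [T IH]]; first by exists (fun=> 0).
case: N T IH => [|N] T IH; first by exists T => A iota x n /andP[].
pose C0 : {rmorphism rat -> mpoly N.+1 rat} := @mpolyC N.+1 rat.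
pose T' n := if (n < M)%N then T n else
  mpolyX rat (mnm1 (inord n : 'I_N.+1)) -
  shape_poly C0 (fun m => if (m < M)%N then T m else 0) n.
exists T' => A iota x n nN; rewrite ltnS leq_eqVlt => /predU1P[nM|nM]; last first.
  by rewrite /T' nM IH.
rewrite /T' nM ltnn -nM rmorphB /= mmapX mmap1U inordK; last by case/andP: nN.
rewrite (rmorph_shape_poly (iota' := iota) (g := mpoly.mmap _ _)); last first.
  by move=> c; rewrite /= mpoly.mmapC.
rewrite shape_poly_split; last by case/andP: nN.
rewrite -[RHS]addr0 -addrA; congr (_ + _); apply/eqP; rewrite subr_eq0; apply/eqP.
apply: eq_shape_poly => m /andP[m2 _] /=; rewrite nM; case: ifP => // mM.
  rewrite IH ?m2 //=; first by case/andP: nN => _; apply: ltn_trans; rewrite nM.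
by rewrite rmorph0.
Qed.

End ShapeFromCumulants.

(** * Multilinear coefficients *)

Section MultilinearCoefficients.
Variable l : nat.
Implicit Types (A : {set 'I_l}) (v : 'I_l).

Definition mlcoef (F : nzRingType) A (f : mpoly l F) : F := mpoly.mcoeff (mesym1 A) f.

Lemma mesym1E A i : mesym1 A i = (i \in A) :> nat.
Proof. by rewrite mnmE. Qed.

Lemma mesym1_inj : injective (@mesym1 l).
Proof.
move=> A B /mnmP e; apply/setP => i; have := e i; rewrite !mesym1E.
by case: (i \in A); case: (i \in B).
Qed.

Lemma mesym1_split A (k1 k2 : multinom l) : mesym1 A = mnm_add k1 k2 ->
  exists B1 B2, k1 = mesym1 B1 /\ k2 = mesym1 B2.
Proof.
move=> /mnmP e; exists [set i | k1 i != 0%N]%SET, [set i | k2 i != 0%N]%SET.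
by split; apply/mnmP => i; have := e i; rewrite mnmDE !mesym1E inE;
  case: (k1 i) (k2 i) => [|[|a]] [|[|b]] //=; case: (i \in A).
Qed.

Section Ring.
Variable F : comNzRingType.
Implicit Types (f g : mpoly l F).

Lemma mlcoefMX A f v : mlcoef A (f * mpolyX F (mnm1 v)) =
  if v \in A then mlcoef (A :\ v) f else 0.
Proof.
rewrite /mlcoef; case: ifPn => vA.
  have -> : mesym1 A = mnm_add (mnm1 v) (mesym1 (A :\ v)).
    apply/mnmP => i; rewrite mnmDE !mesym1E mnm1E !inE eq_sym.
    by case: eqVneq => [->|_] //=; rewrite vA.
  exact: mcoeffMX.
rewrite mcoeffM big1 // => -[k1 k2] /= /eqP e; rewrite mcoeffX.
case: eqP => [kv|]; last by rewrite mulr0.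
have /mnmP/(_ v) := e; rewrite -kv mnmDE mesym1E mnm1E eqxx (negbTE vA).
by rewrite addn1.
Qed.

(** Congruence modulo the squares of the variables; it respects products since a divisor of a
    squarefree monomial is squarefree. *)
Definition mleq f g := forall A, mlcoef A f = mlcoef A g.

Lemma mleqM f f' g g' : mleq f f' -> mleq g g' -> mleq (f * g) (f' * g').
Proof.
move=> ef eg A; rewrite /mlcoef !mcoeffM; apply: eq_bigr => -[k1 k2] /= /eqP e.
have [B1 [B2 [-> ->]]] := mesym1_split e.
by rewrite -!/(mlcoef _ _) ef eg.
Qed.

Lemma mleq_prod (J : finType) (f g : J -> mpoly l F) :
  (forall j, mleq (f j) (g j)) -> mleq (\prod_j f j) (\prod_j g j).
Proof. by move=> e; elim/big_ind2: _ => // *; apply: mleqM. Qed.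

Lemma mleq_multilinear f : mleq f (\sum_A mlcoef A f *: mpolyX F (mesym1 A)).
Proof.
move=> B; rewrite {2}/mlcoef raddf_sum (bigD1 B) //= mpoly.mcoeffZ mcoeffX eqxx mulr1.
rewrite big1 ?addr0 // => A neq.
by rewrite mpoly.mcoeffZ mcoeffX (inj_eq mesym1_inj) (negbTE neq) mulr0.
Qed.

(** [B] records the factor from which each variable is taken. *)
Lemma mlcoef_prod (J : finType) (f : J -> mpoly l F) :
  mlcoef [set: 'I_l]%SET (\prod_j f j) =
  \sum_(B : {ffun 'I_l -> J}) \prod_j mlcoef [set v | B v == j]%SET (f j).
Proof.
rewrite (mleq_prod (fun j => mleq_multilinear (f j))) bigA_distr_bigA /=.
rewrite /mlcoef raddf_sum /=.
pose h (B : {ffun 'I_l -> J}) := [ffun j => [set v | B v == j]%SET].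
have h_inj : injective h.
  move=> B B' /ffunP e; apply/ffunP => v.
  by have := e (B v); rewrite !ffunE => /setP/(_ v); rewrite !inE eqxx => /esym/eqP.
transitivity (\sum_(E : {ffun J -> {set 'I_l}} | E \in h @: setT)
    \prod_j mlcoef (E j) (f j)); last first.
  rewrite big_imset /=; last by move=> ? ? _ _ /h_inj.
  by apply: eq_big => [B|B _]; rewrite ?inE //; apply: eq_bigr => j _; rewrite ffunE.
rewrite [RHS]big_mkcond; apply: eq_bigr => E _.
rewrite scaler_prod mprodXE mpoly.mcoeffZ mcoeffX.
have -> : (\big[@mnm_add l/mnm0]_j mesym1 (E j) == mesym1 [set: 'I_l]%SET) =
    (E \in h @: setT).
  apply/eqP/imsetP => [/mnmP e|[B _ ->]].
    have cnt v : (\sum_j (v \in E j) = 1)%N.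
      have := e v; rewrite mnm_sumE mesym1E inE => ev; rewrite -[RHS]/(nat_of_bool true) -ev.
      by apply: eq_bigr => j _; rewrite mesym1E.
    have ex v : exists j, v \in E j.
      apply/existsP; apply: contraT; rewrite negb_exists => /forallP no.
      by have := cnt v; rewrite big1 // => j _; rewrite (negbTE (no j)).
    have [B BE] := fin_all_exists ex; exists [ffun v => B v] => //.
    apply/ffunP => j; rewrite ffunE; apply/setP => v; rewrite !inE ffunE.
    apply/idP/eqP => [vj|<-]; last exact: BE.
    apply/eqP; apply: contraT => neq; have := cnt v.
    by rewrite (bigD1 (B v)) //= (bigD1 j) 1?eq_sym //= BE vj.
  apply/mnmP => v; rewrite mnm_sumE mesym1E inE (bigD1 (B v)) //= mesym1E ffunE inE eqxx.
  by rewrite big1 // => j neq; rewrite mesym1E ffunE inE eq_sym (negbTE neq).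
by case: ifP; rewrite ?mulr1 ?mulr0.
Qed.

End Ring.

(** By hypothesis [y] multiplies like a + \sum_v b_v x_v on multilinear coefficients, and the
    falling factorial counts the ways to take the variables of [A] from distinct factors. The
    abstract [c] covers coefficients that are rational numbers and coefficients that are polynomials
    in ['X]. *)
Lemma coef_pow_linear (E B : comNzRingType) (c : {set 'I_l} -> E -> B) (y : E)
    (a : B) (b : 'I_l -> B) :
  (forall A, c A 1 = (A == set0)%:R) ->
  (forall A f, c A (f * y) = c A f * a + \sum_(v in A) c (A :\ v) f * b v) ->
  forall n A, c A (y ^+ n) = (n ^_ #|A|)%:R * a ^+ (n - #|A|) * \prod_(v in A) b v.
Proof.
move=> c1 cy; elim=> [|n IH] A.
  rewrite expr0 c1 sub0n expr0 mulr1; have [->|A0] := eqVneq A set0.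
    by rewrite cards0 big_set0 mulr1.
  by rewrite -card_gt0 in A0; case: #|A| A0 => // m _; rewrite mul0r.
rewrite exprSr cy IH.
have [->|A0] := eqVneq A set0.
  by rewrite cards0 !big_set0 !subn0 !ffactn0 addr0 !mulr1 !mul1r exprSr.
have cardA v : v \in A -> #|A :\ v| = #|A|.-1 by move=> vA; rewrite (cardsD1 v A) vA.
rewrite [X in _ + X](eq_bigr (fun=> (n ^_ #|A|.-1)%:R * a ^+ (n - #|A|.-1) * \prod_(v in A) b v)).
  move: A0; rewrite sumr_const -card_gt0; case: #|A| => // m _ /=.
  rewrite subSS ffactSS; set P := \prod_(v in A) b v.
  have -> : (n ^_ m.+1)%:R * a ^+ (n - m.+1) * P * a = (n ^_ m.+1)%:R * a ^+ (n - m) * P.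
    have [ltmn|lenm] := ltnP m n; last by rewrite ffact_small ?ltnS // !mul0r.
    by rewrite mulrAC -[_ * _ * a]mulrA -exprSr subnSK.
  rewrite -mulrnAl -mulrnAl -mulrnA -mulrDl -mulrDl -natrD.
  congr (_%:R * _ * _); rewrite ffactnSr.
  have [lemn|ltnm] := leqP m n; last by rewrite ffact_small // mul0n muln0.
  by rewrite -mulnDr mulnC; congr (_ * _)%N; lia.
move=> v vA; rewrite IH cardA // (big_setD1 v vA) /= -mulrA.
by congr (_ * _); rewrite mulrC.
Qed.

End MultilinearCoefficients.

(** * Multirectangular diagrams *)

Section CyclesOf.
Variables (k : nat) (s : 'S_k).

Lemma porbit_in_porbits i : porbit s i \in porbits s.
Proof. exact: imset_f. Qed.

Definition cycle_of (i : 'I_k) : cycles s :=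
  exist (fun c => c \in porbits s) (porbit s i) (porbit_in_porbits i).

Lemma cycle_ofP (c : cycles s) : exists i, cycle_of i = c.
Proof.
have /imsetP[i _ ci] := valP c; exists i.
by apply: val_inj; rewrite /= -ci.
Qed.

Lemma cycle_of_eq i j : (cycle_of i == cycle_of j) = (i \in porbit s j).
Proof. by rewrite -val_eqE /= eq_porbit_mem. Qed.

Lemma cycle_of_perm i : cycle_of (s i) = cycle_of i.
Proof. by apply/eqP; rewrite cycle_of_eq; have := mem_porbit s 1 i; rewrite expg1. Qed.

Lemma invariant_cycle_of (X : eqType) (f : 'I_k -> X) : (forall i, f (s i) = f i) ->
  forall i j, cycle_of i = cycle_of j -> f i = f j.
Proof.
move=> inv i j /eqP; rewrite cycle_of_eq => /porbitP[n ->].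
by elim: n => [|n IH]; rewrite ?expg0 ?perm1 // expgSr permM inv.
Qed.

Lemma mem_cycle_of (c : cycles s) i : (i \in val c) = (cycle_of i == c).
Proof.
by have [j <-] := cycle_ofP c; rewrite cycle_of_eq.
Qed.

Lemma card_cycles : #|{: cycles s}| = #|porbits s|.
Proof. by rewrite card_sig; apply: eq_card => x; rewrite inE. Qed.

End CyclesOf.

(** Used for rows with weight 1 and for variables with weight p_v, both sent to their blocks. *)
Lemma sum_pushforward (R : comNzSemiRingType) (C X Y : finType) (u : X -> R) (g : X -> Y)
    (F : {ffun C -> Y} -> R) :
  \sum_(r : {ffun C -> X}) (\prod_c u (r c)) * F [ffun c => g (r c)] =
  \sum_(b : {ffun C -> Y}) (\prod_c \sum_(x | g x == b c) u x) * F b.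
Proof.
rewrite (partition_big (fun r : {ffun C -> X} => [ffun c => g (r c)]) xpredT) //=.
apply: eq_bigr => b _; rewrite bigA_distr_big_dep mulr_suml.
apply: eq_big => [r|r /eqP -> //].
apply/eqP/familyP => [<- c|H]; first by rewrite unfold_in ffunE.
by apply/ffunP => c; rewrite ffunE; apply/eqP; exact: H.
Qed.

Section CountCompatible.
Variables (lam : seq nat) (k : nat) (s1 s2 : 'S_k).
Local Notation n := (sumn lam).
Local Notation row := (@box_row lam).
Local Notation col := (@box_col lam).

Lemma nth_le_sumn i : (nth 0 lam i <= n)%N.
Proof.
elim: lam i => [|a t IH] [|i] //=; first exact: leq_addr.
by apply: leq_trans (IH i) _; exact: leq_addl.
Qed.

Definition col_ord (i : 'I_n) : 'I_n :=
  Ordinal (leq_trans (box_col_lt i) (nth_le_sumn (row i))).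

(** A compatible map amounts to a row for each cycle of [s2] and a column for each cycle of [s1].
    Once the rows are chosen the columns are independent, that of [d] having to fit in all the rows
    met by [d]. *)
Lemma card_compatible :
  #|[set f : {ffun 'I_k -> 'I_n} | compatible row col f s1 s2]%SET| =
  (\sum_(r : {ffun cycles s2 -> 'I_(size lam)}) \prod_(d : cycles s1)
    #|[set x : 'I_n | [forall i, (cycle_of s1 i == d) ==>
                        (x < nth 0 lam (r (cycle_of s2 i)))%N]]%SET|)%N.
Proof.
pose ok d (r : {ffun cycles s2 -> 'I_(size lam)}) (x : 'I_n) :=
  [forall i, (cycle_of s1 i == d) ==> (x < nth 0 lam (r (cycle_of s2 i)))%N].
pose Y := [set rg : {ffun cycles s2 -> 'I_(size lam)} * {ffun cycles s1 -> 'I_n} |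
  [forall d, ok d rg.1 (rg.2 d)]]%SET.
transitivity #|Y|; last first.
  rewrite -sum1_card (eq_bigl (fun rg : {ffun cycles s2 -> 'I_(size lam)} *
      {ffun cycles s1 -> 'I_n} => true && [forall d, ok d rg.1 (rg.2 d)])).
    rewrite -(pair_big_dep xpredT (fun r (g : {ffun cycles s1 -> 'I_n}) =>
      [forall d, ok d r (g d)]) (fun _ _ => 1%N)) /=.
    apply: eq_bigr => r _; rewrite sum1dep_card.
    rewrite -[LHS](_ : #|family (fun d => [pred x | ok d r x])| = _).
      rewrite card_family /image_mem foldrE big_map big_enum.
      by apply: eq_bigr => d _; apply: eq_card => x; rewrite !inE.
    by apply: eq_card => g; rewrite !inE; apply/familyP/forallP => H d; have := H d; rewrite inE.
  by move=> rg; rewrite inE.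
have [rep1 rep1P] := fin_all_exists (cycle_ofP (s := s1)).
have [rep2 rep2P] := fin_all_exists (cycle_ofP (s := s2)).
pose h (f : {ffun 'I_k -> 'I_n}) :=
  ([ffun c => row (f (rep2 c))], [ffun d => col_ord (f (rep1 d))]).
set X := [set f | _]%SET.
have hP f : f \in X -> (forall i, (h f).1 (cycle_of s2 i) = row (f i)) /\
    (forall i, (h f).2 (cycle_of s1 i) = col (f i) :> nat).
  rewrite inE => /andP[/forallP cr /forallP cc]; split=> i; rewrite ffunE.
    apply: (@invariant_cycle_of _ s2 _ (row \o f)); last exact: rep2P.
    by move=> j; apply/eqP/cr.
  apply: (@invariant_cycle_of _ s1 _ (col \o f)); last exact: rep1P.
  by move=> j; apply/eqP/cc.
rewrite -(card_in_imset (f := h) (D := X)); last first.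
  move=> f g fX gX e; apply/ffunP => i; have [f1 f2] := hP f fX; have [g1 g2] := hP g gX.
  by apply: box_inj; rewrite -?f1 -?g1 -?f2 -?g2 e.
apply: eq_card => -[r g]; apply/imsetP/idP => [[f fX e]|].
  have [f1 f2] := hP f fX; rewrite inE; apply/forallP => d; apply/forallP => i.
  by apply/implyP => /eqP <-; rewrite e f1 f2 box_col_lt.
rewrite inE => /forallP ok_rg.
have ex i : exists b, row b = r (cycle_of s2 i) /\ col b = g (cycle_of s1 i).
  have := forallP (ok_rg (cycle_of s1 i)) i; rewrite eqxx /= => lt.
  by have [b b1 b2] := box_ex lt; exists b.
have [f fE] := fin_all_exists ex.
have fX : [ffun i => f i] \in X.
  rewrite inE; apply/andP; split; apply/forallP => i; rewrite !ffunE.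
    by rewrite !(proj1 (fE _)) cycle_of_perm.
  by rewrite !(proj2 (fE _)) cycle_of_perm.
exists [ffun i => f i] => //.
rewrite /h; congr pair; apply/ffunP => c.
  by rewrite !ffunE (proj1 (fE _)) rep2P.
by apply: val_inj; rewrite !ffunE /= (proj2 (fE _)) rep1P.
Qed.

End CountCompatible.

Section Blocks.
Variables (m : nat) (P Q : nat -> nat).

(* The multirectangular diagram whose [i]-th block consists of [P i] rows of
   length [Q i], for i < m. *)
Definition blocks M := flatten [seq nseq (P i) i | i <- iota 0 M].
Definition block_shape := [seq Q i | i <- blocks m].
Definition block_start M := (\sum_(i < M) P i)%N.

Lemma blocksS M : blocks M.+1 = blocks M ++ nseq (P M) M.
Proof. by rewrite /blocks -[M.+1]addn1 iotaD map_cat flatten_cat /= cats0. Qed.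

Lemma size_blocks M : size (blocks M) = block_start M.
Proof.
elim: M => [|M IH]; first by rewrite /block_start big_ord0.
by rewrite blocksS size_cat size_nseq IH /block_start big_ord_recr.
Qed.

Lemma blocks_lt M i : i \in blocks M -> (i < M)%N.
Proof.
elim: M => // M IH; rewrite blocksS mem_cat mem_nseq => /orP[/IH/ltnW //|].
by case/andP => _ /eqP ->.
Qed.

Lemma count_blocks M i : count_mem i (blocks M) = if (i < M)%N then P i else 0%N.
Proof.
elim: M => // M IH; rewrite blocksS count_cat IH count_nseq /= ltnS.
by case: ltngtP => [lt|gt|->] //=; rewrite ?mul0n ?mul1n ?addn0.
Qed.

Lemma sum_blocks (V : zmodType) (g : nat -> nat -> V) M :
  \sum_(0 <= j < size (blocks M))
     (g (nth 0%N (blocks M) j) j.+1 - g (nth 0%N (blocks M) j) j) =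
  \sum_(0 <= i < M) (g i (block_start i.+1) - g i (block_start i)).
Proof.
elim: M => [|M IH]; first by rewrite !big_geq.
rewrite [RHS]big_nat_recr //= -IH blocksS size_cat size_nseq.
rewrite (@big_cat_nat _ _ _ (size (blocks M))) ?leq_addr //=; congr (_ + _).
  by apply: eq_big_nat => j /andP[_ lt]; rewrite !nth_cat lt.
rewrite -(size_blocks M) (_ : block_start M.+1 = (size (blocks M) + P M)%N); last first.
  by rewrite size_blocks /block_start big_ord_recr.
rewrite -telescope_sumr ?leq_addr //.
apply: eq_big_nat => j /andP[le lt]; rewrite !nth_cat ltnNge le /= nth_nseq.
by rewrite ltn_subLR // lt.
Qed.

Hypothesis Q_gt0 : forall i, (i < m)%N -> (0 < Q i)%N.
Hypothesis Q_dec : forall i j, (i <= j < m)%N -> (Q j <= Q i)%N.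

Lemma blocks_sorted M : sorted leq (blocks M).
Proof.
have tr : transitive leq by exact: leq_trans.
elim: M => // M IH; rewrite blocksS (sorted_pairwise tr) pairwise_cat.
rewrite -!(sorted_pairwise tr) IH /=; apply/andP; split.
  apply/allrelP => i j /blocks_lt/ltnW le; rewrite mem_nseq.
  by case/andP => _ /eqP ->.
by elim: (P M) => // -[|p] //= ->; rewrite leqnn.
Qed.

Lemma block_shape_partition : is_partition block_shape.
Proof.
apply/andP; split; last first.
  by apply/mapP => -[i /blocks_lt/Q_gt0 Qi e]; rewrite -e in Qi.
apply: (@homo_sorted_in _ _ [pred i | (i < m)%N] Q leq) (blocks_sorted m).
  by move=> i j im jm ij /=; apply: Q_dec; rewrite ij.
by apply/allP => i /blocks_lt.
Qed.

Lemma shape_functional_blocks (R : realType) n : (2 <= n)%N ->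
  shape_functional R block_shape n = n%:R^-1 * \sum_(0 <= i < m)
    ((- ((Q i)%:R - (block_start i.+1)%:R) ^+ n + (- (block_start i.+1)%:R) ^+ n) -
     (- ((Q i)%:R - (block_start i)%:R) ^+ n + (- (block_start i)%:R) ^+ n)).
Proof.
move=> n2; rewrite shape_functionalE //; congr (_ * _).
rewrite -(sum_blocks (fun i y => - ((Q i)%:R - y%:R) ^+ n + (- y%:R) ^+ n)).
rewrite size_map; apply: eq_big_nat => j /andP[_ lt].
by rewrite (nth_map 0%N) //; ring.
Qed.

Lemma card_ord_lt n q : (q <= n)%N -> #|[set x : 'I_n | (x < q)%N]%SET| = q.
Proof.
move=> le; rewrite -[RHS]card_ord -(card_imset _ (@widen_ord_inj n q le)).
apply: eq_card => x; rewrite inE; apply/idP/imsetP => [lt|[y _ ->]]; last exact: (ltn_ord y).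
by exists (Ordinal lt) => //; apply: val_inj.
Qed.

Variables (k : nat) (s1 s2 : 'S_k).

(** As [Q] decreases, this block has the shortest of the rows met by [d], which alone bounds the
    column of [d]. *)
Definition top_block (b : cycles s2 -> nat) (d : cycles s1) : nat :=
  (\max_(i | cycle_of s1 i == d) b (cycle_of s2 i))%N.

Lemma card_compatible_blocks :
  #|[set f : {ffun 'I_k -> 'I_(sumn block_shape)} |
     compatible (@box_row _) (@box_col _) f s1 s2]%SET| =
  (\sum_(b : {ffun cycles s2 -> 'I_m}) (\prod_c P (b c)) *
     \prod_(d : cycles s1) Q (top_block (fun c => val (b c)) d))%N.
Proof.
have ltj (j : 'I_(size block_shape)) : (j < size (blocks m))%N.
  by apply: leq_trans (ltn_ord j) _; rewrite size_map.
have ltb (j : 'I_(size block_shape)) : (nth 0%N (blocks m) j < m)%N.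
  exact/blocks_lt/mem_nth.
pose blk j := Ordinal (ltb j).
have QT (r : {ffun cycles s2 -> 'I_(size block_shape)}) d : #|[set x : 'I_(sumn block_shape) | [forall i, (cycle_of s1 i == d) ==>
      (x < nth 0 block_shape (r (cycle_of s2 i)))%N]]%SET| =
    Q (top_block (fun c => val (blk (r c))) d).
  have [i0 i0d] := cycle_ofP d.
  have [i1 i1d topE] : exists2 i, cycle_of s1 i == d &
      top_block (fun c => val (blk (r c))) d = blk (r (cycle_of s2 i)).
    have i0d' : cycle_of s1 i0 == d by apply/eqP.
    have A0 : (0 < #|[pred i | cycle_of s1 i == d]|)%N.
      by apply/card_gt0P; exists i0.
    have [i id iE] := eq_bigmax_cond (fun i => val (blk (r (cycle_of s2 i)))) A0.
    by exists i.
  rewrite topE -[RHS](card_ord_lt (n := sumn block_shape)); last first.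
    by rewrite /= -(nth_map _ 0%N Q) //; exact: nth_le_sumn.
  apply: eq_card => x; rewrite !inE.
  have nthE i : nth 0%N block_shape (r (cycle_of s2 i)) = Q (blk (r (cycle_of s2 i))).
    by rewrite /block_shape (nth_map 0%N).
  apply/forallP/idP => [/(_ i1)|lt i]; first by rewrite i1d nthE.
  apply/implyP => id; rewrite nthE; apply: leq_trans lt _.
  apply: Q_dec; apply/andP; split; last exact: ltb.
  have le : (val (blk (r (cycle_of s2 i))) <= top_block (fun c => val (blk (r c))) d)%N.
    by rewrite /top_block (bigD1 i) //= leq_maxl.
  by rewrite topE in le.
rewrite card_compatible.
have := @sum_pushforward nat (cycles s2) _ 'I_m (fun=> 1%N) blk
  (fun b => (\prod_(d : cycles s1) Q (top_block (fun c => val (b c)) d))%N).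
rewrite (eq_bigr (fun r : {ffun cycles s2 -> 'I_(size block_shape)} =>
  \prod_(d : cycles s1) #|[set x : 'I_(sumn block_shape) | [forall i, (cycle_of s1 i == d) ==>
      (x < nth 0 block_shape (r (cycle_of s2 i)))%N]]%SET|)%N); last first.
  move=> r _; rewrite big1 // mul1r; apply: eq_bigr => d _.
  by rewrite QT; congr Q; apply: eq_bigr => i _; rewrite ffunE.
move=> ->; apply: eq_bigr => b _; congr (_ * _)%N; apply: eq_bigr => c _.
transitivity (\sum_(x <- blocks m | x == b c) 1)%N; last first.
  by rewrite sum1_count count_blocks ltn_ord.
have e : size (blocks m) = size block_shape by rewrite size_map.
rewrite (big_nth 0%N) big_mkord e.
by apply: eq_bigl => j; rewrite -val_eqE.
Qed.

End Blocks.

Lemma mmap_comp_eval n (A : comNzRingType) (B : comNzRingType) (iota : {rmorphism rat -> A})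
    (iota' : rat -> B) (g : {rmorphism A -> B}) (y : 'I_n -> A) (P : mpoly n rat) :
  (forall c, g (iota c) = iota' c) ->
  g (mpoly.mmap iota y P) = mpoly.mmap iota' (g \o y) P.
Proof.
move=> gi; rewrite /mpoly.mmap rmorph_sum; apply: eq_bigr => m _.
rewrite rmorphM /= gi rmorph_prod; congr (_ * _).
by apply: eq_bigr => i _; rewrite rmorphXn.
Qed.

Lemma rmorph_eval_poly (A B : nzRingType) (g : {rmorphism A -> B}) (x : nat -> A)
    (K : malg (cmonom ge2) int) : g (eval_poly x K) = eval_poly (g \o x) K.
Proof.
rewrite /eval_poly /monalg.mmap rmorph_sum; apply: eq_bigr => s _.
rewrite rmorphM rmorph_int /eval_monomial rmorph_prod; congr (_ * _).
by apply: eq_bigr => i _; rewrite rmorphXn.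
Qed.

(** [grid_functional] isolates the coefficient at [m0] from finitely many values. *)
Lemma mpoly_vanish (R : realType) n (f : mpoly n rat) :
  (forall p : 'I_n -> nat, mpoly.mmap (ratr : rat -> R) (fun v => (p v)%:R) f = 0) -> f = 0.
Proof.
move=> vanish; apply/mpolyP => m0; rewrite mpoly.mcoeff0.
have [D leD] : exists D, forall m, m \in mpoly.msupp f -> forall i, (m i <= D)%N.
  exists (\max_(m <- mpoly.msupp f) \max_i m i)%N => m mf i.
  by rewrite (big_rem m mf) /=; apply: leq_trans (leq_maxl _ _); exact: leq_bigmax.
have [J [kap [x [_ [_ xE]]]]] := @grid_functional R n D
  (fun e => (e == [ffun i => m0 i])%:R).
have [m0f|] := boolP (m0 \in mpoly.msupp f); last by move/memN_msupp_eq0.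
have : \sum_t kap t * mpoly.mmap (ratr : rat -> R) (fun v => (x t v)%:R) f = 0.
  by rewrite big1 // => t _; rewrite vanish mulr0.
under eq_bigr => t _ do rewrite /mpoly.mmap mulr_sumr.
rewrite exchange_big big_seq /= (eq_bigr (fun m => ratr (mpoly.mcoeff m f) * (m == m0)%:R)).
  rewrite -big_seq (big_rem m0 m0f) /= eqxx mulr1 big1_seq ?addr0 => [|m /andP[_]].
    by move/eqP; rewrite fmorph_eq0 => /eqP.
  by rewrite mem_rem_uniq ?msupp_uniq // inE => /andP[/negbTE -> _]; rewrite mulr0.
move=> m mf; under eq_bigr => t _ do rewrite mulrCA.
rewrite -mulr_sumr; congr (_ * _).
have := xE [ffun i => m i]; rewrite (eq_bigr (fun t => kap t * mpoly.mmap1 (fun v => (x t v)%:R) m)).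
  move=> -> => [|i]; last by rewrite ffunE leD.
  congr (nat_of_bool _)%:R; apply/eqP/eqP => [/ffunP e|-> //].
  by apply/mnmP => i; have := e i; rewrite !ffunE.
by move=> t _; congr (_ * _); apply: eq_bigr => i _; rewrite ffunE.
Qed.

Lemma shape_poly_free_cumulant (R : realType) lam n : (2 <= n)%N ->
  shape_poly (ratr : rat -> R) (free_cumulant R lam) n = shape_functional R lam n.
Proof.
move=> n2; rewrite shape_functional_free_cumulant // /shape_poly.
have -> : ratr n%:R^-1 = n%:R^-1 :> R by rewrite fmorphV /= ratr_nat.
have -> // : ps_trunc (free_cumulant R lam) n =
  1 + \sum_(2 <= m < n.+1) free_cumulant R lam m *: 'X^m.
rewrite /ps_trunc poly_def -(big_mkord xpredT (fun i => free_cumulant R lam i *: 'X^i)).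
rewrite 2?big_ltn //; last by rewrite ltnS ltnW.
by rewrite free_cumulant0 free_cumulant1 scale0r add0r expr0 alg_polyC.
Qed.

Lemma shape_poly_small (A : comNzRingType) (iota : {rmorphism rat -> A}) x n :
  (n < 2)%N -> shape_poly iota x n = 0.
Proof.
case: n => [|[|n]] // _; rewrite /shape_poly; first by rewrite invr0 rmorph0 mul0r.
by rewrite big_geq // addr0 expr1 coef1 mulr0.
Qed.

(** * Block heights as polynomial variables *)

Section BlockPolynomials.
Variables (l m : nat) (rho : 'I_l -> 'I_m) (Q : nat -> nat).
Local Notation MP := (mpoly l rat).
Implicit Type A : {set 'I_l}.

Definition var v : MP := mpolyX rat (mnm1 v).
Definition start_set i := [set v | (rho v < i)%N]%SET.
Definition start_poly i : MP := \sum_(v in start_set i) var v.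

(** The formula of [shape_functional_blocks] in the variables p_v; the form [0 - start_poly i] makes
    [mlcoef_const_minus] apply to all four powers. *)
Definition shape_mpoly n : MP := mpolyC l n%:R^-1 * \sum_(0 <= i < m)
  ((- ((Q i)%:R - start_poly i.+1) ^+ n + (0 - start_poly i.+1) ^+ n) -
   (- ((Q i)%:R - start_poly i) ^+ n + (0 - start_poly i) ^+ n)).

Definition top_set A := (\max_(v in A) rho v)%N.

Definition shape_coef n A : rat :=
  if (A != set0) && (#|A| < n)%N then (-1) ^+ #|A|.-1 * (n.-1 ^_ #|A|.-1)%:R else 0.

Lemma mlcoef_const_minus (a : nat) (S : {set 'I_l}) n A :
  mlcoef A ((a%:R - \sum_(v in S) var v) ^+ n : MP) =
  (n ^_ #|A|)%:R * a%:R ^+ (n - #|A|) * ((-1) ^+ #|A| * (A \subset S)%:R).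
Proof.
rewrite (@coef_pow_linear l _ _ (@mlcoef l rat) _ a%:R (fun v => - (v \in S)%:R)).
- congr (_ * _); case: (boolP (A \subset S)) => [/subsetP AS|].
    rewrite (eq_bigr (fun=> -1)) ?prodr_const ?mulr1 // => v vA.
    by rewrite AS.
  move=> /subsetPn[v vA vS]; rewrite (bigD1 v) //= (negbTE vS).
  by rewrite oppr0 mul0r mulr0.
- move=> B; rewrite /mlcoef mpoly.mcoeff1; congr (nat_of_bool _)%:R.
  apply/eqP/eqP => [/mnmP e|->]; last by apply/mnmP => i; rewrite mesym1E inE mnm0E.
  by apply/setP => i; have := e i; rewrite mesym1E mnm0E inE; case: (i \in B).
move=> B f; rewrite mulrBr /mlcoef raddfB /= mulr_sumr raddf_sum /=; congr (_ + _).
  by rewrite !mulr_natr raddfMn.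
rewrite -sumrN big_mkcond [RHS]big_mkcond; apply: eq_bigr => v _.
have := mlcoefMX B f v; rewrite /mlcoef /var => ->.
by case: (v \in S); case: (v \in B); rewrite /= ?oppr0 ?mulr0 ?mulrN1.
Qed.

Lemma subset_start A i : A != set0 -> (A \subset start_set i) = (top_set A < i)%N.
Proof.
move=> /set0Pn[v0 v0A]; apply/subsetP/idP => [H|lt v vA].
  have A0 : (0 < #|A|)%N by apply/card_gt0P; exists v0.
  have [v vA vE] := eq_bigmax_cond (fun v => val (rho v)) A0.
  by have := H v vA; rewrite inE /top_set vE.
rewrite inE; apply: leq_ltn_trans lt.
by rewrite /top_set (bigD1 v) //= leq_maxl.
Qed.

(** The differences detect [A \subset start_set i], whose truth value changes only between i =
    [top_set A] and its successor, so a single block contributes. *)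
Lemma mlcoef_shape_mpoly n A : mlcoef A (shape_mpoly n) =
  shape_coef n A * (Q (top_set A))%:R ^+ (n - #|A|).
Proof.
rewrite /shape_mpoly /mlcoef mpoly.mcoeffCM raddf_sum /=.
pose I i : rat := (A \subset start_set i)%:R.
rewrite (eq_bigr (fun i => (n ^_ #|A|)%:R * (-1) ^+ #|A|.+1 *
   ((Q i)%:R ^+ (n - #|A|) - 0 ^+ (n - #|A|)) * (I i.+1 - I i))); last first.
  move=> i _; rewrite !raddfB !raddfD !raddfN /= -!/(mlcoef _ _).
  have z : (0 : MP) = 0%N%:R by [].
  rewrite /start_poly !mlcoef_const_minus z !mlcoef_const_minus /I exprS; ring.
rewrite /shape_coef; have [A0|A0] := eqVneq A set0.
  by rewrite mul0r big1 ?mulr0 // => i _; rewrite /I A0 !sub0set subrr mulr0.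
have top_lt : (top_set A < m)%N.
  have [v0 v0A] := set0Pn _ A0.
  have cA : (0 < #|A|)%N by apply/card_gt0P; exists v0.
  by have [v vA vE] := eq_bigmax_cond (fun v => val (rho v)) cA; rewrite /top_set vE ltn_ord.
rewrite (big_mkord xpredT) (bigD1 (Ordinal top_lt)) //= big1 => [|i ne]; last first.
  rewrite /I !subset_start // ltnS leq_eqVlt.
  move: ne; rewrite -val_eqE /= eq_sym => /negbTE ->.
  by rewrite /= subrr mulr0.
rewrite /I !subset_start // ltnS leqnn ltnn subr0 mulr1 /=.
(* For |A| >= n the exponent is 0 and the two powers cancel; hence the strict bound in
   [shape_coef]. *)
have [ltAn|leAn] := ltnP #|A| n; last first.
  by rewrite (eqP (leAn : (n - #|A| == 0)%N)) !expr0 subrr !mulr0 mul0r.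
have subA : (n - #|A| != 0)%N by rewrite subn_eq0 -ltnNge.
rewrite [0 ^+ _]expr0n (negbTE subA) subr0.
rewrite [LHS]mulrA [_ * (_ * _)]mulrA; congr (_ * _).
have c0 : (0 < #|A|)%N by rewrite card_gt0.
case: n #|A| ltAn c0 {subA} => [|n] [|a] //= _ _.
have n0 : (n.+1%:R : rat) != 0 by rewrite pnatr_eq0.
have -> : (-1) ^+ a.+2 = (-1) ^+ a :> rat by rewrite 2!exprS; ring.
by rewrite ffactSS natrM mulrA mulVf // mul1r mulrC.
Qed.

Lemma mlcoef_var_prod (C : finType) (psi : {ffun C -> 'I_l}) :
  mlcoef [set: 'I_l]%SET (\prod_c var (psi c)) = (injectiveb psi && (#|C| == l))%:R.
Proof.
rewrite /var mprodXE /mlcoef mcoeffX; congr (nat_of_bool _)%:R.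
have cntE v : mnm_add (\big[@mnm_add l/mnm0]_c mnm1 (psi c)) mnm0 v = #|[pred c | psi c == v]|.
  rewrite mnmDE mnm0E addn0 mnm_sumE -sum1_card [RHS]big_mkcond.
  by apply: eq_bigr => c _; rewrite mnm1E inE; case: eqP.
have cnt v : (\big[@mnm_add l/mnm0]_c mnm1 (psi c)) v = #|[pred c | psi c == v]|.
  by rewrite -cntE mnmDE mnm0E addn0.
apply/eqP/andP => [/mnmP e|[/injectiveP inj /eqP cardC]].
  have cnt1 v : #|[pred c | psi c == v]| = 1%N by rewrite -cnt e mesym1E inE.
  split.
    apply/injectiveP => c c' e'.
    have /card_le1P H := eq_leq (cnt1 (psi c)).
    have cin : c \in [pred c0 | psi c0 == psi c] by rewrite inE eqxx.
    by have := H c cin c'; rewrite !inE -e' eqxx => /esym/eqP.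
  rewrite -sum1_card (partition_big psi xpredT) //=.
  rewrite (eq_bigr (fun=> 1%N)) ?sum1_card ?card_ord // => v _.
  by rewrite sum1_card cnt1.
have [g gK Kg] : bijective psi by apply: inj_card_bij => //; rewrite card_ord cardC.
apply/mnmP => v; rewrite cnt mesym1E inE (eq_card1 (x := g v)) // => c.
by rewrite !inE; apply/eqP/eqP => [<-|->].
Qed.

Variables (k : nat).

(** Expanding each block size into its variables turns the choice of a block for a cycle of sigma2
    into the choice of a variable [psi c]. *)
Definition stanley_poly : MP :=
  \sum_(s : 'S_k * 'S_k | (s.2 * s.1)%g == init_cycle k k) (-1) ^+ (s.1 : bool) *
    \sum_(psi : {ffun cycles s.2 -> 'I_l}) (\prod_c var (psi c)) *
      (\prod_(d : cycles s.1) Q (top_block (fun c => val (rho (psi c))) d))%N%:R.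

Lemma mlcoef_stanley_poly : mlcoef [set: 'I_l]%SET stanley_poly =
  \sum_(s : 'S_k * 'S_k | (s.2 * s.1)%g == init_cycle k k) (-1) ^+ (s.1 : bool) *
    \sum_(psi : {ffun cycles s.2 -> 'I_l} | injectiveb psi && (#|{: cycles s.2}| == l))
      \prod_(d : cycles s.1) (Q (top_block (fun c => val (rho (psi c))) d))%:R.
Proof.
rewrite /mlcoef raddf_sum; apply: eq_bigr => s _ /=.
have inner : mpoly.mcoeff (mesym1 [set: 'I_l]%SET)
    (\sum_(psi : {ffun cycles s.2 -> 'I_l}) (\prod_c var (psi c)) *
      (\prod_(d : cycles s.1) Q (top_block (fun c => val (rho (psi c))) d))%N%:R) =
    \sum_(psi : {ffun cycles s.2 -> 'I_l} | injectiveb psi && (#|{: cycles s.2}| == l))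
      \prod_(d : cycles s.1) (Q (top_block (fun c => val (rho (psi c))) d))%:R.
  rewrite raddf_sum [RHS]big_mkcond; apply: eq_bigr => psi _ /=.
  rewrite mulr_natr raddfMn /= -/(mlcoef _ _) mlcoef_var_prod -natr_prod.
  by case: ifP; rewrite ?mul0rn.
by case: (odd_perm s.1); rewrite ?expr1 ?expr0 ?mulN1r ?mul1r ?raddfN /= inner.
Qed.

Hypothesis Q_gt0 : forall i, (i < m)%N -> (0 < Q i)%N.
Hypothesis Q_dec : forall i j, (i <= j < m)%N -> (Q j <= Q i)%N.
Variable R : realType.

Section Evaluation.
Variable p : 'I_l -> nat.

Definition block_size i := (\sum_(v | val (rho v) == i) p v)%N.
Local Notation lam := (block_shape m block_size Q).

Definition eval_at : MP -> R := mpoly.mmap (ratr : rat -> R) (fun v => (p v)%:R).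
HB.instance Definition _ := GRing.RMorphism.on eval_at.

Lemma eval_at_var v : eval_at (var v) = (p v)%:R.
Proof. by rewrite /eval_at /var mmapX mmap1U. Qed.

Lemma eval_at_const c : eval_at (mpolyC l c) = ratr c.
Proof. exact: mpoly.mmapC. Qed.

Lemma eval_at_start i : eval_at (start_poly i) = (block_start block_size i)%:R.
Proof.
rewrite rmorph_sum /= (eq_bigr (fun v => (p v)%:R)) => [|v _]; last exact: eval_at_var.
rewrite -natr_sum; congr _%:R.
rewrite /block_start /block_size (exchange_big_dep (fun v => rho v < i)%N) /=; last first.
  by move=> j v _ /eqP ->.
apply: eq_big => [v|v lt]; first by rewrite inE.
rewrite inE in lt; rewrite (bigD1 (Ordinal lt)) //= big1 ?addn0 // => j /andP[/eqP e].
by rewrite -val_eqE /= e eqxx.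
Qed.

Lemma eval_at_shape n : (2 <= n)%N -> eval_at (shape_mpoly n) = shape_functional R lam n.
Proof.
move=> n2; rewrite shape_functional_blocks //.
rewrite /shape_mpoly rmorphM /= eval_at_const fmorphV /= ratr_nat rmorph_sum.
congr (_ * _); apply: eq_bigr => i _.
by rewrite !(rmorphB, rmorphD, rmorphN, rmorphXn, rmorph0, rmorph_nat) /= !eval_at_start !sub0r.
Qed.

Lemma eval_at_stanley : eval_at stanley_poly =
  \sum_(s : 'S_k * 'S_k | (s.2 * s.1)%g == init_cycle k k) (-1) ^+ (s.1 : bool) *
    #|[set f : {ffun 'I_k -> 'I_(sumn lam)} |
        compatible (@box_row _) (@box_col _) f s.1 s.2]%SET|%:R.
Proof.
rewrite rmorph_sum; apply: eq_bigr => s _ /=.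
rewrite rmorphM rmorph_sign; congr (_ * _).
rewrite card_compatible_blocks // rmorph_sum natr_sum /=.
have := @sum_pushforward R (cycles s.2) _ 'I_m (fun v => (p v)%:R) rho (fun b =>
  (\prod_(d : cycles s.1) Q (top_block (fun c => val (b c)) d))%N%:R).
rewrite (eq_bigr (fun psi : {ffun cycles s.2 -> 'I_l} => eval_at ((\prod_c var (psi c)) *
      (\prod_(d : cycles s.1) Q (top_block (fun c => val (rho (psi c))) d))%N%:R))).
  move=> ->; apply: eq_bigr => b _; rewrite natrM; congr (_ * _).
  by rewrite natr_prod; apply: eq_bigr => c _; rewrite -natr_sum.
move=> psi _; rewrite rmorphM rmorph_nat; congr (_ * _%:R).
  by rewrite [RHS]rmorph_prod; apply: eq_bigr => c _; rewrite /= eval_at_var.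
by apply: eq_bigr => d _; congr Q; apply: eq_bigr => i _; rewrite ffunE.
Qed.

Lemma kerov_at_blocks (K : malg (cmonom ge2) int) : is_kerov_polynomial R k K ->
  eval_poly (free_cumulant R lam) K = eval_at stanley_poly.
Proof.
move=> /(_ lam (block_shape_partition _ Q_gt0 Q_dec)).
rewrite normalized_character_stanley eval_at_stanley => e.
apply: (fmorph_inj (real_complex R)); rewrite /= -e.
rewrite rmorph_sum; apply: eq_bigr => s _.
by rewrite rmorphM rmorph_sign rmorph_nat.
Qed.

End Evaluation.

(** Diagrams give equality at all natural numbers p_v, and [mpoly_vanish] makes it an identity of
    polynomials in the p_v, the numbers [Q] being fixed. *)
Lemma kerov_stanley_poly (K : malg (cmonom ge2) int) N (T : nat -> mpoly N rat) :
  is_kerov_polynomial R k K ->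
  (forall (A : comNzRingType) (iota : {rmorphism rat -> A}) (x : nat -> A),
    mpoly.mmap iota (fun i : 'I_N => shape_poly iota x i) (eval_poly T K) = eval_poly x K) ->
  mpoly.mmap (@mpolyC l rat) (fun i : 'I_N => shape_mpoly i) (eval_poly T K) = stanley_poly.
Proof.
move=> kerov TE; apply/eqP; rewrite -subr_eq0; apply/eqP.
apply: (@mpoly_vanish R) => p; rewrite -/(eval_at p _) rmorphB /=.
rewrite -(kerov_at_blocks p kerov) -(TE R ratr).
rewrite (@mmap_comp_eval _ _ _ (@mpolyC l rat) ratr (eval_at p)); last exact: eval_at_const.
apply/eqP; rewrite subr_eq0; apply/eqP.
have e (i : 'I_N) : (eval_at p \o (fun i : 'I_N => shape_mpoly i)) i =
    shape_poly (ratr : rat -> R) (free_cumulant R (block_shape m (block_size p) Q)) i.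
  rewrite /=; have [i2|i2] := ltnP i 2; last by rewrite shape_poly_free_cumulant // eval_at_shape.
  rewrite [RHS]shape_poly_small // /shape_mpoly; case: (val i) i2 => [|[|//]] _.
    by rewrite invr0 rmorph0 mul0r rmorph0.
  rewrite big1 ?mulr0 ?rmorph0 // => j _; rewrite !expr1; ring.
by congr mpoly.mmap; apply/funext => i.
Qed.

End BlockPolynomials.

(** * Comparison along chains *)

Section ChainIdentity.
Variables (l : nat) (w : 'I_l -> nat).
Implicit Types (A : {set 'I_l}) (sq : seq {set 'I_l}).

Definition chain_end sq := proper_chain sq && (last set0 sq == [set: 'I_l]%SET).

Lemma chain_nth_subset sq i j : proper_chain sq -> (i <= j < size sq)%N ->
  nth set0 sq i \subset nth set0 sq j.
Proof.
move=> ch /andP[ij jm].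
have tr : transitive (fun A B : {set 'I_l} => A \proper B).
  by move=> A B C; exact: proper_trans.
move: ij; rewrite leq_eqVlt => /predU1P[-> //|lt].
have : sorted (fun A B : {set 'I_l} => A \proper B) sq by exact: path_sorted ch.
rewrite (sorted_pairwise tr) => /(pairwiseP set0) H.
by apply: proper_sub; apply: H; rewrite ?inE // (ltn_trans lt).
Qed.

Lemma chain_has sq v : chain_end sq -> has (fun B : {set 'I_l} => v \in B) sq.
Proof.
case/andP => _; case/lastP: sq => [|sq B]; first by move=> /eqP/setP/(_ v); rewrite !inE.
by rewrite last_rcons has_rcons => /eqP ->; rewrite inE.
Qed.

Section OneChain.
Variables (sq : seq {set 'I_l}) (sq_end : chain_end sq).
Local Notation m := (size sq).

(** With this assignment the variables of blocks 0, ..., i form the set of index i in the chain. *)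
Definition chain_rank v : 'I_m :=
  Ordinal (etrans (esym (has_find (fun B : {set 'I_l} => v \in B) sq)) (chain_has v sq_end)).

Lemma chain_rank_le v (i : 'I_m) : (chain_rank v <= i)%N = (v \in nth set0 sq i).
Proof.
have [ch _] := andP sq_end; apply/idP/idP => [le|vi].
  have le' : (find (fun B : {set 'I_l} => v \in B) sq <= i < m)%N.
    by rewrite ltn_ord andbT.
  apply: (subsetP (chain_nth_subset ch le')).
  exact: (@nth_find _ set0 (fun B : {set 'I_l} => v \in B) sq (chain_has v sq_end)).
rewrite leqNgt; apply/negP => /= /(before_find set0).
by rewrite vi.
Qed.

Lemma top_set_chain A (i : 'I_m) : A != set0 ->
  (top_set chain_rank A <= i)%N = (A \subset nth set0 sq i).
Proof.
move=> A0; have e := subset_start chain_rank i.+1 A0; rewrite ltnS in e; rewrite -e.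
apply: eq_subset_r => v; rewrite inE ltnS; exact: chain_rank_le.
Qed.

Definition nat_extend (x : 'I_m -> nat) (i : nat) : nat :=
  if insub i is Some j then x j else 0%N.

Lemma nat_extendE x (i : 'I_m) : nat_extend x i = x i.
Proof. by rewrite /nat_extend valK. Qed.

Lemma nat_extend_lt x i (lt : (i < m)%N) : nat_extend x i = x (Ordinal lt).
Proof. exact: (nat_extendE x (Ordinal lt)). Qed.

(* The exponents of [Q] cumulate to the values of [edge_fun] along the chain. *)
Lemma grid_chain D : exists (G : finType) (kap : G -> rat) (Q : G -> nat -> nat),
  (forall t i, (i < m)%N -> (0 < Q t i)%N) /\
  (forall t i j, (i <= j < m)%N -> (Q t j <= Q t i)%N) /\
  forall (J : finType) (V : J -> {set 'I_l}) (d : J -> nat),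
    (forall j, V j != set0) -> (\sum_j d j <= D)%N ->
    \sum_t kap t * \prod_j (Q t (top_set chain_rank (V j)))%:R ^+ d j =
    (all (hall_ok w (edge_fun V d)) sq)%:R.
Proof.
(* [cum e i] is the total exponent of Q_0, ..., Q_i, and [phi] imposes the Hall conditions on it. *)
pose cum (e : {ffun 'I_m -> nat}) (i : 'I_m) := (\sum_(a < m | (a <= i)%N) e a)%N.
pose phi (e : {ffun 'I_m -> nat}) : rat := [forall i : 'I_m,
  (weight w (nth set0 sq i) <= cum e i)%N &&
  ((nth set0 sq i == [set: 'I_l]%SET) ==> (cum e i == weight w (nth set0 sq i)))]%:R.
have [G [kap [x [xpos [xdec xE]]]]] := grid_functional D phi.
exists G, kap, (fun t => nat_extend (x t)); split; last split.
- by move=> t i lt; rewrite nat_extend_lt.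
- move=> t i j /andP[ij jm]; rewrite !nat_extend_lt ?(leq_ltn_trans ij) //.
    by move=> ?; move: ij; rewrite leq_eqVlt => /predU1P[e|lt];
      [subst j; rewrite (bool_irrelevance jm _) | apply/ltnW/xdec].
move=> J V d V0 dD.
have top_lt j : (top_set chain_rank (V j) < m)%N.
  have A0 : (0 < #|V j|)%N by rewrite card_gt0.
  have [v vA vE] := eq_bigmax_cond (fun v => val (chain_rank v)) A0.
  by rewrite /top_set vE ltn_ord.
pose e : {ffun 'I_m -> nat} := [ffun i : 'I_m => \sum_(j | top_set chain_rank (V j) == i :> nat) d j]%N.
have eD i : (e i <= D)%N.
  apply: leq_trans dD; rewrite ffunE [leqRHS](bigID (fun j => top_set chain_rank (V j) == i :> nat)) /=.
  exact: leq_addr.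
transitivity (\sum_t kap t * \prod_i (x t i)%:R ^+ e i).
  apply: eq_bigr => t _; congr (_ * _).
  rewrite (partition_big (fun j => Ordinal (top_lt j)) xpredT) //=.
  apply: eq_bigr => i _; rewrite ffunE -prodrXr.
  apply: eq_big => [j|j /eqP ij]; first by rewrite -val_eqE.
  by rewrite nat_extend_lt ij.
rewrite xE // /phi; congr (nat_of_bool _)%:R.
(* The top block of V_j is at most i exactly when V_j lies in the set of index i. *)
have cumE (i : 'I_m) : cum e i = edge_fun V d (nth set0 sq i).
  transitivity (\sum_(a < m | (a <= i)%N)
      \sum_(j | top_set chain_rank (V j) == a :> nat) d j)%N.
    by apply: eq_bigr => a _; rewrite ffunE.
  rewrite /edge_fun.
  rewrite (exchange_big_dep (fun j => top_set chain_rank (V j) <= i)%N) /=; last first.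
    by move=> a j le /eqP ->.
  apply: eq_big => [j|j le]; first by rewrite top_set_chain.
  rewrite (bigD1 (Ordinal (top_lt j))) /=; last by rewrite le eqxx.
  rewrite big1 ?addn0 // => a /andP[/andP[_ /eqP aj]].
  by rewrite -val_eqE /= aj eqxx.
apply/forallP/(all_nthP set0) => [H i lt|H i].
  by have := H (Ordinal lt); rewrite cumE /hall_ok.
by have := H i (ltn_ord i); rewrite cumE /hall_ok.
Qed.

End OneChain.
End ChainIdentity.

Section MonomialIndices.
Variable N : nat.
Implicit Type tau : multinom N.

(** The factors of a monomial are listed with repetition, so that [mlcoef_prod] can distribute the
    variables over them. *)
Definition mnm_seq tau : seq 'I_N := flatten [seq nseq (tau i) i | i <- enum 'I_N].
Definition mnm_nth tau (j : 'I_(size (mnm_seq tau))) : 'I_N := tnth (in_tuple (mnm_seq tau)) j.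

Lemma mmap1_seq (A : comNzRingType) (y : 'I_N -> A) tau :
  mpoly.mmap1 y tau = \prod_(j < size (mnm_seq tau)) y (mnm_nth j).
Proof.
rewrite -(big_tnth _ _ (mnm_seq tau) xpredT y) /mnm_seq big_flatten big_map /=.
rewrite /mpoly.mmap1 -big_enum /=; apply: eq_bigr => i _.
by rewrite big_nseq iter_mulr_1.
Qed.

Lemma mlcoef_mmap l (y : 'I_N -> mpoly l rat) (P : mpoly N rat) :
  mlcoef [set: 'I_l]%SET (mpoly.mmap (@mpolyC l rat) y P) =
  \sum_(tau <- mpoly.msupp P) mpoly.mcoeff tau P *
    \sum_(F : {ffun 'I_l -> 'I_(size (mnm_seq tau))})
      \prod_j mlcoef (block F j) (y (mnm_nth j)).
Proof.
rewrite /mlcoef /mpoly.mmap raddf_sum; apply: eq_bigr => tau _ /=.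
by rewrite mpoly.mcoeffCM -/(mlcoef _ _) mmap1_seq mlcoef_prod.
Qed.

End MonomialIndices.

Section ChainedIdentity.
Variables (l k N : nat) (w : 'I_l -> nat) (R : realType).
Variables (K : malg (cmonom ge2) int) (T : nat -> mpoly N rat).
Hypothesis kerov : is_kerov_polynomial R k K.
Hypothesis TE : forall (A : comNzRingType) (iota : {rmorphism rat -> A}) (x : nat -> A),
  mpoly.mmap iota (fun i : 'I_N => shape_poly iota x i) (eval_poly T K) = eval_poly x K.
Let P := eval_poly T K.

(** By [mlcoef_shape_mpoly], the exponent of Q contributed by factor [j]. *)
Definition degree_fun tau (F : {ffun 'I_l -> 'I_(size (@mnm_seq N tau))}) j :=
  (mnm_nth j - #|block F j|)%N.

Definition neighbours (s1 s2 : 'S_k) (psi : {ffun cycles s2 -> 'I_l}) (d : cycles s1) :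
    {set 'I_l} :=
  [set psi (cycle_of s2 i) | i in [set i | cycle_of s1 i == d]]%SET.

Lemma neighbours_neq0 s1 s2 psi d : @neighbours s1 s2 psi d != set0.
Proof.
have [i id] := cycle_ofP d; apply/set0Pn; exists (psi (cycle_of s2 i)).
by apply: imset_f; rewrite inE id.
Qed.

Lemma top_block_neighbours m (rho : 'I_l -> 'I_m) s1 s2 (psi : {ffun cycles s2 -> 'I_l}) d :
  top_block (fun c => val (rho (psi c))) d = top_set rho (@neighbours s1 s2 psi d).
Proof.
apply/eqP; rewrite eqn_leq; apply/andP; split; apply/bigmax_leqP.
  move=> i id; have vin : psi (cycle_of s2 i) \in neighbours psi d.
    by apply: imset_f; rewrite inE.
  by rewrite /top_set (bigD1 _ vin) /= leq_maxl.
move=> v /imsetP[i1]; rewrite inE => id ->.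
by rewrite /top_block (bigD1 i1) //= leq_maxl.
Qed.

Definition labelling (s2 : 'S_k) (psi : {ffun cycles s2 -> 'I_l}) :=
  injectiveb psi && (#|{: cycles s2}| == l).

(** The functional of [grid_chain] is applied to the coefficients of \prod_v p_v in both sides of
    [kerov_stanley_poly]. *)
Lemma chain_identity sq : chain_end sq ->
  \sum_(tau <- mpoly.msupp P) mpoly.mcoeff tau P *
    \sum_(F : {ffun 'I_l -> 'I_(size (mnm_seq tau))})
      (\prod_j shape_coef (mnm_nth j) (block F j)) *
      (all (hall_ok w (block_fun F (degree_fun F))) sq)%:R =
  \sum_(s : 'S_k * 'S_k | (s.2 * s.1)%g == init_cycle k k) (-1) ^+ (s.1 : bool) *
    \sum_(psi : {ffun cycles s.2 -> 'I_l} | labelling psi)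
      (all (hall_ok w (edge_fun (@neighbours s.1 s.2 psi) (fun=> 1%N))) sq)%:R.
Proof.
move=> sqE.
(* [D1] and [D2] bound the total exponents on the two sides, so that one grid serves for both. *)
pose D1 := (\sum_(tau <- mpoly.msupp P) \sum_(j < size (mnm_seq tau)) mnm_nth j)%N.
pose D2 := (\sum_(s : 'S_k * 'S_k) #|{: cycles s.1}|)%N.
have [G [kap [Q [Qpos [Qdec QE]]]]] := grid_chain w sqE (D1 + D2).
have id t := congr1 (mlcoef [set: 'I_l]%SET)
  (kerov_stanley_poly (chain_rank sqE) (Qpos t) (Qdec t) kerov TE).
transitivity (\sum_t kap t * mlcoef [set: 'I_l]%SET (mpoly.mmap (@mpolyC l rat)
    (fun i : 'I_N => shape_mpoly (chain_rank sqE) (Q t) i) P)).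
  under [RHS]eq_bigr => t _ do rewrite mlcoef_mmap mulr_sumr.
  rewrite [RHS]exchange_big /= big_seq [RHS]big_seq; apply: eq_bigr => tau tauP.
  under [RHS]eq_bigr => t _ do rewrite mulrCA mulr_sumr.
  rewrite -mulr_sumr exchange_big /=; congr (_ * _); apply: eq_bigr => F _.
  under [RHS]eq_bigr => t _ do
    (under eq_bigr => j _ do rewrite mlcoef_shape_mpoly; rewrite big_split mulrCA /=).
  (* An empty block makes its [shape_coef] vanish; otherwise the blocks are nonempty, as
     [grid_chain] requires. *)
  rewrite -mulr_sumr; have [->|sc0] := eqVneq (\prod_j shape_coef (mnm_nth j) (block F j)) 0.
    by rewrite !mul0r.
  congr (_ * _); rewrite -QE //.
    move=> j; apply: contraNneq sc0 => e.
    by rewrite (bigD1 j) //= /shape_coef e eqxx mul0r.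
  apply: leq_trans (leq_addr _ _); rewrite /D1 (big_rem tau tauP) /=.
  apply: leq_trans (leq_addr _ _); apply: leq_sum => j _; exact: leq_subr.
transitivity (\sum_t kap t * mlcoef [set: 'I_l]%SET (stanley_poly (chain_rank sqE) (Q t) k)).
  by apply: eq_bigr => t _; rewrite -id.
under eq_bigr => t _ do rewrite mlcoef_stanley_poly mulr_sumr.
rewrite exchange_big; apply: eq_bigr => s _ /=.
under eq_bigr => t _ do rewrite mulrCA mulr_sumr.
rewrite -mulr_sumr exchange_big /=; congr (_ * _); apply: eq_bigr => psi _.
rewrite -QE; last 2 first.
- exact: neighbours_neq0.
- rewrite sum1_card; apply: leq_trans (leq_addl _ _).
  by rewrite /D2 (bigD1 s) //= leq_addr.
apply: eq_bigr => t _; congr (_ * _); apply: eq_bigr => d _.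
rewrite expr1; congr (_%:R); congr (Q t _); exact: (top_block_neighbours (chain_rank sqE) psi d).
Qed.

Lemma mobius_identity :
  \sum_(tau <- mpoly.msupp P) mpoly.mcoeff tau P *
    \sum_(F : {ffun 'I_l -> 'I_(size (mnm_seq tau))})
      (\prod_j shape_coef (mnm_nth j) (block F j)) *
      mobius rat (hall_ok w (block_fun F (degree_fun F))) [set: 'I_l]%SET =
  \sum_(s : 'S_k * 'S_k | (s.2 * s.1)%g == init_cycle k k) (-1) ^+ (s.1 : bool) *
    \sum_(psi : {ffun cycles s.2 -> 'I_l} | labelling psi)
      mobius rat (hall_ok w (edge_fun (@neighbours s.1 s.2 psi) (fun=> 1%N))) [set: 'I_l]%SET.
Proof.
pose Phi sq : rat := \sum_(tau <- mpoly.msupp P) mpoly.mcoeff tau P *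
    \sum_(F : {ffun 'I_l -> 'I_(size (mnm_seq tau))})
      (\prod_j shape_coef (mnm_nth j) (block F j)) *
      (all (hall_ok w (block_fun F (degree_fun F))) sq)%:R.
pose Psi sq : rat :=
  \sum_(s : 'S_k * 'S_k | (s.2 * s.1)%g == init_cycle k k) (-1) ^+ (s.1 : bool) *
    \sum_(psi : {ffun cycles s.2 -> 'I_l} | labelling psi)
      (all (hall_ok w (edge_fun (@neighbours s.1 s.2 psi) (fun=> 1%N))) sq)%:R.
have e : chain_sum #|'I_l|.+1 [set: 'I_l]%SET [::] Phi =
    chain_sum #|'I_l|.+1 [set: 'I_l]%SET [::] Psi.
  apply: eq_chain_sum => // sq ch /= sqT; apply: chain_identity.
  by rewrite /chain_end ch -sqT eqxx.
transitivity (chain_sum #|'I_l|.+1 [set: 'I_l]%SET [::] Phi).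
  rewrite /Phi (@chain_sum_linear 'I_l rat _ _ _ _ (mpoly.msupp P) (fun tau => mpoly.mcoeff tau P)
    (fun tau sq => \sum_(F : {ffun 'I_l -> 'I_(size (mnm_seq tau))})
      (\prod_j shape_coef (mnm_nth j) (block F j)) *
      (all (hall_ok w (block_fun F (degree_fun F))) sq)%:R)).
  apply: eq_bigr => tau _; congr (_ * _).
  rewrite (@chain_sum_linear 'I_l rat _ _ _ _ _ (fun F : {ffun 'I_l -> 'I_(size (mnm_seq tau))} =>
      \prod_j shape_coef (mnm_nth j) (block F j))
    (fun F sq => (all (hall_ok w (block_fun F (degree_fun F))) sq)%:R)).
  by apply: eq_bigr => F _; congr (_ * _); rewrite (@chain_sum_full 'I_l).
rewrite e.
transitivity (\sum_(s : 'S_k * 'S_k | (s.2 * s.1)%g == init_cycle k k) (-1) ^+ (s.1 : bool) *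
  @chain_sum 'I_l rat #|'I_l|.+1 [set: 'I_l]%SET [::] (fun sq =>
    \sum_(psi : {ffun cycles s.2 -> 'I_l} | labelling psi)
      (all (hall_ok w (edge_fun (@neighbours s.1 s.2 psi) (fun=> 1%N))) sq)%:R)).
  rewrite -[RHS]big_filter -[RHS](@chain_sum_linear 'I_l rat); congr chain_sum.
  by apply/funext => sq; rewrite big_filter.
apply: eq_bigr => s _; congr (_ * _).
transitivity (\sum_(psi : {ffun cycles s.2 -> 'I_l} | labelling psi)
  1 * @chain_sum 'I_l rat #|'I_l|.+1 [set: 'I_l]%SET [::] (fun sq =>
      (all (hall_ok w (edge_fun (@neighbours s.1 s.2 psi) (fun=> 1%N))) sq)%:R)).
  rewrite -[RHS]big_filter -[RHS](@chain_sum_linear 'I_l rat); congr chain_sum.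
  by apply/funext => sq; rewrite big_filter; apply: eq_bigr => psi _; rewrite mul1r.
by apply: eq_bigr => psi _; rewrite mul1r (@chain_sum_full 'I_l).
Qed.

End ChainedIdentity.

(** * Evaluation of the two sides *)

Section CumulantSide.
Variables (l : nat) (q0 : 'I_l -> nat).
Hypothesis q0_ge2 : forall v, (2 <= q0 v)%N.
Implicit Type A : {set 'I_l}.

Definition cumulant_poly n : mpoly l rat := \sum_(v | q0 v == n) var v.

(** The n-th power of 1 + \sum_v p_v X^(q0 v) has a multilinear coefficient proportional to one
    power of X, with factor the falling factorial of n, which the division by n lowers to that of n
    - 1. *)
Lemma mlcoef_shape_cumulant n A :
  mlcoef A (shape_poly (@mpolyC l rat) cumulant_poly n) =
  if A != set0 then (n.-1 ^_ #|A|.-1)%:R * (\sum_(v in A) q0 v == n)%N%:R else 0.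
Proof.
rewrite /shape_poly /mlcoef mpoly.mcoeffCM -/(mlcoef _ _).
pose c (B : {set 'I_l}) (p : {poly mpoly l rat}) : {poly rat} := map_poly (mlcoef B) p.
have cE B p i : (c B p)`_i = mlcoef B p`_i by rewrite coef_map_id0 // /mlcoef raddf0.
(* The sum in [shape_poly] stops at degree n, which discards the variables of larger color. *)
pose b v : {poly rat} := if (q0 v <= n)%N then 'X^(q0 v) else 0.
have cy B (p : {poly mpoly l rat}) :
    c B (p * (1 + \sum_(2 <= m < n.+1) cumulant_poly m *: 'X^m)) =
    c B p * 1 + \sum_(v in B) c (B :\ v) p * b v.
  apply/polyP => i; rewrite cE mulrDr !mulr1 coefD /mlcoef raddfD /= coefD cE.
  congr (_ + _); rewrite mulr_sumr !coef_sum raddf_sum /=.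
  transitivity (\sum_(2 <= m < n.+1) \sum_(v in B | q0 v == m)
      if (i < m)%N then 0 else mlcoef (B :\ v) p`_(i - m)).
    apply: eq_bigr => m _; rewrite -scalerAr coefZ coefMXn.
    case: ifP => _; first by rewrite mulr0 raddf0 big1.
    rewrite mulrC mulr_sumr raddf_sum /= big_mkcond [RHS]big_mkcond.
    apply: eq_bigr => v _; have := mlcoefMX B p`_(i - m) v; rewrite /mlcoef /var => ->.
    by case: (v \in B); case: (q0 v == m).
  rewrite (exchange_big_dep (fun v => v \in B)) /=; last by move=> ? ? _ /andP[].
  apply: eq_bigr => v vB; rewrite vB /b; have [le|gt] := leqP (q0 v) n.
    rewrite coefMXn cE (big_rem (q0 v)) ?mem_index_iota ?q0_ge2 ?ltnS //= eqxx.
    rewrite big1_seq ?addr0 // => m /andP[/eqP e].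
    by rewrite -e mem_rem_uniq ?iota_uniq // inE eqxx.
  rewrite mulr0 coef0 big1_seq // => m /andP[/eqP e].
  by rewrite -e mem_index_iota ltnS [(q0 v <= n)%N]leqNgt gt andbF.
have c1 B : c B 1 = (B == set0)%:R.
  apply/polyP => i; rewrite cE coef1 -[in RHS]polyC_natr coefC /mlcoef.
  case: i => [|i] /=; last by rewrite raddf0.
  rewrite mpoly.mcoeff1; congr (nat_of_bool _)%:R.
  apply/eqP/eqP => [/mnmP e|->]; last by apply/mnmP => j; rewrite mesym1E inE mnm0E.
  by apply/setP => j; have := e j; rewrite mesym1E mnm0E inE; case: (j \in B).
have pow := coef_pow_linear c1 cy n A; rewrite expr1n mulr1 in pow.
rewrite -cE pow -polyC_natr coefCM.
have -> : (\prod_(v in A) b v)`_n = (\sum_(v in A) q0 v == n)%N%:R.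
  case: (boolP [forall v in A, (q0 v <= n)%N]) => [/forall_inP H|].
    rewrite (eq_bigr (fun v => 'X^(q0 v))); last by move=> v vA; rewrite /b H.
    by rewrite -expr_sum coefXn eq_sym.
  rewrite negb_forall_in => /exists_inP[v vA nv].
  rewrite (bigD1 v) //= /b (negbTE nv) mul0r coef0.
  rewrite (bigD1 v) //= gtn_eqF // (leq_trans _ (leq_addr _ _)) // ltnNge //.
have [->|A0] := eqVneq A set0.
  by rewrite big_set0 /=; case: n {b cE cy c1 pow c} => [|n]; rewrite ?invr0 ?mul0r // !mulr0.
case: n {b cE cy c1 pow c} => [|n].
  have [v vA] := set0Pn _ A0; rewrite invr0 mul0r (bigD1 v) //= addn_eq0.
  by rewrite [q0 v == 0%N]gtn_eqF ?mulr0 // ltnW.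
rewrite /=; move: A0; rewrite -card_gt0; case: #|A| => // a _.
by rewrite ffactSS natrM !mulrA mulVf ?mul1r // pnatr_eq0.
Qed.

End CumulantSide.

Section CumulantEvaluation.
Variables (l : nat) (q0 : 'I_l -> nat).
Hypothesis q0_ge2 : forall v, (2 <= q0 v)%N.

Let w v := (q0 v - 1)%N.

Lemma sum_weight_card (A : {set 'I_l}) : (\sum_(v in A) q0 v = weight w A + #|A|)%N.
Proof.
rewrite -sum1_card /weight -big_split; apply: eq_bigr => v _ /=.
by rewrite /w subnK // ltnW.
Qed.

(** Balance of block j, n_j - |B_j| = w(B_j), says that n_j is the sum of the colors in B_j, which
    is the condition of [mlcoef_shape_cumulant]. The signs (-1)^(|B_j| - 1) and one factor -1 per
    block multiply to (-1)^l. *)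
Lemma shape_coef_block (I : finType) (F : 'I_l -> I) (n : I -> nat) :
  (\prod_j shape_coef (n j) (block F j)) *
    mobius rat (hall_ok w (block_fun F (fun j => n j - #|block F j|)%N)) [set: 'I_l]%SET =
  (-1) ^+ l * \prod_j mlcoef (block F j) (shape_poly (@mpolyC l rat) (cumulant_poly q0) (n j)).
Proof.
have w_gt0 v : (0 < w v)%N by rewrite subn_gt0.
have [/existsP[j /eqP e]|] := boolP [exists j, block F j == set0].
  rewrite (bigD1 j) //= [in RHS](bigD1 j) //= mlcoef_shape_cumulant // e /shape_coef eqxx /=.
  by rewrite !mul0r mulr0.
rewrite negb_exists => /forallP B0.
have surj j : exists v, F v = j.
  by have [v] := set0Pn _ (B0 j); rewrite inE => /eqP; exists v.
rewrite (@mobius_block _ _ rat _ _ _ surj w_gt0).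
have [/forallP H|] := boolP [forall j, (n j - #|block F j|)%N == weight w (block F j)].
  have lE : l = (\sum_j #|block F j|)%N.
    rewrite -[LHS]card_ord -sum1_card (partition_big F xpredT) //=.
    by apply: eq_bigr => j _; rewrite -sum1_card; apply: eq_bigl => v; rewrite inE.
  rewrite mulr1 [X in (-1) ^+ X * \prod_j _]lE expr_sum -big_split -prodr_const.
  rewrite -big_split /=; apply: eq_bigr => j _.
  have c0 : (0 < #|block F j|)%N by rewrite card_gt0.
  have wB : (0 < weight w (block F j))%N.
    have [v vB] := set0Pn _ (B0 j).
    by rewrite /weight (bigD1 v) //= (leq_trans (w_gt0 v)) // leq_addr.
  have lt : (#|block F j| < n j)%N by rewrite -subn_gt0 (eqP (H j)).
  rewrite mlcoef_shape_cumulant // /shape_coef B0 lt /= sum_weight_card -(eqP (H j)).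
  rewrite subnK ?(ltnW lt) // eqxx mulr1 mulrAC; congr (_ * _).
  by rewrite -exprSr prednK.
rewrite negb_forall => /existsP[j nj].
rewrite !mulr0 (bigD1 j) //= mlcoef_shape_cumulant // B0 sum_weight_card.
case: eqP => [e|_]; last by rewrite mulr0 mul0r mulr0.
by rewrite -e addnK eqxx in nj.
Qed.

Variables (N : nat) (P : mpoly N rat).

Lemma shape_coef_sum :
  \sum_(tau <- mpoly.msupp P) mpoly.mcoeff tau P *
    \sum_(F : {ffun 'I_l -> 'I_(size (mnm_seq tau))})
      (\prod_j shape_coef (mnm_nth j) (block F j)) *
      mobius rat (hall_ok w (block_fun F (degree_fun F))) [set: 'I_l]%SET =
  (-1) ^+ l * mlcoef [set: 'I_l]%SET (mpoly.mmap (@mpolyC l rat)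
    (fun i : 'I_N => shape_poly (@mpolyC l rat) (cumulant_poly q0) i) P).
Proof.
rewrite mlcoef_mmap mulr_sumr; apply: eq_bigr => tau _; rewrite mulrCA; congr (_ * _).
rewrite mulr_sumr; apply: eq_bigr => F _.
exact: (shape_coef_block F (fun j => mnm_nth j)).
Qed.

End CumulantEvaluation.

(** * Moebius functions of factorizations of the full cycle *)

Section FactorizationSide.
Variables (l k : nat) (w : 'I_l -> nat).
Hypothesis k_gt0 : (0 < k)%N.
Variables (s1 s2 : 'S_k) (psi : {ffun cycles s2 -> 'I_l}).
Hypothesis s12 : (s2 * s1)%g = init_cycle k k.
Hypothesis psiP : labelling psi.

Let g := edge_fun (@neighbours l k s1 s2 psi) (fun=> 1%N).

Lemma init_cycle_iter n (i : 'I_k) : ((init_cycle k k ^+ n)%g i = (i + n) %% k :> nat)%N.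
Proof.
elim: n => [|n IH]; first by rewrite expg0 perm1 addn0 modn_small.
rewrite expgSr permM permE init_cycle_funE minnn ltn_ord IH.
by rewrite addnS -addn1 modnDml addn1.
Qed.

Lemma porbit_init_cycle (i j : 'I_k) : i \in porbit (init_cycle k k) j.
Proof.
apply/porbitP; exists (i + (k - j))%N; apply: val_inj; rewrite /= init_cycle_iter //.
by rewrite addnCA subnKC ?(ltnW (ltn_ord j)) // modnDr modn_small.
Qed.

Lemma odd_init_cycle : odd_perm (init_cycle k k) = ~~ odd k.
Proof.
have e : porbits (init_cycle k k) = [set [set: 'I_k]]%SET.
  apply/setP => c; rewrite inE; apply/imsetP/eqP => [[i _ ->]|->].
    by apply/setP => j; rewrite porbit_init_cycle inE.
  by exists (Ordinal k_gt0) => //; apply/setP => j; rewrite porbit_init_cycle inE.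
by rewrite /odd_perm e card_ord cards1 addbT.
Qed.


(** The full cycle has sign (-1)^(k-1), and [s2], having l cycles, has sign (-1)^(k-l). *)
Lemma sign_factor : (-1) ^+ (s1 : bool) = - (-1) ^+ l :> rat.
Proof.
have [_ /eqP cl] := andP psiP; have := congr1 (@odd_perm _) s12.
rewrite odd_permM odd_init_cycle {1}/odd_perm card_ord -card_cycles cl -(signr_odd _ l).
by case: (odd k); case: (odd l); case: (odd_perm s1) => //= _; rewrite ?expr1 ?expr0 ?opprK.
Qed.

Lemma psi_surj v : exists c, psi c = v.
Proof.
have [/injectiveP inj /eqP cl] := andP psiP.
have [h hK Kh] : bijective psi by apply: inj_card_bij => //; rewrite card_ord cl.
by exists (h v).
Qed.

Lemma edge_funT : g [set: 'I_l]%SET = #|porbits s1|.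
Proof.
rewrite /g /edge_fun (eq_bigl xpredT) => [|d]; last by rewrite subsetT.
by rewrite sum1_card card_cycles.
Qed.

(** Otherwise the neighbours of each cycle of [s1] lie all in [A] or all in its complement. The
    points labelled in [A] are then stable under [s1] and [s2], hence under the full cycle, which is
    transitive. *)
Lemma factor_connected (A : {set 'I_l}) : A != set0 -> A != [set: 'I_l]%SET ->
  (g A + g (~: A) < g [set: 'I_l]%SET)%N.
Proof.
move=> A0 AT; pose V := @neighbours l k s1 s2 psi.
have gE B : g B = (\sum_d (V d \subset B))%N by rewrite /g /edge_fun big_mkcond.
have excl d : ~~ ((V d \subset A) && (V d \subset ~: A)).
  apply/negP => /andP[dA dC]; have [v vd] := set0Pn _ (neighbours_neq0 psi d).
  by have := subsetP dC v vd; rewrite inE (subsetP dA).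
rewrite !gE -big_split ltnNge; apply/negP => le.
have each d : (V d \subset A) || (V d \subset ~: A).
  apply: contraLR le => nd; rewrite -ltnNge (bigD1 d) //= [X in (_ < X)%N](bigD1 d) //=.
  rewrite subsetT -addSn; apply: leq_add; first by case: (_ \subset _) (_ \subset _) nd => -[].
  apply: leq_sum => e _; rewrite subsetT; have := excl e.
  by case: (_ \subset _) (_ \subset _) => -[].
pose S := [pred i | psi (cycle_of s2 i) \in A].
have S2 i : S (s2 i) = S i by rewrite /S /= cycle_of_perm.
have S1 i : S (s1 i) = S i.
  have in_V j : cycle_of s1 j = cycle_of s1 i -> psi (cycle_of s2 j) \in V (cycle_of s1 i).
    by move=> e; apply: imset_f; rewrite inE e.
  have v1 := in_V _ (cycle_of_perm s1 i); have v2 := in_V _ erefl.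
  rewrite /S /=; case/orP: (each (cycle_of s1 i)) => /subsetP sub.
    by rewrite !sub.
  by have := sub _ v1; have := sub _ v2; rewrite !inE => /negbTE -> /negbTE ->.
have Sc i : S (init_cycle k k i) = S i by rewrite -s12 permM S1 S2.
have const i j : S i = S j.
  apply: (@invariant_cycle_of _ _ _ S Sc); apply/eqP; rewrite cycle_of_eq.
  exact: porbit_init_cycle.
have [v vA] := set0Pn _ A0.
have /subsetPn[u _ uA] : ~~ ([set: 'I_l]%SET \subset A) by rewrite subTset.
have [c cv] := psi_surj v; have [c' c'u] := psi_surj u.
have [i ic] := cycle_ofP c; have [j jc] := cycle_ofP c'.
by have := const i j; rewrite /S /= ic jc cv c'u vA (negbTE uA).
Qed.

Definition hall_condition : bool :=
  (#|porbits s1| == weight w [set: 'I_l]%SET) &&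
  [forall A : {set 'I_l}, (A != set0) ==> (A != [set: 'I_l]%SET) ==>
    (edge_fun (@neighbours l k s1 s2 psi) (fun=> 1%N) A < weight w A)%N].

Lemma sign_mobius_factor : (-1) ^+ (s1 : bool) * mobius rat (hall_ok w g) [set: 'I_l]%SET =
  (-1) ^+ l * hall_condition%:R.
Proof.
rewrite sign_factor mobius_hall_connected.
- by rewrite mulrNN edge_funT.
- exact: edge_fun_supermodular (neighbours_neq0 psi).
- by rewrite card_ord; case: (psi (cycle_of s2 (Ordinal k_gt0))) => v; exact: leq_ltn_trans.
- exact: factor_connected.
Qed.
End FactorizationSide.

(** Both sides of [mobius_identity] carry the sign (-1)^l, which is cancelled. *)
Lemma mlcoef_eval_cumulant (R : realType) l k N (q0 : 'I_l -> nat)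
    (K : malg (cmonom ge2) int) (T : nat -> mpoly N rat) :
  (0 < k)%N -> (forall v, (2 <= q0 v)%N) -> is_kerov_polynomial R k K ->
  (forall (A : comNzRingType) (iota : {rmorphism rat -> A}) (x : nat -> A),
    mpoly.mmap iota (fun i : 'I_N => shape_poly iota x i) (eval_poly T K) = eval_poly x K) ->
  mlcoef [set: 'I_l]%SET (eval_poly (cumulant_poly q0) K) =
  (\sum_(s : 'S_k * 'S_k | (s.2 * s.1)%g == init_cycle k k)
    #|[set psi | labelling psi & @hall_condition l k (fun v => q0 v - 1)%N s.1 s.2 psi]%SET|)%N%:R.
Proof.
move=> k0 q02 kerov TE; have := mobius_identity (fun v => q0 v - 1)%N kerov TE.
rewrite shape_coef_sum // (TE _ (@mpolyC l rat)).
rewrite (eq_bigr (fun s : 'S_k * 'S_k => (-1) ^+ l *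
  #|[set psi | labelling psi & @hall_condition l k (fun v => q0 v - 1)%N s.1 s.2 psi]%SET|%:R)).
  by rewrite -mulr_sumr natr_sum; apply: mulfI; rewrite signr_eq0.
move=> s /eqP sE; rewrite mulr_sumr.
rewrite -sum1dep_card natr_sum mulr_sumr [RHS]big_mkcondr /=.
apply: eq_bigr => psi psiP; rewrite sign_mobius_factor //.
by case: hall_condition; rewrite ?mulr1 ?mulr0.
Qed.

Lemma eval_poly_from_shapes (K : malg (cmonom ge2) int) :
  exists N (T : nat -> mpoly N rat), forall (A : comNzRingType) (iota : {rmorphism rat -> A})
    (x : nat -> A),
    mpoly.mmap iota (fun i : 'I_N => shape_poly iota x i) (eval_poly T K) = eval_poly x K.
Proof.
pose N := (\max_(s <- monalg.msupp K) \max_(i <- finsupp s) val i).+1.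
have [T TP] := cumulants_from_shapes N; exists N, T => A iota x.
have comm f : commr_rmorph iota f by move=> a; exact: mulrC.
rewrite (rmorph_eval_poly (mpoly.mmap iota (fun i : 'I_N => shape_poly iota x i))).
rewrite /eval_poly /monalg.mmap; apply: eq_big_seq => s sK; congr (_ * _).
rewrite /eval_monomial; apply: eq_big_seq => i si /=; rewrite TP //.
rewrite (valP i) ltnS (big_rem s sK) /= (big_rem i si) /=.
by rewrite -maxnA leq_maxl.
Qed.

(** * Colorings *)

Section ColorSequence.
Implicit Type s : cmonom ge2.

(** Polarization of the monomial: one variable for each of its factors, colored by the index of the
    factor. *)
Definition color_seq s : seq ge2 := flatten [seq nseq (s i) i | i <- finsupp s].
Definition color s (v : 'I_(size (color_seq s))) : ge2 := tnth (in_tuple (color_seq s)) v.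

Lemma count_color_seq s i : count_mem i (color_seq s) = s i.
Proof.
rewrite -sum1_count /color_seq big_flatten big_map /=.
rewrite (eq_bigr (fun j => (j == i) * s i)%N) => [|j _]; last first.
  by rewrite big_nseq_cond; case: eqP => [->|_]; rewrite ?iter_addn_0 // mul1n.
have [si|] := boolP (i \in finsupp s).
  rewrite (big_rem i si) /= eqxx mul1n big1_seq ?addn0 // => j /andP[_].
  by rewrite mem_rem_uniq ?fset_uniq // inE => /andP[/negbTE -> _].
by rewrite memNfinsupp => /eqP ->; rewrite big1 // => j _; rewrite muln0.
Qed.

Lemma card_color s i : #|[set v | @color s v == i]%SET| = s i.
Proof.
rewrite -count_color_seq -sum1_count (big_tnth _ _ (color_seq s)) -sum1_card.
by apply: eq_bigl => v; rewrite inE.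
Qed.

Lemma size_color_seq s : size (color_seq s) = (\sum_(i <- finsupp s) s i)%N.
Proof.
rewrite size_flatten /shape -map_comp sumnE big_map.
by apply: eq_bigr => i _; rewrite /= size_nseq.
Qed.

Lemma sum_color s (f : ge2 -> nat) :
  (\sum_v f (@color s v) = \sum_(i <- finsupp s) f i * s i)%N.
Proof.
rewrite -(big_tnth _ _ (color_seq s) xpredT f) big_flatten big_map.
by apply: eq_bigr => i _; rewrite big_nseq iter_addn_0.
Qed.

Lemma color_finsupp s v : @color s v \in finsupp s.
Proof.
rewrite mem_finsupp -lt0n -card_color; apply/card_gt0P; exists v.
by rewrite inE.
Qed.

Lemma eval_monomial_color (A : comNzRingType) (y : nat -> A) s :
  eval_monomial y s = \prod_(j < size (color_seq s)) y (val (color j)).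
Proof.
rewrite -(big_tnth _ _ (color_seq s) xpredT (fun i => y (val i))) big_flatten big_map.
by apply: eq_bigr => i _; rewrite big_nseq iter_mulr_1.
Qed.

End ColorSequence.

Section Recolorings.
Variables (X : eqType) (l : nat) (c0 : 'I_l -> X).

(** For [color s] this is \prod_i s_i!; since it cancels at the end, it only matters that it is
    nonzero. *)
Definition recolorings : nat :=
  #|[set psi : {ffun 'I_l -> 'I_l} | injectiveb psi & [forall v, c0 (psi v) == c0 v]]%SET|.

Lemma recolorings_gt0 : (0 < recolorings)%N.
Proof.
apply/card_gt0P; exists [ffun v => v]; rewrite inE; apply/andP; split.
  by apply/injectiveP => u v; rewrite !ffunE.
by apply/forallP => v; rewrite ffunE.
Qed.

Variables (C : finType) (q : C -> X).

Lemma color_bij : (forall i, #|[set c | q c == i]%SET| = #|[set v | c0 v == i]%SET|) ->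
  exists2 beta : C -> 'I_l, bijective beta & forall c, c0 (beta c) = q c.
Proof.
move=> cnt; pose t : l.-tuple X := [tuple c0 v | v < l].
have tE : t = map c0 (enum 'I_l) :> seq X by [].
have countE (D : finType) (f : D -> X) x : count_mem x [seq f c | c <- enum D] =
    #|[set c | f c == x]%SET|.
  rewrite count_map -sum1_count big_enum_cond -sum1_card.
  by apply: eq_bigl => c; rewrite !inE.
have pe : perm_eq [seq q c | c <- enum C] t.
  by apply/allP => x _ /=; rewrite tE !countE cnt.
have cardC : #|C| = l by rewrite cardE -(size_map q) (perm_size pe) size_tuple.
have /tuple_permP[p pE] := pe.
exists (fun c => p (cast_ord cardC (enum_rank c))).
  apply: inj_card_bij; last by rewrite card_ord cardC.
  by move=> c c' /perm_inj/cast_ord_inj/enum_rank_inj.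
move=> c; have := congr1 (fun r => nth (q c) r (enum_rank c)) pE.
rewrite (nth_map c) -?cardE // nth_enum_rank => ->.
rewrite -[enum_rank c : nat]/(cast_ord cardC (enum_rank c) : nat) -tnth_nth !tnth_mktuple.
by [].
Qed.

Lemma recolorings_some : (forall i, #|[set c | q c == i]%SET| = #|[set v | c0 v == i]%SET|) ->
  #|[set psi : {ffun C -> 'I_l} | injectiveb psi && (#|C| == l) &
      [forall c, c0 (psi c) == q c]]%SET| = recolorings.
Proof.
move=> /color_bij[beta beta_bij betaE].
have cardC : #|C| = l by rewrite -[RHS]card_ord; exact: bij_eq_card beta_bij.
have [beta' betaK betaK'] := beta_bij.
pose h (psi : {ffun 'I_l -> 'I_l}) := [ffun c => psi (beta c)].
rewrite /recolorings -(card_imset (f := h)) => [|f g e]; last first.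
  by apply/ffunP => v; have /ffunP/(_ (beta' v)) := e; rewrite !ffunE betaK'.
apply: eq_card => psi; rewrite inE cardC eqxx andbT.
apply/andP/imsetP => [[/injectiveP inj /forallP H]|[f]].
  exists [ffun v => psi (beta' v)]; last by apply/ffunP => c; rewrite !ffunE betaK.
  rewrite inE; apply/andP; split.
    by apply/injectiveP => u v; rewrite !ffunE => /inj/(can_inj betaK').
  by apply/forallP => v; rewrite ffunE (eqP (H _)) -betaE betaK'.
rewrite inE => /andP[/injectiveP inj /forallP H] ->; split.
  by apply/injectiveP => u v; rewrite !ffunE => /inj/(can_inj betaK).
by apply/forallP => c; rewrite ffunE (eqP (H _)) betaE.
Qed.

Lemma recoloring_count (psi : C -> 'I_l) i : injective psi -> #|C| = l ->
  (forall c, c0 (psi c) = q c) -> #|[set c | q c == i]%SET| = #|[set v | c0 v == i]%SET|.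
Proof.
move=> inj cl H; rewrite -(card_imset _ inj).
have [psi' psiK psiK'] : bijective psi by apply: inj_card_bij => //; rewrite card_ord cl.
apply: eq_card => v; rewrite inE; apply/imsetP/idP => [[c]|vi].
  by rewrite inE -H => ci ->.
by exists (psi' v); rewrite ?inE -?H psiK'.
Qed.

End Recolorings.

(** A multilinear term comes from a color-preserving bijection between the factors of [s'] and the
    variables of [s], which forces [s' = s]. *)
Lemma mlcoef_eval_monomial (s s' : cmonom ge2) :
  mlcoef [set: 'I_(size (color_seq s))]%SET
    (eval_monomial (cumulant_poly (fun v => val (@color s v))) s') =
  (s' == s)%:R * (recolorings (@color s))%:R.
Proof.
rewrite eval_monomial_color /cumulant_poly bigA_distr_big_dep /=.
rewrite /mlcoef raddf_sum /=.
under eq_bigr => psi _ do rewrite -/(mlcoef _ _) mlcoef_var_prod card_ord.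
transitivity (#|[set psi : {ffun 'I_(size (color_seq s')) -> 'I_(size (color_seq s))} |
    injectiveb psi && (#|'I_(size (color_seq s'))| == size (color_seq s)) &
      [forall c, color (psi c) == color c]]%SET|%:R : rat).
  rewrite -sum1dep_card natr_sum big_mkcond [RHS]big_mkcond; apply: eq_bigr => psi _.
  have -> : (psi \in family (fun j => [pred v | val (color v) == val (color j)])) =
      [forall c, color (psi c) == color c].
    by apply/familyP/forallP => H c; have := H c; rewrite inE val_eqE.
  by rewrite card_ord; case: [forall c, _]; case: (injectiveb _ && _).
have [e|ne] := eqVneq s' s; rewrite ?mul0r ?mul1r.
  by rewrite recolorings_some // => i; rewrite !card_color e.
apply/eqP; rewrite pnatr_eq0 cards_eq0; apply: contraNT ne => /set0Pn[psi].
rewrite inE => /andP[/andP[/injectiveP inj /eqP cl] /forallP H].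
apply/cmP => i; rewrite -!card_color.
by apply: (recoloring_count i inj cl) => c; apply/eqP.
Qed.

Lemma mlcoef_eval_poly (s : cmonom ge2) (K : malg (cmonom ge2) int) :
  mlcoef [set: 'I_(size (color_seq s))]%SET
    (eval_poly (cumulant_poly (fun v => val (@color s v))) K) =
  (mcoeff s K)%:~R * (recolorings (@color s))%:R.
Proof.
rewrite /eval_poly /monalg.mmap /mlcoef raddf_sum /=.
rewrite (eq_bigr (fun s' => (mcoeff s' K)%:~R * ((s' == s)%:R * (recolorings (@color s))%:R))).
  have [sK|] := boolP (s \in monalg.msupp K).
    rewrite (big_rem s sK) /= eqxx mul1r big1_seq ?addr0 // => s' /andP[_].
    by rewrite mem_rem_uniq ?fset_uniq // inE => /andP[/negbTE -> _]; rewrite mul0r mulr0.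
  move=> sK; rewrite mcoeff_outdom // mul0r big1_seq // => s' /andP[_ s'K].
  by case: eqP s'K => [->|_]; rewrite ?(negbTE sK) // mul0r mulr0.
move=> s' _; rewrite -mlcoef_eval_monomial /mlcoef.
by rewrite !mulrzl raddfMz.
Qed.

Lemma mem_union_support k (s2 : 'S_k) (A : {set cycles s2}) i :
  (i \in union_support A) = (cycle_of s2 i \in A).
Proof.
apply/finset.bigcupP/idP => [[c cA]|iA]; first by rewrite mem_cycle_of => /eqP ->.
by exists (cycle_of s2 i); rewrite ?mem_cycle_of.
Qed.

(** * Hall conditions and admissible colorings *)

Section Matching.
Variables (k : nat) (s : cmonom ge2) (s1 s2 : 'S_k).
Local Notation l := (size (color_seq s)).
Variables (psi : {ffun cycles s2 -> 'I_l}) (q : {ffun cycles s2 -> ge2}).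
Hypothesis psiP : labelling psi.
Hypothesis psi_q : forall c, color (psi c) = q c.
Let w (v : 'I_l) := (val (color v) - 1)%N.
Let g := edge_fun (@neighbours l k s1 s2 psi) (fun=> 1%N).
Implicit Type A : {set cycles s2}.

Let psi_inj : injective psi.
Proof. by have [/injectiveP] := andP psiP. Qed.

(** A cycle of [s1] avoids the union of [A] exactly when all its neighbours lie outside psi(A). *)
Lemma card_meeting A :
  (#|[set d in porbits s1 | d :&: union_support A != set0]%SET| + g (~: (psi @: A)%SET) =
   #|porbits s1|)%N.
Proof.
rewrite -[RHS]card_cycles /g /edge_fun sum1_card.
rewrite -(cardC [pred d | neighbours psi d \subset ~: (psi @: A)%SET]).
rewrite addnC; congr (_ + _)%N.
rewrite -[RHS](card_imset _ val_inj); apply: eq_card => d; rewrite inE.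
apply/andP/imsetP => [[dP meet]|[d' nd' ->]].
  exists (exist _ d dP) => //; rewrite !inE; move: meet; apply: contraNN => /subsetP sub.
  apply/eqP/setP => i; rewrite !inE mem_union_support; apply/negbTE/negP => /andP[id iA].
  have vin : psi (cycle_of s2 i) \in neighbours psi (exist _ d dP : cycles s1).
    by apply: imset_f; rewrite inE -mem_cycle_of.
  by have := sub _ vin; rewrite inE imset_f.
split; first exact: valP.
move: nd'; rewrite !inE; apply: contraNN => /eqP e; apply/subsetP => v.
case/imsetP => i; rewrite inE -mem_cycle_of => id ->; rewrite inE (mem_imset _ _ psi_inj).
by apply/negP => iA; have /setP/(_ i) := e; rewrite !inE id mem_union_support iA.
Qed.

Lemma weight_labels A : weight w (psi @: A)%SET = (\sum_(c in A) (val (q c) - 1))%N.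
Proof.
rewrite /weight big_imset /= => [|c c' _ _]; last exact: psi_inj.
by apply: eq_bigr => c _; rewrite /w psi_q.
Qed.

Lemma weight_complement (B : {set 'I_l}) : (weight w B + weight w (~: B) = weight w [set: 'I_l]%SET)%N.
Proof. by rewrite weightUI setUCr setICr weight0 addn0. Qed.

Lemma hall_conditionP : (s2 * s1)%g = init_cycle k k ->
  hall_condition w s1 psi <-> admissible s (ColoredFactorization s1 q).
Proof.
move=> s12; have [_ /eqP cardC] := andP psiP.
have color_ge2 v : (2 <= val (@color s v))%N by exact: valP.
have wT : (\sum_(i <- finsupp s) val i * s i = weight w [set: 'I_l]%SET + l)%N.
  rewrite -sum_color -(eq_bigl _ _ (fun v => in_setT v)) sum_weight_card //.
  by rewrite cardsT card_ord.
have [h hK Kh] : bijective psi by apply: inj_card_bij => //; rewrite card_ord cardC.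
have compl (B : {set 'I_l}) : B = ~: (psi @: [set c | psi c \notin B])%SET.
  by apply/setP => v; rewrite inE -[v in RHS]Kh (mem_imset _ _ psi_inj) inE Kh negbK.
have complT A : (~: (psi @: A)%SET == [set: 'I_l]%SET) = (A == set0).
  apply/eqP/eqP => [/setP e|->]; last by rewrite imset0 setC0.
  by apply/setP => c; have := e (psi c); rewrite !inE (mem_imset _ _ psi_inj) => /negbTE.
have compl0 A : (~: (psi @: A)%SET == set0) = (A == [set: cycles s2]%SET).
  apply/eqP/eqP => [/setP e|->].
    by apply/setP => c; have := e (psi c); rewrite !inE (mem_imset _ _ psi_inj) => /negbFE.
  by apply/setP => v; rewrite !inE -[v]Kh imset_f.
(* By [card_meeting], g(~psi(A)) plus the number of cycles meeting [A] equals w(~psi(A)) +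
   w(psi(A)); so one inequality is the other read on the complement. *)
have hall A : #|porbits s1| = weight w [set: 'I_l]%SET ->
    (g (~: (psi @: A)%SET) < weight w (~: (psi @: A)%SET))%N =
    (\sum_(c in A) (val (q c) - 1) <
               #|[set d in porbits s1 | d :&: union_support A != set0]%SET|)%N.
  move=> e; rewrite -weight_labels; have := weight_complement (psi @: A)%SET.
  rewrite -e -(card_meeting A); move: (weight _ _) (weight _ _) (g _) #|_| => a b c d abcd.
  by rewrite -(ltn_add2l b) abcd ltn_add2r.
split=> [/andP[/eqP gT /forallP H]|[_ _ C _ E]].
  split.
  - by move=> i; rewrite -s12 permM.
  - by rewrite -card_cycles cardC size_color_seq.
  - by rewrite wT gT -[#|porbits s2|]card_cycles cardC.
  - by move=> i; rewrite (recoloring_count i psi_inj cardC psi_q) card_color.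
  move=> A A0 AT; rewrite -hall //.
  by have := H (~: (psi @: A)%SET); rewrite complT compl0 A0 AT.
have gT : #|porbits s1| = weight w [set: 'I_l]%SET.
  by move: C; rewrite wT -[#|porbits s2|]card_cycles cardC => /addIn.
apply/andP; split; first by rewrite gT.
apply/forallP => B; rewrite [B]compl complT compl0; apply/implyP => AT; apply/implyP => A0.
by rewrite hall // E.
Qed.

End Matching.

Section CountAdmissible.
Variables (k : nat) (s : cmonom ge2).
Local Notation l := (size (color_seq s)).

(* An admissible coloring only uses colors from the finite set [finsupp s]. *)
Definition supported_coloring (ss : 'S_k * 'S_k) : finType := {ffun cycles ss.2 -> finsupp s}.

Definition to_factorization (u : {ss : 'S_k * 'S_k & supported_coloring ss}) :
    colored_factorization k :=
  ColoredFactorization (tag u).1 [ffun c => val (tagged u c) : ge2].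

Definition admissible_set : {set {ss : 'S_k * 'S_k & supported_coloring ss}} :=
  [set u | `[< admissible s (to_factorization u) >]]%SET.

Lemma to_factorization_inj : injective to_factorization.
Proof.
move=> [[s1 s2] q] [[s1' s2'] q'] e.
(* The type of the coloring depends on [s2], so the permutations are identified before the colorings
   are compared. *)
have [e1 e2] := (congr1 (@sigma1 k) e, congr1 (@sigma2 k) e); rewrite /= in e1 e2.
case: _ / e1 e => e; case: _ / e2 q' e => q' e.
have qq' := eq_from_Tagged (congr1 (fun t : colored_factorization k =>
  Tagged (fun s2 : 'S_k => {ffun cycles s2 -> ge2}) (coloring t)) e).
congr existT; apply/ffunP => c; apply: val_inj.
by have := congr1 (fun f : {ffun _ -> _} => f c) qq'; rewrite !ffunE.
Qed.

Lemma card_admissible :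
  ([set t : colored_factorization k | admissible s t]%classic #= `I_#|admissible_set|%classic)%card.
Proof.
have -> : [set t : colored_factorization k | admissible s t]%classic =
    ((to_factorization \o @enum_val _ (mem admissible_set)) @` [set: 'I_#|admissible_set|])%classic.
  apply/seteqP; split=> [[s1 s2 q] adm|t [j _ <-]]; last first.
    by have := enum_valP j; rewrite inE => /asboolP.
  have [_ _ _ D _] := adm.
  have qs c : q c \in finsupp s.
    rewrite mem_finsupp -D -lt0n; apply/card_gt0P; exists c.
    by rewrite inE.
  pose u : {ss : 'S_k * 'S_k & supported_coloring ss} :=
    Tagged supported_coloring (i := (s1, s2)) [ffun c => [` qs c]%fset].
  have uE : to_factorization u = ColoredFactorization s1 q.
    by congr ColoredFactorization; apply/ffunP => c; rewrite !ffunE.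
  have uA : u \in admissible_set by rewrite inE uE; apply/asboolP.
  by exists (enum_rank_in uA u); rewrite //= enum_rankK_in.
apply: card_eq_trans (card_esym card_II).
apply: inj_card_eq => i j _ _ /=.
by move=> /to_factorization_inj/enum_val_inj.
Qed.

(** Labellings satisfying the Hall condition are grouped by the coloring they induce: an admissible
    one arises from [recolorings (@color s)] of them, any other from none. *)
Lemma card_labellings :
  (\sum_(ss : 'S_k * 'S_k | (ss.2 * ss.1)%g == init_cycle k k)
    #|[set psi | labelling psi &
         @hall_condition l k (fun v => val (color v) - 1)%N ss.1 ss.2 psi]%SET| =
   #|admissible_set| * recolorings (@color s))%N.
Proof.
rewrite -sum1_card big_mkcond /=.
pose adm (ss : 'S_k * 'S_k) (q : supported_coloring ss) : bool :=
  `[< admissible s (to_factorization (Tagged supported_coloring q)) >].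
transitivity (\sum_(ss : 'S_k * 'S_k) \sum_(q : supported_coloring ss) 
   adm ss q * recolorings (@color s))%N; last first.
  rewrite sig_big_dep /= -big_distrl /=; congr (_ * _)%N.
  by rewrite [RHS]big_mkcond; apply: eq_bigr => -[ss q] _; rewrite inE -/(adm ss q); case: (adm ss q).
rewrite big_mkcond; apply: eq_bigr => ss _; case: ifP => [/eqP s12|ns].
  pose col v : finsupp s := [` @color_finsupp s v]%fset.
  rewrite -sum1_card (partition_big (fun psi : {ffun cycles ss.2 -> 'I_l} =>
    [ffun c => col (psi c)] : supported_coloring ss) xpredT) //=.
  apply: eq_bigr => q _; rewrite sum1dep_card.
  pose q' := [ffun c => val (q c) : ge2].
  have qE (psi : {ffun cycles ss.2 -> 'I_l}) : ([ffun c => col (psi c)] == q) =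
      [forall c, color (psi c) == q' c].
    apply/eqP/forallP => [/ffunP H c|H]; first by rewrite ffunE -H ffunE.
    by apply/ffunP => c; apply: val_inj; have /eqP := H c; rewrite !ffunE.
  rewrite /adm; have [a|na] := boolP `[< _ >].
    have [_ _ _ D _] := asboolP _ a.
    rewrite mul1n -(@recolorings_some _ _ (@color s) _ q') => [|c]; last by rewrite D card_color.
    apply: eq_card => psi; rewrite !inE qE -andbA; apply: andb_id2l => psiP.
    case: forallP => H; rewrite ?andbF // andbT.
    have [_] := @hall_conditionP _ _ ss.1 _ _ q' psiP (fun c => eqP (H c)) s12.
    by apply; apply/asboolP.
  rewrite mul0n; apply: eq_card0 => psi; rewrite !inE qE.
  apply: contraNF na => /andP[/andP[psiP hall] /forallP H].
  have [adm_q _] := @hall_conditionP _ _ ss.1 _ _ q' psiP (fun c => eqP (H c)) s12.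
  by apply/asboolP/adm_q.
rewrite big1 // => q _; rewrite /adm; case: asboolP => // -[A _ _ _ _].
case/negP: ns; apply/eqP/permP => i.
by rewrite permM A.
Qed.

End CountAdmissible.

Theorem theorem1p4 (R : realType) (k : nat) (k_ge1 : (1 <= k)%N)
    (K : malg (cmonom ge2) int) (K_kerov : is_kerov_polynomial R k K)
    (s : cmonom ge2) :
  exists2 N : nat,
    ([set t : colored_factorization k | admissible s t]%classic #= `I_N%classic)%card
    & mcoeff s K = N%:Z.
Proof.
exists #|admissible_set k s|; first exact: card_admissible.
have [N [T TE]] := eval_poly_from_shapes K.
have := mlcoef_eval_cumulant k_ge1 (fun v => valP (@color s v)) K_kerov TE.
rewrite mlcoef_eval_poly card_labellings natrM.
(* Both sides count each solution with this multiplicity, which is divided out. *)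
have Z : (recolorings (@color s))%:R != 0 :> rat.
  by rewrite pnatr_eq0 -lt0n recolorings_gt0.
by move=> /(mulIf Z)/eqP; rewrite pmulrn eqr_int => /eqP.
Qed.
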